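(* For each $m\ge2$, the $\Sigma^1_1$-definable (equivalently, the $\Sigma^B_1$-definable) functions of $V^0(m)$ are precisely the functions in $\mathrm{FAC}^0(m)$, and the $\Sigma^1_1$-definable (equivalently $\Sigma^B_1$-definable) functions of $V\!ACC$ are precisely the functions in $\mathrm{FACC}$.
   Context: Two-sorted logic with number and string variables (strings intended as finite subsets of $\mathbb N$), vocabulary $\mathcal L^2_A=\{0,1,+,\cdot,|\cdot|,\in,\le,=_1,=_2\}$, $|X|$ intended as $1+\max X$. $\Sigma^B_0$: no string quantifiers, bounded number quantifiers; $\Sigma^B_1$ / $\Sigma^1_1$: $\Sigma^B_0$ preceded by bounded / unbounded existential string quantifiers. $V^0$: basic axioms B1–B12 for $0,1,+,\cdot,\le$ (including $x\ne0\supset\exists y<x(y+1=x)$), L1 $X(y)\supset y<|X|$, L2 $y+1=|X|\supset X(y)$, extensionality $X=Y\leftrightarrow[|X|=|Y|\wedge\forall z<|X|(X(z)\leftrightarrow Y(z))]$, $\Sigma^B_0$-comprehension $\exists X\le a\forall z<a(X(z)\leftrightarrow\varphi(z))$. Pairing $\langle x,y\rangle=(x+y)(x+y+1)+2y$, $Y(z,y)$ means $Y(\langle z,y\rangle)$. For $m\ge2$ (as a numeral), $\varphi(y\bmod m)$ abbreviates $\exists r<m\exists q\le y(y=qm+r\wedge\varphi(r))$, and $\varphi_{\mathrm{MOD}_m}(X,Y)$ is $[\forall z\le|X|\exists!y<m\,Y(z,y)]\wedge Y(0,0)\wedge\forall z<|X|\forall y<m(Y(z,y)\supset[(X(z)\supset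 Y(z+1,y+1\bmod m))\wedge(\neg X(z)\supset Y(z+1,y))])$. $\mathrm{MOD}_m$ is $\forall X\exists Y\varphi_{\mathrm{MOD}_m}(X,Y)$; $V^0(m)=V^0\cup\{\mathrm{MOD}_m\}$; $V\!ACC=V^0\cup\{\mathrm{MOD}_m:m\ge2\}$. A function $F$ is $\Phi$-definable in $T$ if for some $\Phi$ formula $\varphi$, $Y=F(\vec x,\vec X)\leftrightarrow\varphi(\vec x,\vec X,Y)$ (intended interpretation) and $T\vdash\forall\vec x\forall\vec X\exists!Y\varphi$. $\mathrm{mod}_m(z,X)=|\{x\in X:x<z\}|\bmod m$; $\mathrm{AC}^0(m)$ is the class of relations $\mathrm{AC}^0$-reducible to $\mathrm{mod}_m$ (i.e. represented by a $\Sigma^B_0$ formula over $\mathrm{mod}_m$ and a finite chain of p-bounded string functions each with bit graph $\Sigma^B_0$-definable from $\mathrm{mod}_m$ and the earlier ones); $\mathrm{FAC}^0(m)$ is the class of p-bounded number functions with graph in $\mathrm{AC}^0(m)$ and p-bounded string functions with bit graph in $\mathrm{AC}^0(m)$; $\mathrm{FACC}=\bigcup_{m\ge2}\mathrm{FAC}^0(m)$. *)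

(* Defs.v *)
From Stdlib Require List.
From mathcomp Require Import all_boot.
Set Implicit Arguments. Unset Strict Implicit. Unset Printing Implicit Defensive.

(* Strings = finite subsets of N, canonically represented by their bit
   sequence with no trailing [false]; |X| = size = 1 + max X (0 if empty).  *)
Record str := Str { sbits : seq bool; sbits_ok : last true sbits }.
Definition sempty : str := @Str [::] erefl.
Definition slen (X : str) : nat := size (sbits X).
Definition smem (X : str) (n : nat) : bool := nth false (sbits X) n.

Definition scons {A : Type} (a : A) (f : nat -> A) (n : nat) : A :=
  match n with 0 => a | k.+1 => f k end.

(* Syntax of L^2_A (de Bruijn indices, separately for the two sorts).
   String terms are just string variables.                                 *)
Inductive term : Type :=
| TVar (n : nat) | TZero | TOne | TPlus (t u : term) | TTimes (t u : term)
| TLen (X : nat).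

Inductive form : Type :=
| FBot
| FLe (t u : term) | FEq1 (t u : term)
| FIn (t : term) (X : nat)
| FEq2 (X Y : nat)
| FImp (p q : form) | FAnd (p q : form) | FOr (p q : form)
| FAll1 (p : form) | FEx1 (p : form)
| FAll2 (p : form) | FEx2 (p : form).

Definition fneg p := FImp p FBot.
Definition fiff p q := FAnd (FImp p q) (FImp q p).
Definition flt t u := FAnd (FLe t u) (fneg (FEq1 t u)).
Fixpoint numeral (n : nat) : term :=
  match n with 0 => TZero | k.+1 => TPlus (numeral k) TOne end.

Fixpoint tsubst (s1 : nat -> term) (s2 : nat -> nat) (t : term) : term :=
  match t with
  | TVar n => s1 n
  | TZero => TZero | TOne => TOne
  | TPlus a b => TPlus (tsubst s1 s2 a) (tsubst s1 s2 b)
  | TTimes a b => TTimes (tsubst s1 s2 a) (tsubst s1 s2 b)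
  | TLen X => TLen (s2 X)
  end.

Definition shift1t (t : term) := tsubst (fun n => TVar n.+1) id t.
Definition shift2t (t : term) := tsubst TVar S t.
Definition up1 (s1 : nat -> term) : nat -> term := scons (TVar 0) (fun n => shift1t (s1 n)).
Definition up2 (s2 : nat -> nat) : nat -> nat := scons 0 (fun n => (s2 n).+1).

Fixpoint fsubst (s1 : nat -> term) (s2 : nat -> nat) (p : form) : form :=
  match p with
  | FBot => FBot
  | FLe t u => FLe (tsubst s1 s2 t) (tsubst s1 s2 u)
  | FEq1 t u => FEq1 (tsubst s1 s2 t) (tsubst s1 s2 u)
  | FIn t X => FIn (tsubst s1 s2 t) (s2 X)
  | FEq2 X Y => FEq2 (s2 X) (s2 Y)
  | FImp a b => FImp (fsubst s1 s2 a) (fsubst s1 s2 b)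
  | FAnd a b => FAnd (fsubst s1 s2 a) (fsubst s1 s2 b)
  | FOr a b => FOr (fsubst s1 s2 a) (fsubst s1 s2 b)
  | FAll1 a => FAll1 (fsubst (up1 s1) s2 a)
  | FEx1 a => FEx1 (fsubst (up1 s1) s2 a)
  | FAll2 a => FAll2 (fsubst (fun n => shift2t (s1 n)) (up2 s2) a)
  | FEx2 a => FEx2 (fsubst (fun n => shift2t (s1 n)) (up2 s2) a)
  end.

Definition shift1 p := fsubst (fun n => TVar n.+1) id p.
Definition shift2 p := fsubst TVar S p.
Definition inst1 (t : term) p := fsubst (scons t TVar) id p.
Definition inst2 (Y : nat) p := fsubst TVar (scons Y id) p.

Fixpoint tnb (n : nat) (t : term) : Prop :=
  match t with
  | TVar i => i < n
  | TPlus a b | TTimes a b => tnb n a /\ tnb n b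
  | _ => True
  end.
Fixpoint tsb (l : nat) (t : term) : Prop :=
  match t with
  | TLen X => X < l
  | TPlus a b | TTimes a b => tsb l a /\ tsb l b
  | _ => True
  end.
Fixpoint fnb (n : nat) (p : form) : Prop :=
  match p with
  | FBot | FEq2 _ _ => True
  | FLe t u | FEq1 t u => tnb n t /\ tnb n u
  | FIn t _ => tnb n t
  | FImp a b | FAnd a b | FOr a b => fnb n a /\ fnb n b
  | FAll1 a | FEx1 a => fnb n.+1 a
  | FAll2 a | FEx2 a => fnb n a
  end.
Fixpoint fsb (l : nat) (p : form) : Prop :=
  match p with
  | FBot => True
  | FEq2 X Y => X < l /\ Y < l
  | FLe t u | FEq1 t u => tsb l t /\ tsb l u
  | FIn t X => tsb l t /\ X < l
  | FImp a b | FAnd a b | FOr a b => fsb l a /\ fsb l b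
  | FAll1 a | FEx1 a => fsb l a
  | FAll2 a | FEx2 a => fsb l.+1 a
  end.
Definition closed (p : form) : Prop := fnb 0 p /\ fsb 0 p.

Definition close (n l : nat) (p : form) : form := iter n FAll1 (iter l FAll2 p).

Inductive sigB0 : form -> Prop :=
| sB0_bot : sigB0 FBot
| sB0_le t u : sigB0 (FLe t u)
| sB0_eq1 t u : sigB0 (FEq1 t u)
| sB0_in t X : sigB0 (FIn t X)
| sB0_eq2 X Y : sigB0 (FEq2 X Y)
| sB0_imp p q : sigB0 p -> sigB0 q -> sigB0 (FImp p q)
| sB0_and p q : sigB0 p -> sigB0 q -> sigB0 (FAnd p q)
| sB0_or p q : sigB0 p -> sigB0 q -> sigB0 (FOr p q)
| sB0_exle t p : sigB0 p -> sigB0 (FEx1 (FAnd (FLe (TVar 0) (shift1t t)) p))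
| sB0_exlt t p : sigB0 p -> sigB0 (FEx1 (FAnd (flt (TVar 0) (shift1t t)) p))
| sB0_allle t p : sigB0 p -> sigB0 (FAll1 (FImp (FLe (TVar 0) (shift1t t)) p))
| sB0_alllt t p : sigB0 p -> sigB0 (FAll1 (FImp (flt (TVar 0) (shift1t t)) p)).

Inductive sigB1 : form -> Prop :=
| sB1_base p : sigB0 p -> sigB1 p
| sB1_ex t p : sigB1 p -> sigB1 (FEx2 (FAnd (FLe (TLen 0) (shift2t t)) p)).

Inductive sig11 : form -> Prop :=
| s11_base p : sigB0 p -> sig11 p
| s11_ex p : sig11 p -> sig11 (FEx2 p).

Inductive ND : list form -> form -> Prop :=
| nd_ax G p : List.In p G -> ND G p
| nd_botE G p : ND G FBot -> ND G p
| nd_raa G p : ND (fneg p :: G) FBot -> ND G p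
| nd_impI G p q : ND (p :: G) q -> ND G (FImp p q)
| nd_impE G p q : ND G (FImp p q) -> ND G p -> ND G q
| nd_andI G p q : ND G p -> ND G q -> ND G (FAnd p q)
| nd_andE1 G p q : ND G (FAnd p q) -> ND G p
| nd_andE2 G p q : ND G (FAnd p q) -> ND G q
| nd_orI1 G p q : ND G p -> ND G (FOr p q)
| nd_orI2 G p q : ND G q -> ND G (FOr p q)
| nd_orE G p q r : ND G (FOr p q) -> ND (p :: G) r -> ND (q :: G) r -> ND G r
| nd_all1I G p : ND (map shift1 G) p -> ND G (FAll1 p)
| nd_all1E G p t : ND G (FAll1 p) -> ND G (inst1 t p)
| nd_ex1I G p t : ND G (inst1 t p) -> ND G (FEx1 p)
| nd_ex1E G p q : ND G (FEx1 p) -> ND (p :: map shift1 G) (shift1 q) -> ND G q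
| nd_all2I G p : ND (map shift2 G) p -> ND G (FAll2 p)
| nd_all2E G p Y : ND G (FAll2 p) -> ND G (inst2 Y p)
| nd_ex2I G p Y : ND G (inst2 Y p) -> ND G (FEx2 p)
| nd_ex2E G p q : ND G (FEx2 p) -> ND (p :: map shift2 G) (shift2 q) -> ND G q
| nd_refl1 G t : ND G (FEq1 t t)
| nd_leib1 G t u p : ND G (FEq1 t u) -> ND G (inst1 t p) -> ND G (inst1 u p)
| nd_refl2 G X : ND G (FEq2 X X)
| nd_leib2 G X Y p : ND G (FEq2 X Y) -> ND G (inst2 X p) -> ND G (inst2 Y p).

Definition Provable (T : form -> Prop) (p : form) : Prop :=
  exists G, (forall q, List.In q G -> T q) /\ ND G p.

Definition nv := TVar.
Definition B1 := FAll1 (fneg (FEq1 (TPlus (nv 0) TOne) TZero)).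
Definition B2 := FAll1 (FAll1 (FImp (FEq1 (TPlus (nv 1) TOne) (TPlus (nv 0) TOne))
                                    (FEq1 (nv 1) (nv 0)))).
Definition B3 := FAll1 (FEq1 (TPlus (nv 0) TZero) (nv 0)).
Definition B4 := FAll1 (FAll1 (FEq1 (TPlus (nv 1) (TPlus (nv 0) TOne))
                                    (TPlus (TPlus (nv 1) (nv 0)) TOne))).
Definition B5 := FAll1 (FEq1 (TTimes (nv 0) TZero) TZero).
Definition B6 := FAll1 (FAll1 (FEq1 (TTimes (nv 1) (TPlus (nv 0) TOne))
                                    (TPlus (TTimes (nv 1) (nv 0)) (nv 1)))).
Definition B7 := FAll1 (FAll1 (FImp (FAnd (FLe (nv 1) (nv 0)) (FLe (nv 0) (nv 1)))
                                    (FEq1 (nv 1) (nv 0)))).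
Definition B8 := FAll1 (FAll1 (FLe (nv 1) (TPlus (nv 1) (nv 0)))).
Definition B9 := FAll1 (FLe TZero (nv 0)).
Definition B10 := FAll1 (FAll1 (FOr (FLe (nv 1) (nv 0)) (FLe (nv 0) (nv 1)))).
Definition B11 := FAll1 (FAll1 (fiff (FLe (nv 1) (nv 0)) (flt (nv 1) (TPlus (nv 0) TOne)))).
Definition B12 := FAll1 (FImp (fneg (FEq1 (nv 0) TZero))
                    (FEx1 (FAnd (flt (nv 0) (nv 1)) (FEq1 (TPlus (nv 0) TOne) (nv 1))))).
Definition L1 := FAll2 (FAll1 (FImp (FIn (nv 0) 0) (flt (nv 0) (TLen 0)))).
Definition L2 := FAll2 (FAll1 (FImp (FEq1 (TPlus (nv 0) TOne) (TLen 0)) (FIn (nv 0) 0))).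
Definition SE := FAll2 (FAll2 (fiff (FEq2 1 0)
                   (FAnd (FEq1 (TLen 1) (TLen 0))
                         (FAll1 (FImp (flt (nv 0) (TLen 1)) (fiff (FIn (nv 0) 1) (FIn (nv 0) 0))))))).

(* Comprehension instance for phi(z, params): number var 0 of phi is z,
   var i+1 of phi is the i-th parameter; in the result number var 0 is a,
   var i+1 is the i-th parameter; X is fresh (not free in phi).
   compf phi = Ex X (|X| <= a /\ All z (z < a -> (X(z) <-> phi(z)))).       *)
Definition compf (p : form) : form :=
  FEx2 (FAnd (FLe (TLen 0) (nv 0))
    (FAll1 (FImp (flt (nv 0) (nv 1))
       (fiff (FIn (nv 0) 0) (fsubst (scons (nv 0) (fun i => nv i.+2)) S p))))).

Definition basic_ax (q : form) : Prop :=
  List.In q [:: B1; B2; B3; B4; B5; B6; B7; B8; B9; B10; B11; B12; L1; L2; SE].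
Definition comp_ax (q : form) : Prop :=
  exists p n l, sigB0 p /\ q = close n l (compf p) /\ closed q.

Definition V0 (q : form) : Prop := basic_ax q \/ comp_ax q.

Definition tpair (t u : term) : term :=
  TPlus (TTimes (TPlus t u) (TPlus (TPlus t u) TOne)) (TTimes (numeral 2) u).

(* inside All X Ex Y: X = string var 1, Y = string var 0 *)
Definition modA (m : nat) : form :=
  FAll1 (FImp (FLe (nv 0) (TLen 1))
    (FEx1 (FAnd (flt (nv 0) (numeral m))
      (FAnd (FIn (tpair (nv 1) (nv 0)) 0)
        (FAll1 (FImp (flt (nv 0) (numeral m))
                     (FImp (FIn (tpair (nv 2) (nv 0)) 0) (FEq1 (nv 0) (nv 1))))))))).
Definition modB : form := FIn (tpair TZero TZero) 0.
(* Y(z+1, y+1 mod m), in context y = nv 0, z = nv 1 *)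
Definition modStep (m : nat) : form :=
  FEx1 (FAnd (flt (nv 0) (numeral m))
    (FEx1 (FAnd (FLe (nv 0) (TPlus (nv 2) TOne))
      (FAnd (FEq1 (TPlus (nv 2) TOne) (TPlus (TTimes (nv 0) (numeral m)) (nv 1)))
            (FIn (tpair (TPlus (nv 3) TOne) (nv 1)) 0))))).
Definition modC (m : nat) : form :=
  FAll1 (FImp (flt (nv 0) (TLen 1))
    (FAll1 (FImp (flt (nv 0) (numeral m))
      (FImp (FIn (tpair (nv 1) (nv 0)) 0)
        (FAnd (FImp (FIn (nv 1) 1) (modStep m))
              (FImp (fneg (FIn (nv 1) 1)) (FIn (tpair (TPlus (nv 1) TOne) (nv 0)) 0))))))).
Definition MODax (m : nat) : form :=
  FAll2 (FEx2 (FAnd (modA m) (FAnd modB (modC m)))).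

Definition V0m (m : nat) (q : form) : Prop := V0 q \/ q = MODax m.
Definition VACC (q : form) : Prop := V0 q \/ exists m, 2 <= m /\ q = MODax m.

Fixpoint teval (r1 : nat -> nat) (r2 : nat -> str) (t : term) : nat :=
  match t with
  | TVar n => r1 n
  | TZero => 0 | TOne => 1
  | TPlus a b => teval r1 r2 a + teval r1 r2 b
  | TTimes a b => teval r1 r2 a * teval r1 r2 b
  | TLen X => slen (r2 X)
  end.

Fixpoint sat (r1 : nat -> nat) (r2 : nat -> str) (p : form) : Prop :=
  match p with
  | FBot => False
  | FLe t u => teval r1 r2 t <= teval r1 r2 u
  | FEq1 t u => teval r1 r2 t = teval r1 r2 u
  | FIn t X => smem (r2 X) (teval r1 r2 t)
  | FEq2 X Y => r2 X = r2 Y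
  | FImp a b => sat r1 r2 a -> sat r1 r2 b
  | FAnd a b => sat r1 r2 a /\ sat r1 r2 b
  | FOr a b => sat r1 r2 a \/ sat r1 r2 b
  | FAll1 a => forall x, sat (scons x r1) r2 a
  | FEx1 a => exists x, sat (scons x r1) r2 a
  | FAll2 a => forall X, sat r1 (scons X r2) a
  | FEx2 a => exists X, sat r1 (scons X r2) a
  end.

Definition num_env (xs : seq nat) (i : nat) : nat := nth 0 xs i.
Definition str_env (Xs : seq str) (j : nat) : str := nth sempty Xs j.

(* Definable functions.  A function of arity (k,l) is a Coq function on
   lists; only inputs with size xs = k, size Xs = l matter.                 *)

(* Ex! Y phi  (Y = string var 0 of phi, X_j = string var j+1) *)
Definition exU2 (p : form) : form :=
  FEx2 (FAnd p (FAll2 (FImp (fsubst TVar (scons 0 (fun j => j.+2)) p) (FEq2 0 1)))).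
(* Ex! y phi  (y = number var 0 of phi, x_i = number var i+1) *)
Definition exU1 (p : form) : form :=
  FEx1 (FAnd p (FAll1 (FImp (fsubst (scons (TVar 0) (fun i => TVar i.+2)) id p)
                            (FEq1 (TVar 0) (TVar 1))))).

(* string function F(x_0..x_{k-1}, X_0..X_{l-1}); in phi: number var i = x_i,
   string var 0 = Y, string var j+1 = X_j *)
Definition def_strfun (cls : form -> Prop) (T : form -> Prop) (k l : nat)
    (F : seq nat -> seq str -> str) : Prop :=
  exists p, cls p /\ fnb k p /\ fsb l.+1 p /\
    (forall xs Xs Y, size xs = k -> size Xs = l ->
       (Y = F xs Xs <-> sat (num_env xs) (scons Y (str_env Xs)) p)) /\
    Provable T (close k l (exU2 p)).

(* number function f(x_0..x_{k-1}, X_0..); in phi: number var 0 = y,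
   number var i+1 = x_i, string var j = X_j *)
Definition def_numfun (cls : form -> Prop) (T : form -> Prop) (k l : nat)
    (f : seq nat -> seq str -> nat) : Prop :=
  exists p, cls p /\ fnb k.+1 p /\ fsb l p /\
    (forall xs Xs y, size xs = k -> size Xs = l ->
       (y = f xs Xs <-> sat (scons y (num_env xs)) (str_env Xs) p)) /\
    Provable T (close k l (exU1 p)).

(* AC^0(m): Sigma^B_0 formulas over L^2_A + mod_m + a chain of string
   function symbols.                                                        *)
Definition modm (m z : nat) (X : str) : nat := count (smem X) (iota 0 z) %% m.

Inductive xnt : Type :=
| XV (n : nat) | XZero | XOne | XAdd (t u : xnt) | XMul (t u : xnt)
| XLen (s : xst) | XMod (t : xnt) (s : xst)
with xst : Type :=
| XSV (j : nat)
| XF (i : nat) (ts : xnts) (ss : xsts)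
with xnts : Type := NNil | NCons (t : xnt) (ts : xnts)
with xsts : Type := SNil | SCons (s : xst) (ss : xsts).

(* a chain of string functions, each with its arity (k, l) *)
Definition fchain := seq (nat * nat * (seq nat -> seq str -> str)).
Definition fdefault : nat * nat * (seq nat -> seq str -> str) :=
  (0, 0, fun _ _ => sempty).
Definition fit {A : Type} (n : nat) (d : A) (s : seq A) : seq A :=
  take n s ++ nseq (n - size s) d.

Fixpoint xneval (m : nat) (fs : fchain) (r1 : nat -> nat) (r2 : nat -> str) (t : xnt) : nat :=
  match t with
  | XV n => r1 n
  | XZero => 0 | XOne => 1
  | XAdd a b => xneval m fs r1 r2 a + xneval m fs r1 r2 b
  | XMul a b => xneval m fs r1 r2 a * xneval m fs r1 r2 b
  | XLen s => slen (xseval m fs r1 r2 s)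
  | XMod a s => modm m (xneval m fs r1 r2 a) (xseval m fs r1 r2 s)
  end
with xseval (m : nat) (fs : fchain) (r1 : nat -> nat) (r2 : nat -> str) (s : xst) : str :=
  match s with
  | XSV j => r2 j
  | XF i ts ss =>
      let: (k, l, F) := nth fdefault fs i in
      F (fit k 0 (xnseval m fs r1 r2 ts)) (fit l sempty (xsseval m fs r1 r2 ss))
  end
with xnseval (m : nat) (fs : fchain) (r1 : nat -> nat) (r2 : nat -> str) (ts : xnts) : seq nat :=
  match ts with NNil => [::] | NCons t ts' => xneval m fs r1 r2 t :: xnseval m fs r1 r2 ts' end
with xsseval (m : nat) (fs : fchain) (r1 : nat -> nat) (r2 : nat -> str) (ss : xsts) : seq str :=
  match ss with SNil => [::] | SCons s ss' => xseval m fs r1 r2 s :: xsseval m fs r1 r2 ss' end.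

(* Sigma^B_0 formulas: no string quantifiers, only bounded number quantifiers
   XAllB t p = All x <= t. p,  XExB t p = Ex x <= t. p  (x = number var 0 of p,
   not occurring in t) *)
Inductive xform : Type :=
| XBot | XLe (t u : xnt) | XEq1 (t u : xnt) | XIn (t : xnt) (s : xst) | XEq2 (s s' : xst)
| XImp (p q : xform) | XAnd (p q : xform) | XOr (p q : xform)
| XAllB (t : xnt) (p : xform) | XExB (t : xnt) (p : xform).

Fixpoint xsat (m : nat) (fs : fchain) (r1 : nat -> nat) (r2 : nat -> str) (p : xform) : Prop :=
  match p with
  | XBot => False
  | XLe t u => xneval m fs r1 r2 t <= xneval m fs r1 r2 u
  | XEq1 t u => xneval m fs r1 r2 t = xneval m fs r1 r2 u
  | XIn t s => smem (xseval m fs r1 r2 s) (xneval m fs r1 r2 t)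
  | XEq2 s s' => xseval m fs r1 r2 s = xseval m fs r1 r2 s'
  | XImp a b => xsat m fs r1 r2 a -> xsat m fs r1 r2 b
  | XAnd a b => xsat m fs r1 r2 a /\ xsat m fs r1 r2 b
  | XOr a b => xsat m fs r1 r2 a \/ xsat m fs r1 r2 b
  | XAllB t a => forall x, x <= xneval m fs r1 r2 t -> xsat m fs (scons x r1) r2 a
  | XExB t a => exists x, x <= xneval m fs r1 r2 t /\ xsat m fs (scons x r1) r2 a
  end.

Definition xrepr (m : nat) (fs : fchain) (k l : nat)
    (R : seq nat -> seq str -> Prop) (p : xform) : Prop :=
  forall xs Xs, size xs = k -> size Xs = l ->
    (R xs Xs <-> xsat m fs (num_env xs) (str_env Xs) p).

Definition argsize (xs : seq nat) (Xs : seq str) : nat :=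
  sumn xs + sumn (map slen Xs) + 2.
Definition pbounded_num (k l : nat) (f : seq nat -> seq str -> nat) : Prop :=
  exists c, forall xs Xs, size xs = k -> size Xs = l -> f xs Xs <= argsize xs Xs ^ c.
Definition pbounded_str (k l : nat) (F : seq nat -> seq str -> str) : Prop :=
  exists c, forall xs Xs, size xs = k -> size Xs = l -> slen (F xs Xs) <= argsize xs Xs ^ c.

Definition bitgraph (F : seq nat -> seq str -> str) : seq nat -> seq str -> Prop :=
  fun ys Xs => smem (F (behead ys) Xs) (head 0 ys).
Definition graph (f : seq nat -> seq str -> nat) : seq nat -> seq str -> Prop :=
  fun ys Xs => head 0 ys = f (behead ys) Xs.

Definition valid_chain (m : nat) (fs : fchain) : Prop :=
  forall i, i < size fs ->
    let: (k, l, F) := nth fdefault fs i in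
    pbounded_str k l F /\
    exists p, xrepr m (take i fs) k.+1 l (bitgraph F) p.

Definition AC0m (m k l : nat) (R : seq nat -> seq str -> Prop) : Prop :=
  exists fs p, valid_chain m fs /\ xrepr m fs k l R p.

Definition FAC0_num (m k l : nat) (f : seq nat -> seq str -> nat) : Prop :=
  pbounded_num k l f /\ AC0m m k.+1 l (graph f).
Definition FAC0_str (m k l : nat) (F : seq nat -> seq str -> str) : Prop :=
  pbounded_str k l F /\ AC0m m k.+1 l (bitgraph F).

Definition FACC_num (k l : nat) (f : seq nat -> seq str -> nat) : Prop :=
  exists m, 2 <= m /\ FAC0_num m k l f.
Definition FACC_str (k l : nat) (F : seq nat -> seq str -> str) : Prop :=
  exists m, 2 <= m /\ FAC0_str m k l F.

(* Main.v *)
Require Import Defs.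
From mathcomp Require Import all_boot.
From mathcomp Require Import boolp zify.
From mathcomp Require filter.
Set Implicit Arguments. Unset Strict Implicit. Unset Printing Implicit Defensive.

(* Definable functions are in FAC^0(m).  For an ultrafilter U on inputs, the
   functions in FAC^0(m) modulo U form a two-sorted structure; since bounded
   least witnesses are again in FAC^0(m), Los's theorem holds for Sigma^B_0
   formulas, and the structure is a model of V^0(m).  If V^0(m) proves that
   F is total, then in this model some FAC^0(m) function agrees with F on a set
   of U.  The sets that arise in this way are closed under finite unions, so if none
   contained all inputs, an ultrafilter avoiding all of them would give a contradiction.

   Functions in FAC^0(m) are definable.  Over the standard model, AC^0(m) is
   first-order logic with modular counting quantifiers, and such a formula is
   evaluated by a fixed sequence of comprehension steps and MOD_m steps: all
   instances of a counting quantifier are evaluated by one MOD_m step, applied to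
   the concatenation of the strings to be counted.  Only the existence and
   uniqueness of the result of each single step has to be proved in V^0(m), and
   by the completeness theorem this may be argued in an arbitrary model. *)

(** The formula that defines F describes a computation: a sequence of strings, each fixed by its
    predecessors, and an output read off the last one. Existence and uniqueness are then properties
    of the single steps, in every model, whereas agreement with F is needed in the standard model
    only. So no fact about counting has to be derived in V^0(m). For this a step must be functional.
    The axiom MOD_m leaves the bits of Y outside the pairs (z,y) with z at most |X| and y below m
    undetermined, so a step also demands that they vanish.

    In the converse direction the sets on which F agrees with a function of the class have to be
    definable themselves: two such functions are glued by a case distinction on such a set, and this
    is the reason for closure under finite unions. Existential string quantifiers cause no loss,
    since a witness in the ultrapower already is a function of the class.

    One modulus suffices for finitely many axioms MOD_d, because a count modulo m determines the
    count modulo every divisor d of m. *)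

(** * Substitution and free variables *)

Definition cmp1 (s1 : nat -> term) (s2 : nat -> nat) (u1 : nat -> term) :=
  fun n => tsubst s1 s2 (u1 n).
Definition cmp2 (s2 u2 : nat -> nat) := fun n => s2 (u2 n).
Definition lift2 (s1 : nat -> term) := fun n => shift2t (s1 n).

Lemma tsubst_comp s1 s2 u1 u2 t :
  tsubst s1 s2 (tsubst u1 u2 t) = tsubst (cmp1 s1 s2 u1) (cmp2 s2 u2) t.
Proof. by elim: t => //= [t -> u ->|t -> u ->]. Qed.

Lemma tsubst_id t : tsubst TVar id t = t.
Proof. by elim: t => //= [t -> u ->|t -> u ->]. Qed.

Lemma up1_id : up1 TVar = TVar.
Proof. by apply: funext => -[]. Qed.

Lemma up2_id : up2 id = id.
Proof. by apply: funext => -[]. Qed.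

Lemma fsubst_id p : fsubst TVar id p = p.
Proof.
elim: p => //=.
- by move=> t u; rewrite !tsubst_id.
- by move=> t u; rewrite !tsubst_id.
- by move=> t X; rewrite !tsubst_id.
- by move=> p -> q ->.
- by move=> p -> q ->.
- by move=> p -> q ->.
- by move=> p; rewrite up1_id => ->.
- by move=> p; rewrite up1_id => ->.
- by move=> p; rewrite up2_id => {2}<-.
- by move=> p; rewrite up2_id => {2}<-.
Qed.

Lemma up1_comp s1 s2 u1 : up1 (cmp1 s1 s2 u1) = cmp1 (up1 s1) s2 (up1 u1).
Proof.
apply: funext => -[|n] //=; rewrite /cmp1 /= /shift1t !tsubst_comp.
by congr tsubst.
Qed.

Lemma up2_comp s2 u2 : up2 (cmp2 s2 u2) = cmp2 (up2 s2) (up2 u2).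
Proof. by apply: funext => -[|n]. Qed.

Lemma lift2_comp s1 s2 u1 :
  lift2 (cmp1 s1 s2 u1) = cmp1 (lift2 s1) (up2 s2) (lift2 u1).
Proof.
by apply: funext => n; rewrite /lift2 /cmp1 /shift2t !tsubst_comp.
Qed.

Lemma fsubst_comp s1 s2 u1 u2 p :
  fsubst s1 s2 (fsubst u1 u2 p) = fsubst (cmp1 s1 s2 u1) (cmp2 s2 u2) p.
Proof.
elim: p s1 s2 u1 u2 => //=.
- by move=> *; rewrite !tsubst_comp.
- by move=> *; rewrite !tsubst_comp.
- by move=> *; rewrite !tsubst_comp.
- by move=> p IHp q IHq *; rewrite IHp IHq.
- by move=> p IHp q IHq *; rewrite IHp IHq.
- by move=> p IHp q IHq *; rewrite IHp IHq.
- by move=> p IHp *; rewrite IHp up1_comp.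
- by move=> p IHp *; rewrite IHp up1_comp.
- move=> p IHp s1 s2 u1 u2; rewrite IHp up2_comp.
  by rewrite -[fun n => shift2t (cmp1 s1 s2 u1 n)]/(lift2 (cmp1 s1 s2 u1)) lift2_comp.
- move=> p IHp s1 s2 u1 u2; rewrite IHp up2_comp.
  by rewrite -[fun n => shift2t (cmp1 s1 s2 u1 n)]/(lift2 (cmp1 s1 s2 u1)) lift2_comp.
Qed.

Lemma inst1_fsubst s1 s2 t p :
  fsubst s1 s2 (inst1 t p) = inst1 (tsubst s1 s2 t) (fsubst (up1 s1) s2 p).
Proof.
rewrite /inst1 !fsubst_comp; congr fsubst; apply: funext => -[|n] //=.
by rewrite /cmp1 /= /shift1t tsubst_comp -[LHS]tsubst_id; congr tsubst.
Qed.

Lemma inst2_fsubst s1 s2 Y p :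
  fsubst s1 s2 (inst2 Y p) = inst2 (s2 Y) (fsubst (lift2 s1) (up2 s2) p).
Proof.
rewrite /inst2 !fsubst_comp; congr fsubst; last by apply: funext => -[|n].
apply: funext => n; rewrite /cmp1 /lift2 /= /shift2t tsubst_comp.
by rewrite -[LHS]tsubst_id; congr tsubst.
Qed.

Lemma shift1_fsubst s1 s2 p :
  fsubst (up1 s1) s2 (shift1 p) = shift1 (fsubst s1 s2 p).
Proof. by rewrite /shift1 !fsubst_comp; congr fsubst. Qed.

Lemma shift2_fsubst s1 s2 p :
  fsubst (lift2 s1) (up2 s2) (shift2 p) = shift2 (fsubst s1 s2 p).
Proof. by rewrite /shift2 !fsubst_comp; congr fsubst. Qed.

(** Lets an instance of a substituted quantifier body be read as substitution under an extended
    assignment, as the quantifier cases of [termM_sat] require. *)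
Lemma inst1_up s1 s2 t p :
  inst1 t (fsubst (up1 s1) s2 p) = fsubst (scons t s1) s2 p.
Proof.
rewrite /inst1 fsubst_comp; congr fsubst; apply: funext => -[|n] //=.
by rewrite /cmp1 /= /shift1t tsubst_comp -[RHS]tsubst_id; congr tsubst.
Qed.

Lemma inst2_up s1 s2 Y p :
  inst2 Y (fsubst (lift2 s1) (up2 s2) p) = fsubst s1 (scons Y s2) p.
Proof.
rewrite /inst2 fsubst_comp; congr fsubst; last by apply: funext => -[|n].
apply: funext => n; rewrite /cmp1 /= /lift2 /shift2t tsubst_comp.
by rewrite -[RHS]tsubst_id; congr tsubst.
Qed.

Lemma tsubst_eq_bounded n l t s1 s2 u1 u2 : tnb n t -> tsb l t ->
  (forall i, i < n -> s1 i = u1 i) -> (forall i, i < l -> s2 i = u2 i) ->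
  tsubst s1 s2 t = tsubst u1 u2 t.
Proof.
move=> + + h1 h2; elim: t => //=.
- by move=> i /h1.
- by move=> t IHt u IHu [a b] [c d]; rewrite IHt // IHu.
- by move=> t IHt u IHu [a b] [c d]; rewrite IHt // IHu.
- by move=> X _ /h2 ->.
Qed.

(** Source of two facts used for fresh variables: closed formulas are fixed by every substitution,
    and a substitution that is special only at x acts as a plain shift on formulas whose variables
    lie below x. *)
Lemma fsubst_eq_bounded n l p s1 s2 u1 u2 : fnb n p -> fsb l p ->
  (forall i, i < n -> s1 i = u1 i) -> (forall i, i < l -> s2 i = u2 i) ->
  fsubst s1 s2 p = fsubst u1 u2 p.
Proof.
have upn (k : nat) (v1 w1 : nat -> term) : (forall i, i < k -> v1 i = w1 i) ->
    forall i, i < k.+1 -> up1 v1 i = up1 w1 i by move=> h [|i] //= /h ->.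
have ups (k : nat) (v1 w1 : nat -> nat) : (forall i, i < k -> v1 i = w1 i) ->
    forall i, i < k.+1 -> up2 v1 i = up2 w1 i by move=> h [|i] //= /h ->.
elim: p n l s1 s2 u1 u2 => //=.
- move=> t u n l s1 s2 u1 u2 [? ?] [? ?] h1 h2.
  by rewrite !(@tsubst_eq_bounded n l _ s1 s2 u1 u2).
- move=> t u n l s1 s2 u1 u2 [? ?] [? ?] h1 h2.
  by rewrite !(@tsubst_eq_bounded n l _ s1 s2 u1 u2).
- move=> t X n l s1 s2 u1 u2 ? [? ?] h1 h2.
  by rewrite !(@tsubst_eq_bounded n l _ s1 s2 u1 u2) // h2.
- by move=> X Y n l s1 s2 u1 u2 _ [? ?] h1 h2; rewrite !h2.
- move=> p IHp q IHq n l s1 s2 u1 u2 [? ?] [? ?] h1 h2.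
  by rewrite (IHp n l s1 s2 u1 u2) // (IHq n l s1 s2 u1 u2).
- move=> p IHp q IHq n l s1 s2 u1 u2 [? ?] [? ?] h1 h2.
  by rewrite (IHp n l s1 s2 u1 u2) // (IHq n l s1 s2 u1 u2).
- move=> p IHp q IHq n l s1 s2 u1 u2 [? ?] [? ?] h1 h2.
  by rewrite (IHp n l s1 s2 u1 u2) // (IHq n l s1 s2 u1 u2).
- move=> p IH n l s1 s2 u1 u2 a b h1 h2.
  by rewrite (IH _ _ _ _ (up1 u1) u2 a b) //; exact: upn.
- move=> p IH n l s1 s2 u1 u2 a b h1 h2.
  by rewrite (IH _ _ _ _ (up1 u1) u2 a b) //; exact: upn.
- move=> p IH n l s1 s2 u1 u2 a b h1 h2.
  rewrite (IH _ _ _ _ (lift2 u1) (up2 u2) a b) //; last exact: ups.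
  by move=> i /h1; rewrite /lift2 => ->.
- move=> p IH n l s1 s2 u1 u2 a b h1 h2.
  rewrite (IH _ _ _ _ (lift2 u1) (up2 u2) a b) //; last exact: ups.
  by move=> i /h1; rewrite /lift2 => ->.
Qed.

Lemma closed_fsubst p s1 s2 : Defs.closed p -> fsubst s1 s2 p = p.
Proof.
move=> [a b]; rewrite -[RHS]fsubst_id.
exact: (fsubst_eq_bounded a b).
Qed.

Lemma tnb_mono n m t : n <= m -> tnb n t -> tnb m t.
Proof.
move=> nm; elim: t => //=.
- by move=> i /leq_trans; apply.
- by move=> t IHt u IHu [] /IHt ? /IHu.
- by move=> t IHt u IHu [] /IHt ? /IHu.
Qed.

Lemma tsb_mono n m t : n <= m -> tsb n t -> tsb m t.
Proof.
move=> nm; elim: t => //=.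
- by move=> t IHt u IHu [] /IHt ? /IHu.
- by move=> t IHt u IHu [] /IHt ? /IHu.
- by move=> i /leq_trans; apply.
Qed.

Lemma fnb_mono n m p : n <= m -> fnb n p -> fnb m p.
Proof.
elim: p n m => //=.
- by move=> t u n m nm [] /(tnb_mono nm) ? /(tnb_mono nm).
- by move=> t u n m nm [] /(tnb_mono nm) ? /(tnb_mono nm).
- by move=> t u n m nm /(tnb_mono nm).
- by move=> p IHp q IHq n m nm [] /(IHp _ _ nm) ? /(IHq _ _ nm).
- by move=> p IHp q IHq n m nm [] /(IHp _ _ nm) ? /(IHq _ _ nm).
- by move=> p IHp q IHq n m nm [] /(IHp _ _ nm) ? /(IHq _ _ nm).
- by move=> p IH n m nm; apply: IH.
- by move=> p IH n m nm; apply: IH.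
Qed.

Lemma fsb_mono n m p : n <= m -> fsb n p -> fsb m p.
Proof.
elim: p n m => //=.
- by move=> t u n m nm [] /(tsb_mono nm) ? /(tsb_mono nm).
- by move=> t u n m nm [] /(tsb_mono nm) ? /(tsb_mono nm).
- by move=> t u n m nm [] /(tsb_mono nm) ? h; split => //; exact: leq_trans nm.
- by move=> X Y n m nm [] h h'; split; exact: leq_trans nm.
- by move=> p IHp q IHq n m nm [] /(IHp _ _ nm) ? /(IHq _ _ nm).
- by move=> p IHp q IHq n m nm [] /(IHp _ _ nm) ? /(IHq _ _ nm).
- by move=> p IHp q IHq n m nm [] /(IHp _ _ nm) ? /(IHq _ _ nm).
- by move=> p IH n m nm; apply: IH.
- by move=> p IH n m nm; apply: IH.
Qed.

Lemma tnb_ex t : exists n, tnb n t /\ tsb n t.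
Proof.
elim: t => //=; try by exists 0.
- by move=> n; exists n.+1.
- move=> t [n [a b]] u [k [c d]]; exists (maxn n k).
  by split; split; [apply: tnb_mono a|apply: tnb_mono c|apply: tsb_mono b|apply: tsb_mono d]; lia.
- move=> t [n [a b]] u [k [c d]]; exists (maxn n k).
  by split; split; [apply: tnb_mono a|apply: tnb_mono c|apply: tsb_mono b|apply: tsb_mono d]; lia.
- by move=> n; exists n.+1.
Qed.

Lemma fnb_ex p : exists n, fnb n p /\ fsb n p.
Proof.
elim: p => //=; try by exists 0.
- move=> t u; have [n [a b]] := tnb_ex t; have [k [c d]] := tnb_ex u.
  exists (maxn n k).
  by split; split; [apply: tnb_mono a|apply: tnb_mono c|apply: tsb_mono b|apply: tsb_mono d]; lia.
- move=> t u; have [n [a b]] := tnb_ex t; have [k [c d]] := tnb_ex u.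
  exists (maxn n k).
  by split; split; [apply: tnb_mono a|apply: tnb_mono c|apply: tsb_mono b|apply: tsb_mono d]; lia.
- move=> t X; have [n [a b]] := tnb_ex t; exists (maxn n X.+1).
  split; last split; [apply: tnb_mono a|apply: tsb_mono b|]; lia.
- move=> X Y; exists (maxn X.+1 Y.+1); lia.
- move=> p [n [a b]] q [k [c d]]; exists (maxn n k).
  by split; split; [apply: fnb_mono a|apply: fnb_mono c|apply: fsb_mono b|apply: fsb_mono d]; lia.
- move=> p [n [a b]] q [k [c d]]; exists (maxn n k).
  by split; split; [apply: fnb_mono a|apply: fnb_mono c|apply: fsb_mono b|apply: fsb_mono d]; lia.
- move=> p [n [a b]] q [k [c d]]; exists (maxn n k).
  by split; split; [apply: fnb_mono a|apply: fnb_mono c|apply: fsb_mono b|apply: fsb_mono d]; lia.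
- by move=> p [n [a b]]; exists n; split => //; apply: fnb_mono a.
- by move=> p [n [a b]]; exists n; split => //; apply: fnb_mono a.
- by move=> p [n [a b]]; exists n; split => //; apply: fsb_mono b.
- by move=> p [n [a b]]; exists n; split => //; apply: fsb_mono b.
Qed.

Lemma fnb_close k n l p : fnb k (close n l p) <-> fnb (n + k) p.
Proof.
rewrite /close; elim: n k => [|n IH] k /=; last by rewrite IH addSnnS.
by rewrite add0n; elim: l.
Qed.

Lemma fsb_close k n l p : fsb k (close n l p) <-> fsb (l + k) p.
Proof.
rewrite /close; elim: n => //=.
by elim: l k => [|l IH] k //=; rewrite IH addSnnS.
Qed.

Lemma closed_close n l p : fnb n p -> fsb l p -> Defs.closed (close n l p).
Proof. by split; [apply/fnb_close|apply/fsb_close]; rewrite addn0. Qed.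

(** A bound in [sigB0] has the syntactic form [shift1t t], so the point is that substitution under a
    binder commutes with the shift. *)
Lemma sigB0_fsubst p s1 s2 : sigB0 p -> sigB0 (fsubst s1 s2 p).
Proof.
have E t u1 u2 : tsubst (up1 u1) u2 (shift1t t) = shift1t (tsubst u1 u2 t).
  by rewrite /shift1t !tsubst_comp; congr tsubst.
move=> h; elim: h s1 s2 => /=; try by intros; constructor.
- by move=> t q _ IH s1 s2; rewrite E; apply: sB0_exle.
- by move=> t q _ IH s1 s2; rewrite E; apply: sB0_exlt.
- by move=> t q _ IH s1 s2; rewrite E; apply: sB0_allle.
- by move=> t q _ IH s1 s2; rewrite E; apply: sB0_alllt.
Qed.

(** * Structures and soundness *)

(** Both equalities are arbitrary relations here, because the term model and the ultrapower come
    with provable equality and equality almost everywhere. That these are congruences is [normal];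
    that they are true equality is [strict]. *)
Record struc := Struc {
  num : Type; strg : Type;
  m0 : num; m1 : num; madd : num -> num -> num; mmul : num -> num -> num;
  mlen : strg -> num;
  mle : num -> num -> Prop; meq1 : num -> num -> Prop;
  mmem : strg -> num -> Prop; meq2 : strg -> strg -> Prop }.

Fixpoint meval (M : struc) (r1 : nat -> num M) (r2 : nat -> strg M) (t : term) : num M :=
  match t with
  | TVar n => r1 n
  | TZero => m0 M | TOne => m1 M
  | TPlus a b => madd (meval r1 r2 a) (meval r1 r2 b)
  | TTimes a b => mmul (meval r1 r2 a) (meval r1 r2 b)
  | TLen X => mlen (r2 X)
  end.

Fixpoint msat (M : struc) (r1 : nat -> num M) (r2 : nat -> strg M) (p : form) : Prop :=
  match p with
  | FBot => False
  | FLe t u => mle (meval r1 r2 t) (meval r1 r2 u)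
  | FEq1 t u => meq1 (meval r1 r2 t) (meval r1 r2 u)
  | FIn t X => mmem (r2 X) (meval r1 r2 t)
  | FEq2 X Y => meq2 (r2 X) (r2 Y)
  | FImp a b => msat r1 r2 a -> msat r1 r2 b
  | FAnd a b => msat r1 r2 a /\ msat r1 r2 b
  | FOr a b => msat r1 r2 a \/ msat r1 r2 b
  | FAll1 a => forall x, msat (scons x r1) r2 a
  | FEx1 a => exists x, msat (scons x r1) r2 a
  | FAll2 a => forall X, msat r1 (scons X r2) a
  | FEx2 a => exists X, msat r1 (scons X r2) a
  end.

Definition stdM : struc :=
  Struc 0 1 addn muln slen (fun x y => x <= y) (@eq nat) (fun X n => smem X n) (@eq str).

Lemma meval_std r1 r2 t : @meval stdM r1 r2 t = teval r1 r2 t.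
Proof. by elim: t => //= t -> u ->. Qed.

Lemma msat_std r1 r2 p : @msat stdM r1 r2 p = sat r1 r2 p.
Proof.
elim: p r1 r2 => //=.
- by move=> *; rewrite !meval_std.
- by move=> *; rewrite !meval_std.
- by move=> *; rewrite !meval_std.
- by move=> p IHp q IHq *; rewrite IHp IHq.
- by move=> p IHp q IHq *; rewrite IHp IHq.
- by move=> p IHp q IHq *; rewrite IHp IHq.
- by move=> p IH *; apply: eq_forall => x; rewrite IH.
- by move=> p IH *; apply: eq_exists => x; rewrite IH.
- by move=> p IH *; apply: eq_forall => x; rewrite IH.
- by move=> p IH *; apply: eq_exists => x; rewrite IH.
Qed.

Lemma meval_subst (M : struc) (r1 : nat -> num M) r2 s1 s2 t :
  meval r1 r2 (tsubst s1 s2 t) = meval (fun n => meval r1 r2 (s1 n)) (fun n => r2 (s2 n)) t.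
Proof. by elim: t => //= t -> u ->. Qed.

Lemma meval_shift1 (M : struc) (r1 : nat -> num M) r2 x t :
  meval (scons x r1) r2 (shift1t t) = meval r1 r2 t.
Proof. by rewrite /shift1t meval_subst. Qed.

Lemma meval_shift2 (M : struc) (r1 : nat -> num M) r2 X t :
  meval r1 (scons X r2) (shift2t t) = meval r1 r2 t.
Proof. by rewrite /shift2t meval_subst. Qed.

Lemma msat_subst (M : struc) (r1 : nat -> num M) r2 s1 s2 p :
  msat r1 r2 (fsubst s1 s2 p) = msat (fun n => meval r1 r2 (s1 n)) (fun n => r2 (s2 n)) p.
Proof.
have U1 (x : num M) v1 v2 w1 : (fun n => meval (scons x v1) v2 (up1 w1 n)) =
   scons x (fun n => meval v1 v2 (w1 n)).
  by apply: funext => -[|n] //=; rewrite meval_shift1.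
have U2 X v1 (v2 : nat -> strg M) w1 :
   (fun n => meval v1 (scons X v2) (shift2t (w1 n))) = (fun n => meval v1 v2 (w1 n)).
  by apply: funext => n; rewrite meval_shift2.
have U3 X (v2 : nat -> strg M) w2 :
   (fun n => scons X v2 (up2 w2 n)) = scons X (fun n => v2 (w2 n)).
  by apply: funext => -[|n].
elim: p r1 r2 s1 s2 => //=.
- by move=> *; rewrite !meval_subst.
- by move=> *; rewrite !meval_subst.
- by move=> *; rewrite !meval_subst.
- by move=> p IHp q IHq *; rewrite IHp IHq.
- by move=> p IHp q IHq *; rewrite IHp IHq.
- by move=> p IHp q IHq *; rewrite IHp IHq.
- by move=> p IH *; apply: eq_forall => x; rewrite IH U1.
- by move=> p IH *; apply: eq_exists => x; rewrite IH U1.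
- by move=> p IH *; apply: eq_forall => x; rewrite IH U2 U3.
- by move=> p IH *; apply: eq_exists => x; rewrite IH U2 U3.
Qed.

Lemma msat_shift1 (M : struc) (r1 : nat -> num M) r2 x p :
  msat (scons x r1) r2 (shift1 p) = msat r1 r2 p.
Proof. by rewrite /shift1 msat_subst. Qed.

Lemma msat_shift2 (M : struc) (r1 : nat -> num M) r2 X p :
  msat r1 (scons X r2) (shift2 p) = msat r1 r2 p.
Proof. by rewrite /shift2 msat_subst. Qed.

Lemma msat_inst1 (M : struc) (r1 : nat -> num M) r2 t p :
  msat r1 r2 (inst1 t p) = msat (scons (meval r1 r2 t) r1) r2 p.
Proof. by rewrite /inst1 msat_subst; congr msat; apply: funext => -[]. Qed.

Lemma msat_inst2 (M : struc) (r1 : nat -> num M) r2 Y p :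
  msat r1 r2 (inst2 Y p) = msat r1 (scons (r2 Y) r2) p.
Proof. by rewrite /inst2 msat_subst; congr msat; apply: funext => -[]. Qed.

Definition normal (M : struc) : Prop :=
  [/\ (forall x : num M, meq1 x x),
      (forall x y : num M, meq1 x y -> meq1 y x),
      (forall x y z : num M, meq1 x y -> meq1 y z -> meq1 x z),
      (forall x x' y y' : num M, meq1 x x' -> meq1 y y' ->
        [/\ meq1 (madd x y) (madd x' y'), meq1 (mmul x y) (mmul x' y') & (mle x y -> mle x' y')]) &
      [/\ (forall X : strg M, meq2 X X),
      (forall X Y : strg M, meq2 X Y -> meq2 Y X),
      (forall X Y Z : strg M, meq2 X Y -> meq2 Y Z -> meq2 X Z),
      (forall X Y : strg M, meq2 X Y -> meq1 (mlen X) (mlen Y)) &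
      (forall X Y (x y : num M), meq2 X Y -> meq1 x y -> mmem X x -> mmem Y y)]].

Lemma msat_congr (M : struc) (hM : normal M) (r1 u1 : nat -> num M) r2 u2 p :
  (forall n, meq1 (r1 n) (u1 n)) -> (forall n, meq2 (r2 n) (u2 n)) ->
  msat r1 r2 p <-> msat u1 u2 p.
Proof.
case: hM => rf1 sy1 tr1 cg [rf2 sy2 tr2 cl cm].
have ev v1 w1 v2 w2 t : (forall n, meq1 (v1 n) (w1 n)) -> (forall n, meq2 (v2 n) (w2 n)) ->
    meq1 (@meval M v1 v2 t) (meval w1 w2 t).
  move=> h1 h2; elim: t => //=.
  - by move=> t IHt u IHu; case: (cg _ _ _ _ IHt IHu).
  - by move=> t IHt u IHu; case: (cg _ _ _ _ IHt IHu).
  - by move=> X; apply: cl.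
have S1 (v w : nat -> num M) x : (forall n, meq1 (v n) (w n)) ->
   forall n, meq1 (scons x v n) (scons x w n) by move=> h [|n] /=.
have S2 (v w : nat -> strg M) x : (forall n, meq2 (v n) (w n)) ->
   forall n, meq2 (scons x v n) (scons x w n) by move=> h [|n] /=.
elim: p r1 u1 r2 u2 => //=.
- move=> t u r1 u1 r2 u2 h1 h2; have A := ev _ _ _ _ t h1 h2; have B := ev _ _ _ _ u h1 h2.
  by split; [case: (cg _ _ _ _ A B)|case: (cg _ _ _ _ (sy1 _ _ A) (sy1 _ _ B))].
- move=> t u r1 u1 r2 u2 h1 h2; have A := ev _ _ _ _ t h1 h2; have B := ev _ _ _ _ u h1 h2.
  split=> E; first by apply: tr1 (tr1 _ _ _ E B); apply: sy1.
  by apply: tr1 A (tr1 _ _ _ E _); apply: sy1.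
- move=> t X r1 u1 r2 u2 h1 h2; have A := ev _ _ _ _ t h1 h2.
  by split; apply: cm => //; [apply: sy2|apply: sy1].
- move=> X Y r1 u1 r2 u2 h1 h2.
  split=> E; first by apply: tr2 (tr2 _ _ _ E (h2 Y)); apply: sy2.
  by apply: tr2 (h2 X) (tr2 _ _ _ E _); apply: sy2.
- by move=> p IHp q IHq r1 u1 r2 u2 h1 h2; rewrite (IHp r1 u1 r2 u2) // (IHq r1 u1 r2 u2).
- by move=> p IHp q IHq r1 u1 r2 u2 h1 h2; rewrite (IHp r1 u1 r2 u2) // (IHq r1 u1 r2 u2).
- by move=> p IHp q IHq r1 u1 r2 u2 h1 h2; rewrite (IHp r1 u1 r2 u2) // (IHq r1 u1 r2 u2).
- move=> p IH r1 u1 r2 u2 h1 h2; have E x := IH _ _ _ _ (S1 _ _ x h1) h2.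
  by split=> h x; apply/E.
- move=> p IH r1 u1 r2 u2 h1 h2; have E x := IH _ _ _ _ (S1 _ _ x h1) h2.
  by split=> -[x h]; exists x; apply/E.
- move=> p IH r1 u1 r2 u2 h1 h2; have E x := IH _ _ _ _ h1 (S2 _ _ x h2).
  by split=> h x; apply/E.
- move=> p IH r1 u1 r2 u2 h1 h2; have E x := IH _ _ _ _ h1 (S2 _ _ x h2).
  by split=> -[x h]; exists x; apply/E.
Qed.

Lemma soundness (M : struc) (hM : normal M) G p : ND G p ->
  forall r1 r2, (forall q, List.In q G -> @msat M r1 r2 q) -> msat r1 r2 p.
Proof.
have sh1 G' (r1 : nat -> num M) r2 x : (forall q, List.In q G' -> msat r1 r2 q) ->
   forall q, List.In q (map shift1 G') -> msat (scons x r1) r2 q.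
  move=> h q; elim: G' h => //= a G' IH h [<-|]; first by rewrite msat_shift1; apply: h; left.
  by apply: IH => b hb; apply: h; right.
have sh2 G' (r1 : nat -> num M) r2 X : (forall q, List.In q G' -> msat r1 r2 q) ->
   forall q, List.In q (map shift2 G') -> msat r1 (scons X r2) q.
  move=> h q; elim: G' h => //= a G' IH h [<-|]; first by rewrite msat_shift2; apply: h; left.
  by apply: IH => b hb; apply: h; right.
elim=> {G p}.
- by move=> G p h r1 r2 /(_ _ h).
- by move=> G p _ IH r1 r2 /IH.
- move=> G p _ IH r1 r2 h; apply: contrapT => np; apply: (IH r1 r2).
  by move=> q /= [<-|/h].
- by move=> G p q _ IH r1 r2 h /= hp; apply: IH => s /= [<-|/h].
- by move=> G p q _ IH _ IH' r1 r2 h; apply: (IH r1 r2 h); apply: IH'.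
- by move=> G p q _ IH _ IH' r1 r2 h; split; [apply: IH|apply: IH'].
- by move=> G p q _ IH r1 r2 /IH [].
- by move=> G p q _ IH r1 r2 /IH [].
- by move=> G p q _ IH r1 r2 /IH; left.
- by move=> G p q _ IH r1 r2 /IH; right.
- move=> G p q s _ IH _ IHp _ IHq r1 r2 h.
  by case: (IH r1 r2 h) => a; [apply: IHp|apply: IHq] => b /= [<-|/h].
- by move=> G p _ IH r1 r2 h x; apply: IH; apply: sh1.
- by move=> G p t _ IH r1 r2 /IH h; rewrite msat_inst1; apply: h.
- by move=> G p t _ IH r1 r2 /IH; rewrite msat_inst1 => h; exists (meval r1 r2 t).
- move=> G p q _ IH _ IH' r1 r2 h; case: (IH r1 r2 h) => x hx.
  rewrite -(@msat_shift1 _ r1 r2 x); apply: IH' => s /= [<-//|]; exact: sh1.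
- by move=> G p _ IH r1 r2 h x; apply: IH; apply: sh2.
- by move=> G p t _ IH r1 r2 /IH h; rewrite msat_inst2; apply: h.
- by move=> G p t _ IH r1 r2 /IH; rewrite msat_inst2 => h; exists (r2 t).
- move=> G p q _ IH _ IH' r1 r2 h; case: (IH r1 r2 h) => x hx.
  rewrite -(@msat_shift2 _ r1 r2 x); apply: IH' => s /= [<-//|]; exact: sh2.
- by move=> G t r1 r2 _ /=; case: hM.
- move=> G t u p _ IH _ IH' r1 r2 h; move: (IH r1 r2 h) (IH' r1 r2 h) => /= E.
  rewrite !msat_inst1 ; apply: (proj1 (msat_congr hM _ _ _)); last by case: hM => ? ? ? ? [].
  by move=> [|n] //=; case: hM.
- by move=> G t r1 r2 _ /=; case: hM => ? ? ? ? [].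
- move=> G t u p _ IH _ IH' r1 r2 h; move: (IH r1 r2 h) (IH' r1 r2 h) => /= E.
  rewrite !msat_inst2 ; apply: (proj1 (msat_congr hM _ _ _)); first by case: hM.
  by move=> [|n] //=; case: hM => ? ? ? ? [].
Qed.

Definition models (M : struc) (T : form -> Prop) : Prop :=
  forall q, T q -> forall r1 r2, @msat M r1 r2 q.

Lemma provable_models M T p : normal M -> models M T -> Provable T p ->
  forall r1 r2, @msat M r1 r2 p.
Proof. by move=> hM hT [G [GT /(soundness hM) h]] r1 r2; apply: h => q /GT /hT. Qed.

Lemma scons_eta (A : Type) (f : nat -> A) : scons (f 0) (fun n => f n.+1) = f.
Proof. by apply: funext => -[]. Qed.

(** Quantifying over all assignments already is a universal closure, so the length of the prefix
    does not matter. *)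
Lemma msat_close M n l p :
  (forall r1 r2, @msat M r1 r2 (close n l p)) <-> (forall r1 r2, @msat M r1 r2 p).
Proof.
rewrite /close; elim: n => [|n IH] /=.
- elim: l => [|l IH] //=; rewrite -IH; split=> h r1 r2 => [|X] //.
  by rewrite -(scons_eta r2).
- rewrite -IH; split=> h r1 r2 => [|x] //.
  by rewrite -(scons_eta r1).
Qed.

Definition strict (M : struc) : Prop :=
  (forall x y : num M, meq1 x y <-> x = y) /\ (forall X Y : strg M, meq2 X Y <-> X = Y).

(** * Quotients *)

Section Quotient.
Variables (A : Type) (e : A -> A -> Prop).
Hypotheses (erf : forall x, e x x) (esy : forall x y, e x y -> e y x)
  (etr : forall x y z, e x y -> e y z -> e x z).
(** A class is its characteristic predicate; extensionality turns [e] into Leibniz equality of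
    classes, and choice supplies [qrep]. *)
Definition quot := {P : A -> Prop | exists a, P = e a}.
Definition qpi (a : A) : quot := exist _ (e a) (ex_intro _ a erefl).
Definition qrep (x : quot) : A := projT1 (cid (proj2_sig x)).
Lemma qpiK x : qpi (qrep x) = x.
Proof.
case: x => P h; rewrite /qrep /=; case: cid => a /= Ea.
by apply: eq_exist.
Qed.
Lemma qpi_eq a b : qpi a = qpi b <-> e a b.
Proof.
split=> [/(f_equal (@proj1_sig _ _)) /= ->|h]; first exact: erf.
apply: eq_exist; apply: funext => c; apply: propext.
by split; [apply: etr (esy h)|apply: etr h].
Qed.
End Quotient.

Section QuotStruc.
Variables (M : struc) (hM : normal M).
Let e1 := @meq1 M.
Let e2 := @meq2 M.
Notation p1 := (qpi e1).
Notation p2 := (qpi e2).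
(** Makes a normal structure strict without changing truth, so that the arithmetic in models can
    work with true equality. *)
Definition qstruc : struc :=
  @Struc (quot e1) (quot e2) (p1 (m0 M)) (p1 (m1 M))
   (fun x y => p1 (madd (qrep x) (qrep y))) (fun x y => p1 (mmul (qrep x) (qrep y)))
   (fun X => p1 (mlen (qrep X)))
   (fun x y => mle (qrep x) (qrep y)) eq (fun X x => mmem (qrep X) (qrep x)) eq.

Lemma qstruc_strict : strict qstruc.
Proof. by []. Qed.

Lemma qeq1 a b : p1 a = p1 b <-> meq1 a b.
Proof. by case: hM => *; apply: qpi_eq. Qed.
Lemma qeq2 a b : p2 a = p2 b <-> meq2 a b.
Proof. by case: hM => ? ? ? ? [*]; apply: qpi_eq. Qed.
Lemma qrep1 a : meq1 (qrep (p1 a)) a.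
Proof. by apply/qeq1; rewrite qpiK. Qed.
Lemma qrep2 a : meq2 (qrep (p2 a)) a.
Proof. by apply/qeq2; rewrite qpiK. Qed.

Lemma meval_qstruc r1 r2 t :
  @meval qstruc (fun n => p1 (r1 n)) (fun n => p2 (r2 n)) t = p1 (@meval M r1 r2 t).
Proof.
case: (hM) => rf1 sy1 tr1 cg [rf2 sy2 tr2 cl cm].
elim: t => //=.
- by move=> t -> u ->; apply/qeq1; case: (cg _ _ _ _ (qrep1 (meval r1 r2 t)) (qrep1 (meval r1 r2 u))).
- by move=> t -> u ->; apply/qeq1; case: (cg _ _ _ _ (qrep1 (meval r1 r2 t)) (qrep1 (meval r1 r2 u))).
- by move=> X; apply/qeq1/cl/qrep2.
Qed.

Lemma msat_qstruc r1 r2 p :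
  @msat qstruc (fun n => p1 (r1 n)) (fun n => p2 (r2 n)) p <-> @msat M r1 r2 p.
Proof.
case: (hM) => rf1 sy1 tr1 cg [rf2 sy2 tr2 cl cm].
have S1 (v : nat -> num M) x : scons (p1 x) (fun n => p1 (v n)) = fun n => p1 (scons x v n).
  by apply: funext => -[].
have S2 (v : nat -> strg M) x : scons (p2 x) (fun n => p2 (v n)) = fun n => p2 (scons x v n).
  by apply: funext => -[].
elim: p r1 r2 => //=.
- move=> t u r1 r2; rewrite !meval_qstruc.
  have A := qrep1 (meval r1 r2 t); have B := qrep1 (meval r1 r2 u).
  by split; [case: (cg _ _ _ _ A B)|case: (cg _ _ _ _ (sy1 _ _ A) (sy1 _ _ B))].
- by move=> t u r1 r2; rewrite !meval_qstruc qeq1.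
- move=> t X r1 r2; rewrite !meval_qstruc.
  have A := qrep1 (meval r1 r2 t); have B := qrep2 (r2 X).
  by split; [apply: (cm _ _ _ _ B A)|apply: (cm _ _ _ _ (sy2 _ _ B) (sy1 _ _ A))].
- by move=> X Y r1 r2; rewrite qeq2.
- by move=> p IHp q IHq r1 r2; rewrite IHp IHq.
- by move=> p IHp q IHq r1 r2; rewrite IHp IHq.
- by move=> p IHp q IHq r1 r2; rewrite IHp IHq.
- move=> p IH r1 r2; split=> h x; first by apply/IH; rewrite -S1.
  by rewrite -(qpiK x) S1; apply/IH.
- move=> p IH r1 r2; split=> -[x h]; last by exists (p1 x); rewrite S1; apply/IH.
  by exists (qrep x); apply/IH; rewrite -S1 qpiK.
- move=> p IH r1 r2; split=> h x; first by apply/IH; rewrite -S2.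
  by rewrite -(qpiK x) S2; apply/IH.
- move=> p IH r1 r2; split=> -[x h]; last by exists (p2 x); rewrite S2; apply/IH.
  by exists (qrep x); apply/IH; rewrite -S2 qpiK.
Qed.
End QuotStruc.

(** * Completeness *)

Lemma In_map (A B : Type) (f : A -> B) (G : seq A) q :
  List.In q (map f G) <-> exists a, List.In a G /\ q = f a.
Proof.
elim: G => [|b G IH] /=; first by split=> [//|[a []]].
split=> [[<-|/IH [a [ha ->]]]|[a [[->|ha] E]]].
- by exists b; split => //; left.
- by exists a; split => //; right.
- by left.
- by right; apply/IH; exists a.
Qed.

Lemma In_cat (A : Type) (G K : seq A) q :
  List.In q (G ++ K) <-> List.In q G \/ List.In q K.
Proof. by elim: G => [|a G IH] /=; [split; [right|case]|rewrite IH; tauto]. Qed.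

Lemma nd_weak G G' p : ND G p -> (forall q, List.In q G -> List.In q G') -> ND G' p.
Proof.
have C (A : form) G1 G2 : (forall q, List.In q G1 -> List.In q G2) ->
   forall q, List.In q (A :: G1) -> List.In q (A :: G2) by move=> h q /= [|/h]; [left|right].
have Mp (f : form -> form) G1 G2 : (forall q, List.In q G1 -> List.In q G2) ->
   forall q, List.In q (map f G1) -> List.In q (map f G2).
  by move=> h q /In_map [a [/h ha ->]]; apply/In_map; exists a.
move=> d; elim: d G' => {G p}.
- by move=> G p h G' /(_ _ h) /nd_ax.
- by move=> G p _ IH G' h; apply: nd_botE; apply: IH.
- by move=> G p _ IH G' h; apply: nd_raa; apply: IH; apply: C.
- by move=> G p q _ IH G' h; apply: nd_impI; apply: IH; apply: C.
- by move=> G p q _ IH _ IH' G' h; apply: (nd_impE (IH _ h)); apply: IH'.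
- by move=> G p q _ IH _ IH' G' h; apply: nd_andI; [apply: IH|apply: IH'].
- by move=> G p q _ IH G' h; apply: nd_andE1 (IH _ h).
- by move=> G p q _ IH G' h; apply: nd_andE2 (IH _ h).
- by move=> G p q _ IH G' h; apply: nd_orI1 (IH _ h).
- by move=> G p q _ IH G' h; apply: nd_orI2 (IH _ h).
- by move=> G p q r _ IH _ IH1 _ IH2 G' h; apply: (nd_orE (IH _ h)); [apply: IH1|apply: IH2]; apply: C.
- by move=> G p _ IH G' h; apply: nd_all1I; apply: IH; apply: Mp.
- by move=> G p t _ IH G' h; apply: nd_all1E; apply: IH.
- by move=> G p t _ IH G' h; apply: nd_ex1I (IH _ h).
- by move=> G p q _ IH _ IH' G' h; apply: (nd_ex1E (IH _ h)); apply: IH'; apply/C/Mp.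
- by move=> G p _ IH G' h; apply: nd_all2I; apply: IH; apply: Mp.
- by move=> G p t _ IH G' h; apply: nd_all2E; apply: IH.
- by move=> G p t _ IH G' h; apply: nd_ex2I (IH _ h).
- by move=> G p q _ IH _ IH' G' h; apply: (nd_ex2E (IH _ h)); apply: IH'; apply/C/Mp.
- by move=> G t G' _; apply: nd_refl1.
- by move=> G t u p _ IH _ IH' G' h; apply: (nd_leib1 (IH _ h)); apply: IH'.
- by move=> G t G' _; apply: nd_refl2.
- by move=> G t u p _ IH _ IH' G' h; apply: (nd_leib2 (IH _ h)); apply: IH'.
Qed.

Lemma nd_subst G p s1 s2 : ND G p -> ND (map (fsubst s1 s2) G) (fsubst s1 s2 p).
Proof.
have M1 v1 v2 G1 : map (fsubst (up1 v1) v2) (map shift1 G1) = map shift1 (map (fsubst v1 v2) G1).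
  by rewrite -!map_comp; apply: eq_map => a /=; rewrite shift1_fsubst.
have M2 v1 v2 G1 : map (fsubst (lift2 v1) (up2 v2)) (map shift2 G1) = map shift2 (map (fsubst v1 v2) G1).
  by rewrite -!map_comp; apply: eq_map => a /=; rewrite shift2_fsubst.
move=> d; elim: d s1 s2 => {G p}.
- by move=> G p h s1 s2; apply: nd_ax; apply/In_map; exists p.
- by move=> G p _ IH s1 s2; apply: nd_botE; apply: IH.
- by move=> G p _ IH s1 s2; apply: nd_raa; apply: IH.
- by move=> G p q _ IH s1 s2; apply: nd_impI; apply: IH.
- by move=> G p q _ IH _ IH' s1 s2; apply: nd_impE (IH s1 s2) (IH' _ _).
- by move=> G p q _ IH _ IH' s1 s2; apply: nd_andI; [apply: IH|apply: IH'].
- by move=> G p q _ IH s1 s2; apply: nd_andE1 (IH s1 s2).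
- by move=> G p q _ IH s1 s2; apply: nd_andE2 (IH s1 s2).
- by move=> G p q _ IH s1 s2; apply: nd_orI1 (IH s1 s2).
- by move=> G p q _ IH s1 s2; apply: nd_orI2 (IH s1 s2).
- by move=> G p q r _ IH _ IH1 _ IH2 s1 s2; apply: (nd_orE (IH s1 s2)); [apply: IH1|apply: IH2].
- by move=> G p _ IH s1 s2; apply: nd_all1I; rewrite -M1; apply: IH.
- by move=> G p t _ IH s1 s2; rewrite inst1_fsubst; apply: nd_all1E; apply: IH.
- by move=> G p t _ IH s1 s2; apply: (@nd_ex1I _ _ (tsubst s1 s2 t)); rewrite -inst1_fsubst.
- move=> G p q _ IH _ IH' s1 s2; apply: (nd_ex1E (IH s1 s2)).
  by rewrite -M1 -shift1_fsubst; apply: IH'.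
- by move=> G p _ IH s1 s2; apply: nd_all2I; rewrite -M2; apply: IH.
- by move=> G p t _ IH s1 s2; rewrite inst2_fsubst; apply: nd_all2E; apply: IH.
- by move=> G p t _ IH s1 s2; apply: (@nd_ex2I _ _ (s2 t)); rewrite -/(lift2 s1) -inst2_fsubst.
- move=> G p q _ IH _ IH' s1 s2; apply: (nd_ex2E (IH s1 s2)).
  by rewrite -M2 -shift2_fsubst; apply: IH'.
- by move=> G t s1 s2; apply: nd_refl1.
- move=> G t u p _ IH _ IH' s1 s2; rewrite inst1_fsubst; apply: (nd_leib1 (IH s1 s2)).
  by rewrite -inst1_fsubst.
- by move=> G t s1 s2; apply: nd_refl2.
- move=> G t u p _ IH _ IH' s1 s2; rewrite inst2_fsubst; apply: (nd_leib2 (IH s1 s2)).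
  by rewrite -inst2_fsubst.
Qed.

Lemma prov_mono (H K : form -> Prop) p : (forall q, H q -> K q) -> Provable H p -> Provable K p.
Proof. by move=> h [L [hL d]]; exists L; split => // q /hL /h. Qed.

Lemma prov_ax (H : form -> Prop) p : H p -> Provable H p.
Proof. by move=> h; exists [:: p]; split=> [q /= [<-|]//|]; apply: nd_ax; left. Qed.

Lemma prov_deduct (H : form -> Prop) a p :
  Provable (fun q => q = a \/ H q) p -> Provable H (FImp a p).
Proof.
move=> [L [hL d]].
have [K [hK hLK]] : exists K, (forall q, List.In q K -> H q) /\
    forall q, List.In q L -> List.In q (a :: K).
  elim: L hL {d} => [|b L IH] hL; first by exists [::].
  have [|K [h1 h2]] := IH; first by move=> q hq; apply: hL; right.
  have [->|hb] := hL b (or_introl erefl).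
    by exists K; split => // q /= [<-|/h2]; [left|].
  exists (b :: K); split=> q /=; first by move=> [<-|/h1].
  by move=> [<-|/h2 /= [<-|]]; [right; left|left|right; right].
by exists K; split => //; apply: nd_impI; apply: nd_weak d hLK.
Qed.

Lemma prov_mp (H : form -> Prop) a p : Provable H (FImp a p) -> Provable H a -> Provable H p.
Proof.
move=> [L [hL d]] [K [hK d']]; exists (L ++ K); split.
  by move=> q /In_cat [/hL|/hK].
by apply: (nd_impE (nd_weak d _)) (nd_weak d' _) => q ?; apply/In_cat; [left|right].
Qed.

Lemma prov_nd (H : form -> Prop) G p :
  (forall q, List.In q G -> Provable H q) -> ND G p -> Provable H p.
Proof.
elim: G p => [|a G IH] p h d; first by exists [::].
apply: (@prov_mp _ a); last by apply: h; left.
by apply: IH (nd_impI d) => q hq; apply: h; right.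
Qed.

Lemma prov_nd1 (H : form -> Prop) a p : Provable H a -> ND [:: a] p -> Provable H p.
Proof. by move=> h; apply: prov_nd => q /= [<-|]. Qed.

(** * Countability of the set of formulas *)

(** Finite labelled trees form a countable type, so an injection into them yields the enumeration
    along which the Henkin set is built. *)
Fixpoint tenc (t : term) : GenTree.tree nat :=
  match t with
  | TVar n => GenTree.Node 0 [:: GenTree.Leaf n]
  | TZero => GenTree.Node 1 [::] | TOne => GenTree.Node 2 [::]
  | TPlus a b => GenTree.Node 3 [:: tenc a; tenc b]
  | TTimes a b => GenTree.Node 4 [:: tenc a; tenc b]
  | TLen X => GenTree.Node 5 [:: GenTree.Leaf X]
  end.
Fixpoint fenc (p : form) : GenTree.tree nat :=
  match p with
  | FBot => GenTree.Node 0 [::]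
  | FLe t u => GenTree.Node 1 [:: tenc t; tenc u]
  | FEq1 t u => GenTree.Node 2 [:: tenc t; tenc u]
  | FIn t X => GenTree.Node 3 [:: tenc t; GenTree.Leaf X]
  | FEq2 X Y => GenTree.Node 4 [:: GenTree.Leaf X; GenTree.Leaf Y]
  | FImp p q => GenTree.Node 5 [:: fenc p; fenc q]
  | FAnd p q => GenTree.Node 6 [:: fenc p; fenc q]
  | FOr p q => GenTree.Node 7 [:: fenc p; fenc q]
  | FAll1 p => GenTree.Node 8 [:: fenc p]
  | FEx1 p => GenTree.Node 9 [:: fenc p]
  | FAll2 p => GenTree.Node 10 [:: fenc p]
  | FEx2 p => GenTree.Node 11 [:: fenc p]
  end.

Lemma tenc_inj : injective tenc.
Proof.
elim=> [n|||t IHt u IHu|t IHt u IHu|n] [k|||t' u'|t' u'|k] //=.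
- by case=> ->.
- by case=> /IHt -> /IHu ->.
- by case=> /IHt -> /IHu ->.
- by case=> ->.
Qed.

Lemma fenc_inj : injective fenc.
Proof.
elim=> [|t u|t u|t X|X Y|p IHp q IHq|p IHp q IHq|p IHp q IHq|p IH|p IH|p IH|p IH]
  [|t' u'|t' u'|t' X'|X' Y'|p' q'|p' q'|p' q'|p'|p'|p'|p'] //=.
- by case=> /tenc_inj -> /tenc_inj ->.
- by case=> /tenc_inj -> /tenc_inj ->.
- by case=> /tenc_inj -> ->.
- by case=> -> ->.
- by case=> /IHp -> /IHq ->.
- by case=> /IHp -> /IHq ->.
- by case=> /IHp -> /IHq ->.
- by case=> /IH ->.
- by case=> /IH ->.
- by case=> /IH ->.
- by case=> /IH ->.
Qed.

Lemma form_enum : exists E : nat -> form, forall p, exists n, E n = p.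
Proof.
exists (fun n => if pselect (exists p, pickle (fenc p) = n) is left h
          then projT1 (cid h) else FBot) => p.
exists (pickle (fenc p)); case: pselect => [h|[]]; last by exists p.
by case: cid => q /= /(pcan_inj pickleK) /fenc_inj.
Qed.

Lemma list_bound (G : seq form) : exists n, forall q, List.In q G -> fnb n q /\ fsb n q.
Proof.
elim: G => [|p G [n h]]; first by exists 0.
have [k [a b]] := fnb_ex p; exists (maxn n k) => q /= [<-|/h [c d]].
  by split; [apply: fnb_mono a|apply: fsb_mono b]; lia.
by split; [apply: fnb_mono c|apply: fsb_mono d]; lia.
Qed.

(** * Maximal consistent sets with witnesses *)

Section Henkin.
Variables (T : form -> Prop) (Tcl : forall q, T q -> Defs.closed q).

Definition TG (G : seq form) (q : form) : Prop := T q \/ List.In q G.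

Definition consis G := ~ Provable (TG G) FBot.

(** In a proof of absurdity from the instance at x, rename x to 0 and shift all other variables.
    This gives the second premise of [nd_ex1E], for the members of G because x is fresh and for the
    axioms of T because they are closed. *)
Lemma fresh_wit1 x q G : (forall p, List.In p (FEx1 q :: G) -> fnb x p /\ fsb x p) ->
  consis (FEx1 q :: G) -> consis (inst1 (TVar x) q :: FEx1 q :: G).
Proof.
move=> hx; apply: contra_not => h.
have /prov_deduct [L [hL d]] : Provable (fun p => p = inst1 (TVar x) q \/ TG (FEx1 q :: G) p) FBot.
  by apply: prov_mono h => p [?|/= [<-|]]; [right; left|left|right; right].
have {}d : ND (inst1 (TVar x) q :: L) FBot.
  apply: (@nd_impE _ (inst1 (TVar x) q)); last by apply: nd_ax; left.
  by apply: nd_weak d _ => p ?; right.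
pose s n := if n == x then TVar 0 else TVar n.+1.
have := nd_subst s id d; rewrite /=.
have -> : fsubst s id (inst1 (TVar x) q) = q.
  have [/= a b] := hx _ (or_introl erefl).
  rewrite /inst1 fsubst_comp -[RHS]fsubst_id; apply: (fsubst_eq_bounded a b) => //.
  by move=> [|i] /= hi; rewrite /cmp1 /= /s ?eqxx //; case: eqP => //; lia.
have -> : map (fsubst s id) L = map shift1 L.
  elim: L hL {d} => //= p L IH hL; rewrite IH; last by move=> r hr; apply: hL; right.
  congr cons; have [/Tcl cp|/hx [a b]] := hL p (or_introl erefl).
    by rewrite /shift1 !closed_fsubst.
  by apply: (fsubst_eq_bounded a b) => // i hi; rewrite /s; case: eqP => //; lia.
move=> d1; exists (FEx1 q :: L); split=> [p /= [<-|/hL//]|]; first by right; left.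
apply: (@nd_ex1E _ q FBot); first by apply: nd_ax; left.
by apply: nd_weak d1 _ => p /= [<-|?]; [left|right; right].
Qed.

Lemma fresh_wit2 x q G : (forall p, List.In p (FEx2 q :: G) -> fnb x p /\ fsb x p) ->
  consis (FEx2 q :: G) -> consis (inst2 x q :: FEx2 q :: G).
Proof.
move=> hx; apply: contra_not => h.
have /prov_deduct [L [hL d]] : Provable (fun p => p = inst2 x q \/ TG (FEx2 q :: G) p) FBot.
  by apply: prov_mono h => p [?|/= [<-|]]; [right; left|left|right; right].
have {}d : ND (inst2 x q :: L) FBot.
  apply: (@nd_impE _ (inst2 x q)); last by apply: nd_ax; left.
  by apply: nd_weak d _ => p ?; right.
pose s n := if n == x then 0 else n.+1.
have := nd_subst TVar s d; rewrite /=.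
have -> : fsubst TVar s (inst2 x q) = q.
  have [/= a b] := hx _ (or_introl erefl).
  rewrite /inst2 fsubst_comp -[RHS]fsubst_id; apply: (fsubst_eq_bounded a b) => //.
  by move=> [|i] /= hi; rewrite /cmp2 /= /s ?eqxx //; case: eqP => //; lia.
have -> : map (fsubst TVar s) L = map shift2 L.
  elim: L hL {d} => //= p L IH hL; rewrite IH; last by move=> r hr; apply: hL; right.
  congr cons; have [/Tcl cp|/hx [a b]] := hL p (or_introl erefl).
    by rewrite /shift2 !closed_fsubst.
  by apply: (fsubst_eq_bounded a b) => // i hi; rewrite /s; case: eqP => //; lia.
move=> d1; exists (FEx2 q :: L); split=> [p /= [<-|/hL//]|]; first by right; left.
apply: (@nd_ex2E _ q FBot); first by apply: nd_ax; left.
by apply: nd_weak d1 _ => p /= [<-|?]; [left|right; right].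
Qed.

Lemma consis_ext p G : consis (p :: G) ->
  exists K, [/\ consis K, (forall q, List.In q (p :: G) -> List.In q K),
    (forall q, p = FEx1 q -> exists t, List.In (inst1 t q) K) &
    (forall q, p = FEx2 q -> exists Y, List.In (inst2 Y q) K)].
Proof.
move=> c; have [x hx] := list_bound (p :: G).
case: p c hx => [|t u|t u|t X|X Y|p q|p q|p q|p|p|p|p] c hx.
10: { exists (inst1 (TVar x) p :: FEx1 p :: G); split => //.
  - exact: fresh_wit1.
  - by move=> q; right.
  - by move=> q [<-]; exists (TVar x); left. }
11: { exists (inst2 x p :: FEx2 p :: G); split => //.
  - exact: fresh_wit2.
  - by move=> q; right.
  - by move=> q [<-]; exists x; left. }
all: by match goal with c : consis ?K |- _ => exists K end; split.
Qed.

Variables (G0 : seq form) (c0 : consis G0) (E : nat -> form) (hE : forall p, exists n, E n = p).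

Lemma stage_ex : exists st : nat -> seq form, st 0 = G0 /\ forall n,
  [/\ consis (st n), (forall q, List.In q (st n) -> List.In q (st n.+1)) &
   consis (E n :: st n) -> [/\ List.In (E n) (st n.+1),
    (forall q, E n = FEx1 q -> exists t, List.In (inst1 t q) (st n.+1)) &
    (forall q, E n = FEx2 q -> exists Y, List.In (inst2 Y q) (st n.+1))]].
Proof.
have step n G : exists K, consis G -> [/\ consis K, (forall q, List.In q G -> List.In q K) &
   consis (E n :: G) -> [/\ List.In (E n) K,
    (forall q, E n = FEx1 q -> exists t, List.In (inst1 t q) K) &
    (forall q, E n = FEx2 q -> exists Y, List.In (inst2 Y q) K)]].
  case: (pselect (consis (E n :: G))) => [c|nc]; last by exists G.
  have [K [cK i h1 h2]] := consis_ext c; exists K => _; split => //.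
    by move=> q hq; apply: i; right.
  by move=> _; split => //; apply: i; left.
pose nxt n G := projT1 (cid (step n G)).
pose st := fix st n := if n is k.+1 then nxt k (st k) else G0.
have cst n : consis (st n).
  by elim: n => //= n IH; rewrite /nxt; case: cid => K /= /(_ IH) [].
exists st; split => // n; move: (cst n) => c; rewrite /=.
by rewrite /nxt; case: cid => K /= /(_ c) [].
Qed.

Lemma henkin_set : exists H : form -> Prop, [/\
  (forall q, T q \/ List.In q G0 -> H q), ~ H FBot,
  (forall q, H q \/ H (fneg q)) /\ (forall G p, (forall q, List.In q G -> H q) -> ND G p -> H p),
  (forall q, H (FEx1 q) -> exists t, H (inst1 t q)) &
  (forall q, H (FEx2 q) -> exists Y, H (inst2 Y q))].
Proof.
have [st [st0 hst]] := stage_ex.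
have stm n k q : List.In q (st n) -> List.In q (st (n + k)).
  elim: k => [|k IH] h; first by rewrite addn0.
  by rewrite addnS; case: (hst (n + k)) => _ h1 _; apply/h1/IH.
pose H q := exists n, Provable (TG (st n)) q.
have Hin n q : List.In q (st n) -> H q by move=> h; exists n; apply: prov_ax; right.
have Hm n k q : Provable (TG (st n)) q -> Provable (TG (st (n + k))) q.
  by apply: prov_mono => p [|/stm]; [left|right].
have Hnd G p : (forall q, List.In q G -> H q) -> ND G p -> H p.
  move=> hG d.
  have [n hn] : exists n, forall q, List.In q G -> Provable (TG (st n)) q.
    elim: G hG {d} => [|a G IH] hG; first by exists 0.
    have [|n hn] := IH; first by move=> q hq; apply: hG; right.
    have [k hk] := hG a (or_introl erefl); exists (n + k) => q /= [<-|/hn].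
      by rewrite addnC; apply: Hm.
    exact: Hm.
  by exists n; apply: prov_nd hn d.
have Hnb : ~ H FBot by move=> [n]; case: (hst n).
(* A member of H is consistent with every stage; hence it was added at its own stage, together with
   a witness if it is existential. *)
have cE n : H (E n) -> consis (E n :: st n).
  move=> [k hk] hb; apply: Hnb; exists (n + k); apply: (@prov_mp _ (E n)).
    apply: Hm; apply: prov_deduct; apply: prov_mono hb => q [|/= [<-|]].
    - by right; left.
    - by left.
    - by right; right.
  by rewrite addnC; apply: Hm.
exists H; split => //.
- move=> q h; exists 0; apply: prov_ax; rewrite st0; exact: h.
- split => // q; have [n <-] := hE q; case: (pselect (consis (E n :: st n))) => [c|nc].
    by left; case: (hst n) => _ _ /(_ c) [] /Hin.
  right; exists n; apply: prov_deduct; move/contrapT: nc; apply: prov_mono => p [|/= [<-|]].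
  - by right; left.
  - by left.
  - by right; right.
- move=> q; have [n En] := hE (FEx1 q); rewrite -En => /cE c.
  by case: (hst n) => _ _ /(_ c) [] _ /(_ _ En) [t /Hin ht] _; exists t.
- move=> q; have [n En] := hE (FEx2 q); rewrite -En => /cE c.
  by case: (hst n) => _ _ /(_ c) [] _ _ /(_ _ En) [t /Hin ht]; exists t.
Qed.

End Henkin.

(** * The term model *)

Section TermModel.
Variables (H : form -> Prop) (Hbot : ~ H FBot) (Hmax : forall q, H q \/ H (fneg q))
  (Hnd : forall G p, (forall q, List.In q G -> H q) -> ND G p -> H p)
  (Hex1 : forall q, H (FEx1 q) -> exists t, H (inst1 t q))
  (Hex2 : forall q, H (FEx2 q) -> exists Y, H (inst2 Y q)).

(* Assignments in this structure are exactly substitutions, so truth of p under (r1, r2)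
   is membership of fsubst r1 r2 p in H. *)
Definition termM : struc :=
  @Struc term nat TZero TOne TPlus TTimes TLen (fun t u => H (FLe t u))
    (fun t u => H (FEq1 t u)) (fun X t => H (FIn t X)) (fun X Y => H (FEq2 X Y)).

Lemma henkin_nd1 a p : H a -> ND [:: a] p -> H p.
Proof. by move=> h; apply: Hnd => q /= [<-|]. Qed.
Lemma henkin_nd2 a b p : H a -> H b -> ND [:: a; b] p -> H p.
Proof. by move=> ha hb; apply: Hnd => q /= [<-|[<-|]]. Qed.

Lemma henkin_imp a b : H (FImp a b) <-> (H a -> H b).
Proof.
split=> [h ha|h].
  by apply: (henkin_nd2 h ha); apply: (@nd_impE _ a); apply: nd_ax => /=; tauto.
case: (Hmax a) => [/h hb|hn].
  by apply: (henkin_nd1 hb); apply: nd_impI; apply: nd_ax => /=; tauto.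
apply: (henkin_nd1 hn); apply: nd_impI; apply: nd_botE.
by apply: (@nd_impE _ a); apply: nd_ax => /=; tauto.
Qed.

Lemma henkin_not a : H (fneg a) <-> ~ H a.
Proof. by rewrite /fneg henkin_imp; split=> h ha; [apply: Hbot; apply: h|case: (h ha)]. Qed.

Lemma termM_eval r1 r2 t : @meval termM r1 r2 t = tsubst r1 r2 t.
Proof. by elim: t => //= t -> u ->. Qed.

Lemma termM_sat p (r1 : nat -> term) (r2 : nat -> nat) :
  @msat termM r1 r2 p <-> H (fsubst r1 r2 p).
Proof.
elim: p r1 r2 => //=.
- by move=> t u r1 r2; rewrite !termM_eval.
- by move=> t u r1 r2; rewrite !termM_eval.
- by move=> t X r1 r2; rewrite !termM_eval.
- by move=> p IHp q IHq r1 r2; rewrite IHp IHq henkin_imp.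
- move=> p IHp q IHq r1 r2; rewrite IHp IHq; split=> [[a b]|h].
    by apply: (henkin_nd2 a b); apply: nd_andI; apply: nd_ax => /=; tauto.
  by split; apply: (henkin_nd1 h); [apply: nd_andE1|apply: nd_andE2]; apply: nd_ax => /=; left.
- move=> p IHp q IHq r1 r2; rewrite IHp IHq; split=> [[a|a]|h].
  + by apply: (henkin_nd1 a); apply: nd_orI1; apply: nd_ax; left.
  + by apply: (henkin_nd1 a); apply: nd_orI2; apply: nd_ax; left.
  + set a := fsubst _ _ p in h *; set b := fsubst _ _ q in h *.
    apply: contrapT => /not_orP [/henkin_not na /henkin_not nb]; apply: Hbot.
    apply: (@Hnd [:: FOr a b; fneg a; fneg b]); first by move=> s /= [<-|[<-|[<-|]]].
    apply: (@nd_orE _ a b); first by apply: nd_ax; left.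
    * by apply: (@nd_impE _ a); apply: nd_ax => /=; tauto.
    * by apply: (@nd_impE _ b); apply: nd_ax => /=; tauto.
- move=> p IH r1 r2; set a := fsubst _ _ p; split=> [h|h x]; last first.
    by apply/IH; rewrite -inst1_up; apply: (henkin_nd1 h); apply: nd_all1E; apply: nd_ax; left.
  apply: contrapT => /henkin_not na.
  (* If the universal formula were missing from H, its classical dual would be in H, and the Henkin
     witness of the dual would be a counterexample to the hypothesis. *)
  have /Hex1 [t] : H (FEx1 (fneg a)).
    apply: (henkin_nd1 na); apply: nd_raa.
    apply: (@nd_impE _ (FAll1 a)); first by apply: nd_ax => /=; tauto.
    apply: nd_all1I; apply: nd_raa.
    apply: (@nd_impE _ (shift1 (FEx1 (fneg a)))); first by apply: nd_ax => /=; tauto.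
    apply: (@nd_ex1I _ (fsubst (up1 (fun n => TVar n.+1)) id (fneg a)) (TVar 0)).
    rewrite inst1_up.
    rewrite (_ : scons _ _ = TVar) ?fsubst_id; last by apply: funext => -[].
    by apply: nd_ax; left.
  rewrite -[inst1 _ _]/(fneg (inst1 t a)) => /henkin_not; apply.
  by rewrite inst1_up; apply/IH.
- move=> p IH r1 r2; split=> [[t /IH h]|/Hex1 [t]]; last first.
    by rewrite inst1_up => /IH; exists t.
  by apply: (henkin_nd1 h); apply: (@nd_ex1I _ _ t); rewrite inst1_up; apply: nd_ax; left.
- move=> p IH r1 r2; rewrite -/(lift2 r1); set a := fsubst _ _ p; split=> [h|h x]; last first.
    by apply/IH; rewrite -inst2_up; apply: (henkin_nd1 h); apply: nd_all2E; apply: nd_ax; left.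
  apply: contrapT => /henkin_not na.
  have /Hex2 [t] : H (FEx2 (fneg a)).
    apply: (henkin_nd1 na); apply: nd_raa.
    apply: (@nd_impE _ (FAll2 a)); first by apply: nd_ax => /=; tauto.
    apply: nd_all2I; apply: nd_raa.
    apply: (@nd_impE _ (shift2 (FEx2 (fneg a)))); first by apply: nd_ax => /=; tauto.
    apply: (@nd_ex2I _ (fsubst (lift2 TVar) (up2 S) (fneg a)) 0).
    rewrite inst2_up.
    rewrite (_ : scons _ _ = id) ?fsubst_id; last by apply: funext => -[].
    by apply: nd_ax; left.
  rewrite -[inst2 _ _]/(fneg (inst2 t a)) => /henkin_not; apply.
  by rewrite inst2_up; apply/IH.
- move=> p IH r1 r2; rewrite -/(lift2 r1); split=> [[t /IH h]|/Hex2 [t]]; last first.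
    by rewrite inst2_up => /IH; exists t.
  by apply: (henkin_nd1 h); apply: (@nd_ex2I _ _ t); rewrite inst2_up; apply: nd_ax; left.
Qed.

Lemma henkin_leib1 t u p : H (FEq1 t u) -> H (inst1 t p) -> H (inst1 u p).
Proof.
by move=> h h'; apply: (henkin_nd2 h h'); apply: (@nd_leib1 _ t); apply: nd_ax => /=; tauto.
Qed.
Lemma henkin_leib2 t u p : H (FEq2 t u) -> H (inst2 t p) -> H (inst2 u p).
Proof.
by move=> h h'; apply: (henkin_nd2 h h'); apply: (@nd_leib2 _ t); apply: nd_ax => /=; tauto.
Qed.

(** Every congruence law is Leibniz's rule for an atomic formula in which one place is marked by
    variable 0. *)
Lemma termM_normal : normal termM.
Proof.
have E t v : tsubst (scons v TVar) id (shift1t t) = t.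
  by rewrite /shift1t tsubst_comp -[RHS]tsubst_id.
have rf1 t : H (FEq1 t t) by apply: (@Hnd [::]) => //; apply: nd_refl1.
have rf2 t : H (FEq2 t t) by apply: (@Hnd [::]) => //; apply: nd_refl2.
have sy t u : H (FEq1 t u) -> H (FEq1 u t).
  move=> h; have := @henkin_leib1 t u (FEq1 (TVar 0) (shift1t t)) h.
  by rewrite /inst1 /= !E; apply.
have trr t u v : H (FEq1 t u) -> H (FEq1 u v) -> H (FEq1 t v).
  move=> h h'; have := @henkin_leib1 u v (FEq1 (shift1t t) (TVar 0)) h'.
  by rewrite /inst1 /= !E; apply.
split => //.
- move=> t t' u u' h h'; split.
  + apply: (@trr _ (TPlus t' u)).
      have := @henkin_leib1 t t' (FEq1 (shift1t (TPlus t u)) (TPlus (TVar 0) (shift1t u))) h.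
      by rewrite /inst1 /= !E; apply.
    have := @henkin_leib1 u u' (FEq1 (shift1t (TPlus t' u)) (TPlus (shift1t t') (TVar 0))) h'.
    by rewrite /inst1 /= !E; apply.
  + apply: (@trr _ (TTimes t' u)).
      have := @henkin_leib1 t t' (FEq1 (shift1t (TTimes t u)) (TTimes (TVar 0) (shift1t u))) h.
      by rewrite /inst1 /= !E; apply.
    have := @henkin_leib1 u u' (FEq1 (shift1t (TTimes t' u)) (TTimes (shift1t t') (TVar 0))) h'.
    by rewrite /inst1 /= !E; apply.
  + move=> /= hl.
    have := @henkin_leib1 t t' (FLe (TVar 0) (shift1t u)) h; rewrite /inst1 /= !E => /(_ hl) hl'.
    by have := @henkin_leib1 u u' (FLe (shift1t t') (TVar 0)) h'; rewrite /inst1 /= !E => /(_ hl').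
- split => //.
  + by move=> X Y h; apply: (@henkin_leib2 X Y (FEq2 0 X.+1) h (rf2 X)).
  + by move=> X Y Z h h'; apply: (@henkin_leib2 Y Z (FEq2 X.+1 0) h').
  + by move=> X Y h; apply: (@henkin_leib2 X Y (FEq1 (TLen X.+1) (TLen 0)) h (rf1 _)).
  + move=> X Y x y h h' /= hm.
    have := @henkin_leib1 x y (FIn (TVar 0) X) h'; rewrite /inst1 /= => /(_ hm) hm'.
    have := @henkin_leib2 X Y (FIn (shift2t y) 0) h; rewrite /inst2 /=.
    have E2 V : tsubst TVar (scons V id) (shift2t y) = y.
      by rewrite /shift2t tsubst_comp -[RHS]tsubst_id.
    by rewrite !E2; apply.
Qed.
End TermModel.

Lemma completeness (T : form -> Prop) p :
  (forall q, T q -> Defs.closed q) -> Defs.closed p ->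
  (forall M, strict M -> models M T -> forall r1 r2, @msat M r1 r2 p) ->
  Provable T p.
Proof.
move=> Tcl pcl hp; apply: contrapT => np.
have c0 : consis T [:: fneg p].
  move=> hb; apply: np; have /prov_deduct h : Provable (fun q => q = fneg p \/ T q) FBot.
    by apply: prov_mono hb => q [|/= [<-|]//]; [right|left].
  apply: (prov_nd1 h); apply: nd_raa.
  by apply: (@nd_impE _ (fneg p)); apply: nd_ax => /=; tauto.
have [E hE] := form_enum.
have [H [HT Hb [Hmax Hnd] He1 He2]] := henkin_set Tcl c0 hE.
have nM := termM_normal Hnd.
have q1 q : Defs.closed q -> H q -> forall r1 r2, @msat (termM H) r1 r2 q.
  by move=> cq hq r1 r2; apply/(termM_sat Hb Hmax Hnd He1 He2); rewrite closed_fsubst.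
have : ~ H p.
  by apply/(henkin_not Hb Hmax Hnd); apply: HT; right; left.
apply; rewrite -(fsubst_id p); apply/(termM_sat Hb Hmax Hnd He1 He2).
apply/(msat_qstruc nM); apply: hp; first exact: qstruc_strict.
move=> q hq r1 r2.
have -> : r1 = (fun n => qpi (@meq1 (termM H)) (qrep (r1 n))).
  by apply: funext => n; rewrite qpiK.
have -> : r2 = (fun n => qpi (@meq2 (termM H)) (qrep (r2 n))).
  by apply: funext => n; rewrite qpiK.
by apply/(msat_qstruc nM); apply: q1; [apply: Tcl|apply: HT; left].
Qed.

(** * Strings *)

(** Drops the trailing zeros: a bit is kept if it is 1 or if some later bit was kept. This gives the
    canonical sequence that [str] demands. *)
Definition nrm (s : seq bool) : seq bool :=
  foldr (fun b s' => if b || (s' != [::]) then b :: s' else [::]) [::] s.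

Lemma nrm_ok s : last true (nrm s).
Proof.
elim: s => //= b s IH; case: ifP => // /orP [->|] /=.
  by case: (nrm s) IH.
by case: (nrm s) IH.
Qed.

Lemma nth_nrm s i : nth false (nrm s) i = nth false s i.
Proof.
elim: s i => //= b s IH [|i] /=.
  by case: ifP => //= /negbT; rewrite negb_or => /andP [/negbTE ->].
rewrite -IH; case: ifP => //= /negbT; rewrite negb_or negbK => /andP [_ /eqP ->].
by rewrite !nth_nil.
Qed.

Definition strof (n : nat) (P : pred nat) : str := Str (nrm_ok (mkseq P n)).

Lemma smem_strof n P z : smem (strof n P) z = (z < n) && P z.
Proof.
rewrite /smem /= nth_nrm; case: (ltnP z n) => h; first by rewrite nth_mkseq.
by rewrite nth_default // size_mkseq.
Qed.

Lemma smem_lt X z : smem X z -> z < slen X.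
Proof. by rewrite /smem /slen; case: ltnP => // h; rewrite nth_default. Qed.

Lemma smem_last X z : z.+1 = slen X -> smem X z.
Proof.
case: X => s ok; rewrite /slen /smem /= => E; have -> : z = (size s).-1 by rewrite -E.
rewrite nth_last; case: s ok E => //= a s.
Qed.

Lemma smem_sempty z : smem sempty z = false.
Proof. by rewrite /smem nth_nil. Qed.

Lemma slen_le X n : (forall z, smem X z -> z < n) -> slen X <= n.
Proof.
move=> h; case E: (slen X) => [//|k]; apply: h; exact: smem_last.
Qed.

Lemma slen_strof n P : slen (strof n P) <= n.
Proof. by apply: slen_le => z; rewrite smem_strof => /andP []. Qed.

Lemma str_ext X Y : (forall z, smem X z = smem Y z) -> X = Y.
Proof.
move=> h; have E : slen X = slen Y.
  apply/eqP; rewrite eqn_leq; apply/andP.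
  by split; apply: slen_le => z; [rewrite h|rewrite -h]; apply: smem_lt.
case: X Y h E => s os [t ot] h E; have st : s = t by apply: (@eq_from_nth _ false) => // i _; apply: h.
by subst t; congr Str; apply: bool_irrelevance.
Qed.

(** Describes the graph of the length by bit tests whose quantifiers can be bounded, the form used
    in [ndef_len]. *)
Lemma slen_eq X y : slen X = y <-> (forall z, smem X z -> z < y) /\ (y = 0 \/ exists z, z.+1 = y /\ smem X z).
Proof.
split=> [<-|[h1 h2]].
  split; first by move=> z; apply: smem_lt.
  case E: (slen X) => [|k]; [by left|right]; exists k; split => //; exact: smem_last.
have := slen_le h1; case: h2 => [->|[z [<- /smem_lt]]]; lia.
Qed.

(** * First-order logic with modular counting quantifiers *)

Definition balln (n : nat) (P : pred nat) : bool := all P (iota 0 n.+1).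

Lemma ballnP n (P : pred nat) : reflect (forall x, x <= n -> P x) (balln n P).
Proof.
apply: (iffP allP) => h x hx; apply: h; first by rewrite mem_iota add0n ltnS.
by move: hx; rewrite mem_iota add0n ltnS.
Qed.

(** The terms are those of L^2_A over input strings only: functions of a chain and [mod_m] of
    computed strings are to be traded for the quantifier [GCnt]. A short list of connectives keeps
    later inductions small; the others are derived as closure properties of [gdef]. *)
Inductive gform : Type :=
| GBot | GLe (t u : term) | GIn (t : term) (X : nat) | GImp (p q : gform)
| GAll (t : term) (p : gform) | GCnt (t v : term) (p : gform).

(* GAll and GCnt bind TVar 0 in p, but not in t and v. *)
Fixpoint gsat (m : nat) (r1 : nat -> nat) (r2 : nat -> str) (p : gform) : bool :=
  match p with
  | GBot => false
  | GLe t u => teval r1 r2 t <= teval r1 r2 u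
  | GIn t X => smem (r2 X) (teval r1 r2 t)
  | GImp p q => gsat m r1 r2 p ==> gsat m r1 r2 q
  | GAll t p => balln (teval r1 r2 t) (fun x => gsat m (scons x r1) r2 p)
  | GCnt t v p =>
      count (fun x => gsat m (scons x r1) r2 p) (iota 0 (teval r1 r2 t)) %% m == teval r1 r2 v
  end.

Definition upr (f : nat -> nat) (n : nat) : nat := if n is k.+1 then (f k).+1 else 0.

Fixpoint gren (f1 f2 : nat -> nat) (p : gform) : gform :=
  let st := tsubst (fun n => TVar (f1 n)) f2 in
  match p with
  | GBot => GBot
  | GLe t u => GLe (st t) (st u)
  | GIn t X => GIn (st t) (f2 X)
  | GImp p q => GImp (gren f1 f2 p) (gren f1 f2 q)
  | GAll t p => GAll (st t) (gren (upr f1) f2 p)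
  | GCnt t v p => GCnt (st t) (st v) (gren (upr f1) f2 p)
  end.

Lemma teval_subst r1 r2 s1 s2 t :
  teval r1 r2 (tsubst s1 s2 t) = teval (fun n => teval r1 r2 (s1 n)) (fun n => r2 (s2 n)) t.
Proof. by elim: t => //= t -> u ->. Qed.

Lemma gsat_ren m r1 r2 f1 f2 p :
  gsat m r1 r2 (gren f1 f2 p) = gsat m (fun n => r1 (f1 n)) (fun n => r2 (f2 n)) p.
Proof.
have U x v g : (fun n => scons x v (upr g n)) = scons x (fun n => v (g n)) :> (nat -> nat).
  by apply: funext => -[].
elim: p r1 r2 f1 f2 => //=.
- by move=> t u *; rewrite !teval_subst.
- by move=> t X *; rewrite !teval_subst.
- by move=> p IHp q IHq *; rewrite IHp IHq.
- by move=> t p IH *; rewrite !teval_subst; apply: eq_all => x; rewrite IH U.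
- by move=> t v p IH *; rewrite !teval_subst; congr (_ %% _ == _); apply: eq_count => x; rewrite IH U.
Qed.

Section Gdef.
Variable m : nat.
Notation E1 := (nat -> nat).
Notation E2 := (nat -> str).


Definition gdef (R : E1 -> E2 -> Prop) : Prop :=
  exists p, forall r1 r2, R r1 r2 <-> gsat m r1 r2 p.
Definition tbnd (f : E1 -> E2 -> nat) : Prop :=
  exists b, forall r1 r2, f r1 r2 <= teval r1 r2 b.
(** FAC^0(m) with whole environments as inputs, so that composition becomes substitution. Number
    variable 0 holds the value (in [sdef] the bit position) and the inputs move up by one; bounding
    terms stand for polynomial bounds. *)
Definition ndef (f : E1 -> E2 -> nat) : Prop :=
  tbnd f /\ gdef (fun r1 r2 => r1 0 = f (fun n => r1 n.+1) r2).
Definition sdef (F : E1 -> E2 -> str) : Prop :=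
  tbnd (fun r1 r2 => slen (F r1 r2)) /\ gdef (fun r1 r2 => smem (F (fun n => r1 n.+1) r2) (r1 0)).

Lemma gdef_ext R R' : (forall r1 r2, R' r1 r2 <-> R r1 r2) -> gdef R -> gdef R'.
Proof. by move=> h [p hp]; exists p => r1 r2; rewrite h. Qed.

Lemma ndef_ext f g : (forall r1 r2, g r1 r2 = f r1 r2) -> ndef f -> ndef g.
Proof.
move=> h; have -> // : g = f by apply: funext => r1; apply: funext => r2.
Qed.

Lemma sdef_ext f g : (forall r1 r2, g r1 r2 = f r1 r2) -> sdef f -> sdef g.
Proof.
move=> h; have -> // : g = f by apply: funext => r1; apply: funext => r2.
Qed.

Lemma gdef_ren R f1 f2 : gdef R -> gdef (fun r1 r2 => R (fun n => r1 (f1 n)) (fun n => r2 (f2 n))).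
Proof. by move=> [p hp]; exists (gren f1 f2 p) => r1 r2; rewrite gsat_ren hp. Qed.

Lemma gdef_bot : gdef (fun _ _ => False).
Proof. by exists GBot. Qed.

Lemma gdef_imp R S : gdef R -> gdef S -> gdef (fun r1 r2 => R r1 r2 -> S r1 r2).
Proof.
move=> [p hp] [q hq]; exists (GImp p q) => r1 r2 /=; rewrite hp hq.
by split=> /implyP.
Qed.

Lemma gdef_not R : gdef R -> gdef (fun r1 r2 => ~ R r1 r2).
Proof. by move=> hR; apply: gdef_imp hR gdef_bot. Qed.

Lemma gdef_or R S : gdef R -> gdef S -> gdef (fun r1 r2 => R r1 r2 \/ S r1 r2).
Proof.
move=> hR hS; apply: gdef_ext (gdef_imp (gdef_not hR) hS) => r1 r2 /=.
by split=> [[]|h] //; case: (pselect (R r1 r2)); tauto.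
Qed.

Lemma gdef_and R S : gdef R -> gdef S -> gdef (fun r1 r2 => R r1 r2 /\ S r1 r2).
Proof.
move=> hR hS; apply: gdef_ext (gdef_not (gdef_imp hR (gdef_not hS))) => r1 r2 /=.
case: (pselect (R r1 r2)); case: (pselect (S r1 r2)); tauto.
Qed.

Lemma gdef_iff R S : gdef R -> gdef S -> gdef (fun r1 r2 => R r1 r2 <-> S r1 r2).
Proof.
move=> hR hS; apply: gdef_ext (gdef_and (gdef_imp hR hS) (gdef_imp hS hR)) => r1 r2 /=; tauto.
Qed.

Lemma gdef_all0 b R : gdef R ->
  gdef (fun r1 r2 => forall x, x <= teval r1 r2 b -> R (scons x r1) r2).
Proof.
move=> [p hp]; exists (GAll b p) => r1 r2 /=; split.
  by move=> h; apply/ballnP => x /h /hp.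
by move/ballnP => h x /h /hp.
Qed.

Lemma gdef_ex0 b R : gdef R ->
  gdef (fun r1 r2 => exists x, x <= teval r1 r2 b /\ R (scons x r1) r2).
Proof.
move=> hR; apply: gdef_ext (gdef_not (gdef_all0 b (gdef_not hR))) => r1 r2 /=; split.
  by move=> [x [hx h]] /(_ x hx).
by move=> /existsNP [x /not_implyP [hx /contrapT h]]; exists x.
Qed.

(** A number function is eliminated by quantifying over its value, and its bounding term bounds that
    quantifier. *)
Lemma gdef_subst1 R f : gdef R -> ndef f -> gdef (fun r1 r2 => R (scons (f r1 r2) r1) r2).
Proof.
move=> hR [[b hb] hf].
apply: gdef_ext (gdef_ex0 b (gdef_and hf hR)) => r1 r2 /=; split.
  by move=> h; exists (f r1 r2); split.
by move=> [x [_ [-> h]]].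
Qed.

Lemma tbnd_wk f : tbnd f -> tbnd (fun r1 r2 => f (fun n => r1 n.+1) r2).
Proof.
move=> [b hb]; exists (tsubst (fun n => TVar n.+1) id b) => r1 r2.
by rewrite teval_subst.
Qed.

Lemma gdef_wk R : gdef R -> gdef (fun r1 r2 => R (fun n => r1 n.+1) r2).
Proof. exact: (gdef_ren (fun n => n.+1) id). Qed.

(* Weakening below variable 0, the argument of the graph or of the bit graph. *)
Lemma gdef_wk1 R : gdef R -> gdef (fun r1 r2 => R (fun n => r1 (if n is k.+1 then k.+2 else 0)) r2).
Proof. exact: (gdef_ren (fun n => if n is k.+1 then k.+2 else 0) id). Qed.

Lemma ndef_wk f : ndef f -> ndef (fun r1 r2 => f (fun n => r1 n.+1) r2).
Proof. by move=> [hb hf]; split; [exact: tbnd_wk|exact: (gdef_wk1 hf)]. Qed.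

Lemma sdef_wk f : sdef f -> sdef (fun r1 r2 => f (fun n => r1 n.+1) r2).
Proof. by move=> [hb hf]; split; [exact: tbnd_wk hb|exact: (gdef_wk1 hf)]. Qed.

Lemma ndef_var n : ndef (fun r1 _ => r1 n).
Proof.
split; first by exists (TVar n).
have h1 : gdef (fun r1 _ => r1 0 <= r1 n.+1) by exists (GLe (TVar 0) (TVar n.+1)).
have h2 : gdef (fun r1 _ => r1 n.+1 <= r1 0) by exists (GLe (TVar n.+1) (TVar 0)).
by apply: gdef_ext (gdef_and h1 h2) => r1 r2; split; lia.
Qed.

Lemma gdef_le f g : ndef f -> ndef g -> gdef (fun r1 r2 => f r1 r2 <= g r1 r2).
Proof.
move=> hf hg.
have h1 : gdef (fun r1 r2 => r1 1 <= r1 0) by exists (GLe (TVar 1) (TVar 0)).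
exact: (gdef_subst1 (gdef_subst1 h1 (ndef_wk hg)) hf).
Qed.

Lemma gdef_eq f g : ndef f -> ndef g -> gdef (fun r1 r2 => f r1 r2 = g r1 r2).
Proof.
move=> hf hg; apply: gdef_ext (gdef_and (gdef_le hf hg) (gdef_le hg hf)) => r1 r2; split; lia.
Qed.

Lemma gdef_lt f g : ndef f -> ndef g -> gdef (fun r1 r2 => f r1 r2 < g r1 r2).
Proof.
by move=> hf hg; apply: gdef_ext (gdef_not (gdef_le hg hf)) => r1 r2; split; lia.
Qed.

Lemma gdef_mem F f : sdef F -> ndef f -> gdef (fun r1 r2 => smem (F r1 r2) (f r1 r2)).
Proof. by move=> [_ hF] hf; apply: (gdef_subst1 hF hf). Qed.

Lemma gdef_ex f R : ndef f -> gdef R ->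
  gdef (fun r1 r2 => exists x, x <= f r1 r2 /\ R (scons x r1) r2).
Proof.
move=> hf hR; have [[b hb] _] := hf.
apply: gdef_ext (gdef_ex0 b (gdef_and (gdef_le (ndef_var 0) (ndef_wk hf)) hR)) => r1 r2 /=.
split=> [[x [hx h]]|[x [_ [hx h]]]]; exists x; split => //.
exact: leq_trans hx (hb _ _).
Qed.

Lemma gdef_all f R : ndef f -> gdef R ->
  gdef (fun r1 r2 => forall x, x <= f r1 r2 -> R (scons x r1) r2).
Proof.
move=> hf hR; apply: gdef_ext (gdef_not (gdef_ex hf (gdef_not hR))) => r1 r2 /=; split.
  by move=> h [x [hx]]; apply; apply: h.
by move=> h x hx; apply: contrapT => n; apply: h; exists x.
Qed.

Lemma tnumeral r1 r2 c : teval r1 r2 (numeral c) = c.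
Proof. by elim: c => //= c ->; rewrite addn1. Qed.

Lemma ndef_term0 t : ndef (fun r1 r2 => teval r1 r2 t).
Proof.
split; first by exists t.
pose t' := tsubst (fun n => TVar n.+1) id t.
have h1 : gdef (fun r1 r2 => r1 0 <= teval r1 r2 t') by exists (GLe (TVar 0) t').
have h2 : gdef (fun r1 r2 => teval r1 r2 t' <= r1 0) by exists (GLe t' (TVar 0)).
apply: gdef_ext (gdef_and h1 h2) => r1 r2.
have -> : teval r1 r2 t' = teval (fun n => r1 n.+1) r2 t by rewrite /t' teval_subst.
by split; lia.
Qed.

Lemma ndef_const c : ndef (fun _ _ => c).
Proof. by apply: ndef_ext (ndef_term0 (numeral c)) => r1 r2; rewrite tnumeral. Qed.

Lemma ndef_comp2 (t : term) (op : nat -> nat -> nat) f g :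
  (forall r1 r2, teval r1 r2 t = op (r1 1) (r1 0)) ->
  tbnd (fun r1 r2 => op (f r1 r2) (g r1 r2)) ->
  ndef f -> ndef g -> ndef (fun r1 r2 => op (f r1 r2) (g r1 r2)).
Proof.
move=> ht hb hf hg; split => //.
have h0 : gdef (fun r1 r2 => r1 2 = op (r1 1) (r1 0)).
  by apply: gdef_ext (gdef_eq (ndef_var 2) (ndef_term0 t)) => r1 r2; rewrite ht.
exact: (gdef_subst1 (gdef_subst1 h0 (ndef_wk (ndef_wk hg))) (ndef_wk hf)).
Qed.

Lemma tbnd_add f g : tbnd f -> tbnd g -> tbnd (fun r1 r2 => f r1 r2 + g r1 r2).
Proof. by move=> [a ha] [b hb]; exists (TPlus a b) => r1 r2 /=; apply: leq_add. Qed.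

Lemma tbnd_mul f g : tbnd f -> tbnd g -> tbnd (fun r1 r2 => f r1 r2 * g r1 r2).
Proof. by move=> [a ha] [b hb]; exists (TTimes a b) => r1 r2 /=; apply: leq_mul. Qed.

Lemma tbnd_le f g : (forall r1 r2, f r1 r2 <= g r1 r2) -> tbnd g -> tbnd f.
Proof. by move=> h [b hb]; exists b => r1 r2; apply: leq_trans (h _ _) (hb _ _). Qed.

Lemma tbnd_const c : tbnd (fun _ _ => c).
Proof. by exists (numeral c) => r1 r2; rewrite tnumeral. Qed.

Lemma tbnd_exp f c : tbnd f -> tbnd (fun r1 r2 => f r1 r2 ^ c).
Proof.
move=> hf; elim: c => [|c IH]; first exact: tbnd_const.
by apply: tbnd_le (tbnd_mul hf IH) => r1 r2; rewrite expnS.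
Qed.

Lemma ndef_add f g : ndef f -> ndef g -> ndef (fun r1 r2 => f r1 r2 + g r1 r2).
Proof.
move=> hf hg; apply: (@ndef_comp2 (TPlus (TVar 1) (TVar 0))) => //.
by apply: tbnd_add; [case: hf|case: hg].
Qed.

Lemma ndef_mul f g : ndef f -> ndef g -> ndef (fun r1 r2 => f r1 r2 * g r1 r2).
Proof.
move=> hf hg; apply: (@ndef_comp2 (TTimes (TVar 1) (TVar 0))) => //.
by apply: tbnd_mul; [case: hf|case: hg].
Qed.

Lemma ndef_len F : sdef F -> ndef (fun r1 r2 => slen (F r1 r2)).
Proof.
move=> hF; split; first by case: hF.
have [[b hb] _] := sdef_wk hF.
have hb' := ndef_term0 b.
have h1 := gdef_all hb' (gdef_imp (gdef_mem (sdef_wk (sdef_wk hF)) (ndef_var 0)) (gdef_lt (ndef_var 0) (ndef_var 1))).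
have h2 := gdef_ex hb' (gdef_and (gdef_eq (ndef_add (ndef_var 0) (ndef_const 1)) (ndef_var 1)) (gdef_mem (sdef_wk (sdef_wk hF)) (ndef_var 0))).
apply: gdef_ext (gdef_and h1 (gdef_or (gdef_eq (ndef_var 0) (ndef_const 0)) h2)) => r1 r2 /=.
set X := F _ _; have hX : slen X <= teval r1 r2 b by apply: hb.
have -> : (r1 0 = slen X) <-> slen X = r1 0 by split=> ->.
rewrite slen_eq; split=> [[a c]|[a c]]; split.
- by move=> z _; apply: a.
- case: c => [|[z [c d]]]; [by left|right]; exists z; rewrite addn1; split => //.
  by apply: leq_trans hX; apply: ltnW; apply: smem_lt.
- by move=> z hz; apply: a => //; apply: leq_trans hX; apply: ltnW; apply: smem_lt.
- by case: c => [|[z [_]]]; [left|rewrite addn1 => ?; right; exists z].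
Qed.

Lemma gdef_cnt R f g : gdef R -> ndef f -> ndef g ->
  gdef (fun r1 r2 => count (fun x => `[< R (scons x r1) r2 >]) (iota 0 (f r1 r2)) %% m = g r1 r2).
Proof.
move=> [p hp] hf hg.
(* The bound and the value in [GCnt] must be terms, so they are first variables 1 and 0, past which
   the outer variables of p are moved; f and g are substituted for them at the end. *)
pose p' := gren (fun n => if n is k.+1 then k.+3 else 0) id p.
have h0 : gdef (fun r1 r2 =>
    count (fun x => `[< R (scons x (fun n => r1 n.+2)) r2 >]) (iota 0 (r1 1)) %% m = r1 0).
  exists (GCnt (TVar 1) (TVar 0) p') => r1 r2 /=.
  have -> : count (fun x => gsat m (scons x r1) r2 p') (iota 0 (r1 1))
      = count (fun x => `[< R (scons x (fun n => r1 n.+2)) r2 >]) (iota 0 (r1 1)).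
    apply: eq_count => x; rewrite gsat_ren.
    rewrite (_ : (fun n => scons x r1 _) = scons x (fun n => r1 n.+2)); last by apply: funext => -[].
    by apply/idP/asboolP => /hp.
  by split=> [->|/eqP].
exact: (gdef_subst1 (gdef_subst1 h0 (ndef_wk hg)) hf).
Qed.

Lemma sdef_strof f R : ndef f -> gdef R ->
  sdef (fun r1 r2 => strof (f r1 r2) (fun z => `[< R (scons z r1) r2 >])).
Proof.
move=> hf hR; split.
  by case: hf => hb _; apply: tbnd_le hb => r1 r2; apply: slen_strof.
apply: gdef_ext (gdef_and (gdef_lt (ndef_var 0) (ndef_wk hf)) hR) => r1 r2.
rewrite smem_strof scons_eta; split=> [/andP [? /asboolP]|[? ?]] //.
by apply/andP; split => //; apply/asboolP.
Qed.

Lemma sdef_var n : sdef (fun _ r2 => r2 n).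
Proof. by split; [exists (TLen n)|exists (GIn (TVar 0) n)]. Qed.

Lemma sdef_empty : sdef (fun _ _ => sempty).
Proof.
split; first by exists TZero.
by apply: gdef_ext gdef_bot => r1 r2; rewrite smem_sempty.
Qed.

Lemma ndef_term t th1 th2 : (forall n, ndef (th1 n)) -> (forall n, sdef (th2 n)) ->
  ndef (fun r1 r2 => teval (fun n => th1 n r1 r2) (fun n => th2 n r1 r2) t).
Proof.
move=> h1 h2; elim: t => [n|||t IHt u IHu|t IHt u IHu|X] /=.
- exact: h1.
- exact: ndef_const.
- exact: ndef_const.
- exact: ndef_add.
- exact: ndef_mul.
- exact: ndef_len.
Qed.

(** Strings, unlike numbers, cannot be quantified away, so this goes by induction on the counting
    formula: an atom X(t) is replaced by the bit graph of the function substituted for X. *)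
Lemma gdef_comp R th1 th2 : gdef R -> (forall n, ndef (th1 n)) -> (forall n, sdef (th2 n)) ->
  gdef (fun r1 r2 => R (fun n => th1 n r1 r2) (fun n => th2 n r1 r2)).
Proof.
have up (th : nat -> E1 -> E2 -> nat) : (forall n, ndef (th n)) -> forall n,
    ndef (if n is k.+1 then fun r1 r2 => th k (fun i => r1 i.+1) r2 else fun r1 _ => r1 0).
  by move=> h [|n]; [apply: ndef_var|apply: ndef_wk].
have upE (th : nat -> E1 -> E2 -> nat) r1 r2 x :
    (fun n => (if n is k.+1 then fun r1 r2 => th k (fun i => r1 i.+1) r2 else fun r1 _ => r1 0)
       (scons x r1) r2) = scons x (fun n => th n r1 r2).
  by apply: funext => -[].
have wk (th : nat -> E1 -> E2 -> str) : (forall n, sdef (th n)) -> forall n,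
    sdef (fun r1 r2 => th n (fun i => r1 i.+1) r2).
  by move=> h n; apply: sdef_wk.
move=> [p hp]; set Q := fun p th1 th2 => gdef (fun r1 r2 => gsat m (fun n => th1 n r1 r2) (fun n => th2 n r1 r2) p).
suff {R hp} H : forall th1 th2, (forall n, ndef (th1 n)) -> (forall n, sdef (th2 n)) -> Q p th1 th2.
  move=> h1 h2; apply: gdef_ext (H _ _ h1 h2) => r1 r2; exact: hp.
elim: p {th1 th2} => [|t u|t X|p IHp q IHq|t p IH|t v p IH] th1 th2 h1 h2; rewrite /Q /=.
- by apply: gdef_ext gdef_bot.
- by apply: gdef_le; apply: ndef_term.
- by apply: gdef_mem => //; apply: ndef_term.
- apply: gdef_ext (gdef_imp (IHp _ _ h1 h2) (IHq _ _ h1 h2)) => r1 r2.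
  by split=> /implyP.
- apply: gdef_ext (gdef_all (ndef_term t h1 h2) (IH _ _ (up _ h1) (wk _ h2))) => r1 r2 /=.
  split.
    by move=> /ballnP h x hx; rewrite upE; apply: h.
  by move=> h; apply/ballnP => x hx; rewrite -upE; apply: h.
- apply: gdef_ext (gdef_cnt (IH _ _ (up _ h1) (wk _ h2)) (ndef_term t h1 h2) (ndef_term v h1 h2)) => r1 r2 /=.
  rewrite -(rwP eqP); set c := count _ _; set d := count _ _; suff -> : c = d by [].
  by apply: eq_count => x; rewrite upE asboolb.
Qed.

End Gdef.

(** * The relations in AC0(m) are those definable with modular counting *)

Scheme xnt_mut := Induction for xnt Sort Prop
with xst_mut := Induction for xst Sort Prop
with xnts_mut := Induction for xnts Sort Prop
with xsts_mut := Induction for xsts Sort Prop.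
Combined Scheme xterm_mut from xnt_mut, xst_mut, xnts_mut, xsts_mut.

Lemma size_fit (A : Type) n (d : A) s : size (fit n d s) = n.
Proof. by rewrite /fit size_cat size_take size_nseq; case: ltnP; lia. Qed.

Lemma nth_fit (A : Type) n (d : A) s i : nth d (fit n d s) i = if i < n then nth d s i else d.
Proof.
rewrite /fit nth_cat size_take nth_nseq if_same; case: (ltnP n (size s)) => hs.
  by case: (ltnP i n) => hi //; rewrite nth_take.
case: (ltnP i (size s)) => h; first by rewrite nth_take ?(leq_trans h).
by rewrite nth_default // if_same.
Qed.

Lemma fit_id (A : Type) n (d : A) s : size s = n -> fit n d s = s.
Proof. by move=> <-; rewrite /fit take_size subnn cats0. Qed.

Section XG.
Variable m : nat.

Definition gbit (k l : nat) (F : seq nat -> seq str -> str) : Prop :=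
  exists q, forall z xs Xs, size xs = k -> size Xs = l ->
    (smem (F xs Xs) z <-> gsat m (num_env (z :: xs)) (str_env Xs) q).

Lemma tbnd_sumn (f : (nat -> nat) -> (nat -> str) -> seq nat) k :
  (forall i, tbnd (fun r1 r2 => nth 0 (f r1 r2) i)) -> (forall r1 r2, size (f r1 r2) = k) ->
  tbnd (fun r1 r2 => sumn (f r1 r2)).
Proof.
move=> h hk.
have H j : tbnd (fun r1 r2 => sumn (mkseq (nth 0 (f r1 r2)) j)).
  elim: j => [|j IH]; first exact: tbnd_const 0.
  by apply: tbnd_le (tbnd_add IH (h j)) => r1 r2; rewrite mkseqS sumn_rcons.
apply: tbnd_le (H k) => r1 r2; rewrite -(hk r1 r2).
by rewrite (_ : mkseq _ _ = f r1 r2) //; apply: mkseq_nth.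
Qed.

(** A fixed power of the total size of term-bounded arguments is again bounded by a term, since
    terms are closed under sum and product. *)
Lemma tbnd_call k l (f : seq nat -> seq str -> nat) ns ss :
  (exists c, forall xs Xs, size xs = k -> size Xs = l -> f xs Xs <= argsize xs Xs ^ c) ->
  (forall r1 r2, size (ns r1 r2) = k) -> (forall r1 r2, size (ss r1 r2) = l) ->
  (forall n, ndef m (fun r1 r2 => nth 0 (ns r1 r2) n)) ->
  (forall n, sdef m (fun r1 r2 => nth sempty (ss r1 r2) n)) ->
  tbnd (fun r1 r2 => f (ns r1 r2) (ss r1 r2)).
Proof.
move=> [c hc] sn ss' hn hs.
have h1 : tbnd (fun r1 r2 => sumn (ns r1 r2)).
  by apply: tbnd_sumn sn => i; case: (hn i).
have h2 : tbnd (fun r1 r2 => sumn (map slen (ss r1 r2))).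
  apply: (@tbnd_sumn _ l) => [i|r1 r2]; last by rewrite size_map.
  have [h _] := hs i; apply: tbnd_le h => r1 r2.
  case: (ltnP i l) => hi; last by rewrite nth_default // size_map ss'.
  by rewrite (nth_map sempty) // ss'.
apply: tbnd_le (tbnd_exp c (tbnd_add (tbnd_add h1 h2) (tbnd_const 2))) => r1 r2.
exact: hc.
Qed.

Lemma num_env_cons z xs : num_env (z :: xs) = scons z (num_env xs).
Proof. by apply: funext => -[]. Qed.

Lemma sdef_call k l F ns ss : pbounded_str k l F -> gbit k l F ->
  (forall r1 r2, size (ns r1 r2) = k) -> (forall r1 r2, size (ss r1 r2) = l) ->
  (forall n, ndef m (fun r1 r2 => nth 0 (ns r1 r2) n)) ->
  (forall n, sdef m (fun r1 r2 => nth sempty (ss r1 r2) n)) ->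
  sdef m (fun r1 r2 => F (ns r1 r2) (ss r1 r2)).
Proof.
move=> pF [q hq] sn ss' hn hs; split; first exact: (tbnd_call pF sn ss' hn hs).
have hQ : gdef m (fun r1 r2 => gsat m r1 r2 q) by exists q.
pose th1 n : (nat -> nat) -> (nat -> str) -> nat := if n is k.+1 then fun r1 r2 => nth 0 (ns (fun i => r1 i.+1) r2) k else fun r1 _ => r1 0.
have h1 n : ndef m (th1 n).
  by case: n => [|n]; [exact: ndef_var|exact: (ndef_wk (hn n))].
have h2 n := sdef_wk (hs n).
apply: gdef_ext (gdef_comp hQ h1 h2) => r1 r2.
rewrite hq //; suff -> : (fun n => th1 n r1 r2) = num_env (r1 0 :: ns (fun i => r1 i.+1) r2) by [].
by apply: funext => -[].
Qed.

Lemma ndef_call k l f ns ss : pbounded_num k l f ->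
  (exists q, forall y xs Xs, size xs = k -> size Xs = l ->
    (y = f xs Xs <-> gsat m (num_env (y :: xs)) (str_env Xs) q)) ->
  (forall r1 r2, size (ns r1 r2) = k) -> (forall r1 r2, size (ss r1 r2) = l) ->
  (forall n, ndef m (fun r1 r2 => nth 0 (ns r1 r2) n)) ->
  (forall n, sdef m (fun r1 r2 => nth sempty (ss r1 r2) n)) ->
  ndef m (fun r1 r2 => f (ns r1 r2) (ss r1 r2)).
Proof.
move=> pF [q hq] sn ss' hn hs; split; first exact: (tbnd_call pF sn ss' hn hs).
have hQ : gdef m (fun r1 r2 => gsat m r1 r2 q) by exists q.
pose th1 n : (nat -> nat) -> (nat -> str) -> nat := if n is k.+1 then fun r1 r2 => nth 0 (ns (fun i => r1 i.+1) r2) k else fun r1 _ => r1 0.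
have h1 n : ndef m (th1 n).
  by case: n => [|n]; [exact: ndef_var|exact: (ndef_wk (hn n))].
have h2 n := sdef_wk (hs n).
apply: gdef_ext (gdef_comp hQ h1 h2) => r1 r2.
rewrite hq //; suff -> : (fun n => th1 n r1 r2) = num_env (r1 0 :: ns (fun i => r1 i.+1) r2) by [].
by apply: funext => -[].
Qed.

Definition gchain (fs : fchain) : Prop :=
  forall i, i < size fs ->
    let: (k, l, F) := nth fdefault fs i in pbounded_str k l F /\ gbit k l F.

Lemma ndef_mod f F : ndef m f -> sdef m F -> ndef m (fun r1 r2 => modm m (f r1 r2) (F r1 r2)).
Proof.
move=> hf hF; split.
  case: hf => hb _; apply: tbnd_le hb => r1 r2; apply: leq_trans (leq_mod _ _) _.
  by apply: leq_trans (count_size _ _) _; rewrite size_iota.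
have hR := gdef_mem (sdef_wk (sdef_wk hF)) (ndef_var m 0).
apply: gdef_ext (gdef_cnt hR (ndef_wk hf) (ndef_var m 0)) => r1 r2 /=; rewrite /modm.
set c := count _ _; set d := count _ _; suff -> : c = d by split=> ->.
by apply: eq_count => x /=; rewrite asboolb.
Qed.

Lemma xterm_def fs : gchain fs ->
  (forall t, ndef m (fun r1 r2 => xneval m fs r1 r2 t)) /\
  (forall s, sdef m (fun r1 r2 => xseval m fs r1 r2 s)) /\
  (forall ts n, ndef m (fun r1 r2 => nth 0 (xnseval m fs r1 r2 ts) n)) /\
  (forall ss n, sdef m (fun r1 r2 => nth sempty (xsseval m fs r1 r2 ss) n)).
Proof.
move=> hfs; apply: xterm_mut => /=.
- by move=> n; apply: ndef_var.
- exact: ndef_const.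
- exact: ndef_const.
- by move=> t ht u hu; apply: ndef_add.
- by move=> t ht u hu; apply: ndef_mul.
- by move=> s hs; apply: ndef_len.
- by move=> t ht s hs; apply: ndef_mod.
- by move=> n; apply: sdef_var.
- move=> i ts hts ss hss.
  (* A symbol beyond the end of the chain denotes the default function, which is constantly
     empty. *)
  case: (ltnP i (size fs)) => hi; last first.
    by rewrite (nth_default _ hi) /=; apply: sdef_empty.
  have := hfs i hi; case: (nth fdefault fs i) => [[k l] F] [pF gF].
  apply: (sdef_call (ns := fun r1 r2 => fit k 0 (xnseval m fs r1 r2 ts))
    (ss := fun r1 r2 => fit l sempty (xsseval m fs r1 r2 ss)) pF gF) => [r1 r2|r1 r2|n|n].
  + exact: size_fit.
  + exact: size_fit.
  + apply: (@ndef_ext _ (if n < k then fun r1 r2 => nth 0 (xnseval m fs r1 r2 ts) n else fun _ _ => 0)).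
      by move=> r1 r2; rewrite nth_fit; case: ifP.
    by case: ifP => _; [apply: hts|apply: ndef_const].
  + apply: (@sdef_ext _ (if n < l then fun r1 r2 => nth sempty (xsseval m fs r1 r2 ss) n else fun _ _ => sempty)).
      by move=> r1 r2; rewrite nth_fit; case: ifP.
    by case: ifP => _; [apply: hss|apply: sdef_empty].
- by move=> n; apply: ndef_ext (ndef_const m 0) => r1 r2; rewrite nth_nil.
- by move=> t ht ts hts [|n]; [exact: ht|exact: hts].
- by move=> n; apply: sdef_ext (sdef_empty m) => r1 r2; rewrite nth_nil.
- by move=> t ht ts hts [|n]; [exact: ht|exact: hts].
Qed.

Lemma xform_def fs p : gchain fs -> gdef m (fun r1 r2 => xsat m fs r1 r2 p).
Proof.
move=> hfs; have [ht [hs _]] := xterm_def hfs.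
elim: p => /=.
- exact: gdef_bot.
- by move=> t u; apply: gdef_le.
- by move=> t u; apply: gdef_eq.
- by move=> t s; apply: gdef_mem.
- move=> s s'.
  have hl := ndef_add (ndef_len (hs s)) (ndef_len (hs s')).
  have h := gdef_all hl (gdef_iff (gdef_mem (sdef_wk (hs s)) (ndef_var m 0))
                                  (gdef_mem (sdef_wk (hs s')) (ndef_var m 0))).
  apply: gdef_ext h => r1 r2 /=; split=> [->|h] //; apply: str_ext => z.
  apply/idP/idP => hz; apply/h => //; have := smem_lt hz; lia.
- by move=> p hp q hq; apply: gdef_imp.
- by move=> p hp q hq; apply: gdef_and.
- by move=> p hp q hq; apply: gdef_or.
- by move=> t p hp; apply: gdef_all (ht t) hp.
- by move=> t p hp; apply: gdef_ex (ht t) hp.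
Qed.

(** Strong induction on the prefix: a bit graph is a formula over the earlier functions, which are
    already known to be definable with counting. *)
Lemma valid_gchain fs n : valid_chain m fs -> gchain (take n fs).
Proof.
move=> hfs; elim/ltn_ind: n => n IH i; rewrite size_take_min leq_min => /andP [hin hi].
rewrite nth_take //; have := hfs i hi; case: (nth fdefault fs i) => [[k l] F] [pF [p hp]].
split => //; have [q hq] := xform_def p (IH i hin).
exists q => z xs Xs hx hX; rewrite -hq -hp //=; by rewrite hx.
Qed.

Fixpoint tx (t : term) : xnt :=
  match t with
  | TVar n => XV n | TZero => XZero | TOne => XOne
  | TPlus a b => XAdd (tx a) (tx b) | TTimes a b => XMul (tx a) (tx b)
  | TLen X => XLen (XSV X)
  end.

Lemma tx_eval fs r1 r2 t : xneval m fs r1 r2 (tx t) = teval r1 r2 t.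
Proof. by elim: t => //= t -> u ->. Qed.

Lemma teval_argsize t : exists c, forall xs Xs,
  teval (num_env xs) (str_env Xs) t <= argsize xs Xs ^ c.
Proof.
have a2 xs Xs : 2 <= argsize xs Xs by rewrite /argsize; lia.
elim: t => [n|||t [c hc] u [d hd]|t [c hc] u [d hd]|X] /=.
- exists 1 => xs Xs; rewrite expn1 /argsize /num_env.
  have : nth 0 xs n <= sumn xs.
    by elim: xs n => [|x xs IH] [|n] //=; [lia|have := IH n; lia].
  by move/leq_trans; apply; rewrite -addnA leq_addr.
- by exists 0.
- by exists 0.
(* For A at least 2, A^c + A^d is at most 2 A^c A^d, hence at most A^(c+d+1); the summand 2 in
   [argsize] provides this. *)
- exists (c + d).+1 => xs Xs; rewrite expnS expnD.
  move: (hc xs Xs) (hd xs Xs) (a2 xs Xs).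
  set A := argsize xs Xs => h1 h2 h3.
  have : 0 < A ^ c by rewrite expn_gt0; lia.
  have : 0 < A ^ d by rewrite expn_gt0; lia.
  move: (A ^ c) (A ^ d) h1 h2 => P Q h1 h2 hQ hP.
  apply: leq_trans (leq_add h1 h2) (leq_trans _ (leq_mul h3 (leqnn (P * Q)))); nia.
- by exists (c + d) => xs Xs; rewrite expnD; apply: leq_mul.
- exists 1 => xs Xs; rewrite expn1 /argsize /str_env.
  have : slen (nth sempty Xs X) <= sumn (map slen Xs).
    by elim: Xs X => [|x Xs IH] [|n] //=; [lia|have := IH n; lia].
  by move/leq_trans; apply; rewrite addnAC leq_addl.
Qed.

Fixpoint xvars (ns : seq nat) : xnts :=
  if ns is n :: ns' then NCons (XV n) (xvars ns') else NNil.
Fixpoint xsvars (ns : seq nat) : xsts :=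
  if ns is n :: ns' then SCons (XSV n) (xsvars ns') else SNil.

Lemma xvars_eval fs r1 r2 ns : xnseval m fs r1 r2 (xvars ns) = map r1 ns.
Proof. by elim: ns => //= n ns ->. Qed.
Lemma xsvars_eval fs r1 r2 ns : xsseval m fs r1 r2 (xsvars ns) = map r2 ns.
Proof. by elim: ns => //= n ns ->. Qed.

Lemma num_env_mkseq r1 K : (forall n, K <= n -> r1 n = 0) -> num_env (mkseq r1 K) = r1.
Proof.
move=> h; apply: funext => n; rewrite /num_env; case: (ltnP n K) => hn; first by rewrite nth_mkseq.
by rewrite nth_default ?size_mkseq // h.
Qed.
Lemma str_env_mkseq r2 K : (forall n, K <= n -> r2 n = sempty) -> str_env (mkseq r2 K) = r2.
Proof.
move=> h; apply: funext => n; rewrite /str_env; case: (ltnP n K) => hn; first by rewrite nth_mkseq.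
by rewrite nth_default ?size_mkseq // h.
Qed.

Lemma valid_rcons fs k l F : valid_chain m fs -> pbounded_str k l F ->
  (exists p, xrepr m fs k.+1 l (bitgraph F) p) -> valid_chain m (fs ++ [:: (k, l, F)]).
Proof.
move=> hfs pF [p hp] i; rewrite size_cat /= addn1 ltnS leq_eqVlt => /orP [/eqP ->|hi].
  by rewrite nth_cat ltnn subnn /= take_size_cat //; split => //; exists p.
by rewrite nth_cat hi take_cat hi; apply: hfs.
Qed.

Lemma num_env_behead ys k : size ys = k.+1 -> num_env ys = scons (head 0 ys) (num_env (behead ys)).
Proof. by case: ys => // y ys _; rewrite num_env_cons. Qed.

(* The counted formula of a GCnt becomes the bit graph of a new function of the
   chain; the conclusion is stable under appending ext' so that chains can be
   threaded through both sides of an implication. *)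
Lemma gform_xform p K L fs0 : valid_chain m fs0 -> exists ext q,
  valid_chain m (fs0 ++ ext) /\ forall ext' r1 r2,
    (forall n, K <= n -> r1 n = 0) -> (forall n, L <= n -> r2 n = sempty) ->
    (xsat m ((fs0 ++ ext) ++ ext') r1 r2 q <-> gsat m r1 r2 p).
Proof.
have sc K' (x : nat) r1 : (forall n, K' <= n -> r1 n = 0) -> forall n, K' < n -> scons x r1 n = 0.
  by move=> h [|n] //= /h.
elim: p K L fs0 => [|t u|t X|p IHp q IHq|t p IH|t v p IH] K L fs0 h0.
- by exists [::], XBot; rewrite cats0.
- by exists [::], (XLe (tx t) (tx u)); rewrite cats0; split=> // ext' r1 r2 _ _ /=; rewrite !tx_eval.
- by exists [::], (XIn (tx t) (XSV X)); rewrite cats0; split=> // ext' r1 r2 _ _ /=; rewrite !tx_eval.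
- have [e1 [p' [v1 h1]]] := IHp K L _ h0.
  have [e2 [q' [v2 h2]]] := IHq K L _ v1.
  exists (e1 ++ e2), (XImp p' q'); split; first by rewrite catA.
  move=> ext' r1 r2 hr1 hr2 /=; rewrite !catA h2 // -[_ ++ ext']catA h1 //.
  by split=> /implyP.
- have [e1 [p' [v1 h1]]] := IH K.+1 L _ h0.
  exists e1, (XAllB (tx t) p'); split => // ext' r1 r2 hr1 hr2 /=; rewrite tx_eval.
  split=> h; first by apply/ballnP => x /h /h1; apply => //; apply: sc.
  by move=> x hx; apply/h1 => //; [apply: sc|move/ballnP: h; apply].
- have [e1 [p' [v1 h1]]] := IH K.+1 L _ h0.
  pose F xs Xs := strof (teval (num_env xs) (str_env Xs) t)
                        (fun u => gsat m (scons u (num_env xs)) (str_env Xs) p).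
  have ve xs : forall n, size xs <= n -> num_env xs n = 0.
    by move=> n hn; rewrite /num_env nth_default.
  have vs Xs : forall n, size Xs <= n -> str_env Xs n = sempty.
    by move=> n hn; rewrite /str_env nth_default.
  exists (e1 ++ [:: (K, L, F)]).
  exists (XEq1 (XMod (tx t) (XF (size (fs0 ++ e1)) (xvars (iota 0 K)) (xsvars (iota 0 L)))) (tx v)).
  split.
    rewrite catA; apply: valid_rcons => //.
      have [c hc] := teval_argsize t; exists c => xs Xs _ _.
      by apply: leq_trans (slen_strof _ _) (hc _ _).
    exists (XAnd (XLe (XAdd (XV 0) XOne) (tx (shift1t t))) p') => ys Xs sy sX /=.
    have := h1 [::] (num_env ys) (str_env Xs); rewrite cats0 => -> //; last 2 first.
      by move=> n hn; apply: ve; rewrite sy.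
      by move=> n hn; apply: vs; rewrite sX.
    rewrite /bitgraph smem_strof (num_env_behead sy) tx_eval /= /shift1t teval_subst /= addn1.
    by split=> [/andP []|[-> ->]].
  move=> ext' r1 r2 hr1 hr2 /=; rewrite !tx_eval -catA -catA catA.
  rewrite nth_cat ltnn subnn /= xvars_eval xsvars_eval !fit_id ?size_map ?size_iota //.
  rewrite /F -/(mkseq r1 K) -/(mkseq r2 L) num_env_mkseq // str_env_mkseq //.
  rewrite -(rwP eqP) /modm; set c := count _ _; set d := count _ _; suff -> : c = d by [].
  by apply: eq_in_count => x; rewrite mem_iota add0n smem_strof => /andP [_ ->].
Qed.

Lemma AC0m_gdef k l R : AC0m m k l R <->
  exists p, forall xs Xs, size xs = k -> size Xs = l -> (R xs Xs <-> gsat m (num_env xs) (str_env Xs) p).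
Proof.
split=> [[fs [p [hfs hp]]]|[p hp]].
  have := valid_gchain (n := size fs) hfs; rewrite take_size => /(xform_def p) [q hq].
  by exists q => xs Xs hx hX; rewrite -hq hp.
have v0 : valid_chain m [::] by [].
have [fs [q [hfs hq]]] := gform_xform p k l v0.
exists fs, q; split => // xs Xs hx hX; rewrite hp //.
have := hq [::] (num_env xs) (str_env Xs); rewrite !cats0 => -> // n hn.
  by rewrite /num_env nth_default ?hx.
by rewrite /str_env nth_default ?hX.
Qed.

Lemma mkseq_env xs k : size xs = k -> mkseq (num_env xs) k = xs.
Proof. by move=> <-; apply: mkseq_nth. Qed.
Lemma mkseq_senv Xs k : size Xs = k -> mkseq (str_env Xs) k = Xs.
Proof. by move=> <-; apply: mkseq_nth. Qed.

Lemma ndef_mkseq k n : ndef m (fun r1 _ => nth 0 (mkseq r1 k) n).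
Proof.
apply: (@ndef_ext _ (if n < k then fun r1 _ => r1 n else fun _ _ => 0)).
  move=> r1 r2; case: ifP => h; first by rewrite nth_mkseq.
  by rewrite nth_default // size_mkseq leqNgt h.
by case: ifP => _; [apply: ndef_var|apply: ndef_const].
Qed.
Lemma sdef_mkseq k n : sdef m (fun _ r2 => nth sempty (mkseq r2 k) n).
Proof.
apply: (@sdef_ext _ (if n < k then fun _ r2 => r2 n else fun _ _ => sempty)).
  move=> r1 r2; case: ifP => h; first by rewrite nth_mkseq.
  by rewrite nth_default // size_mkseq leqNgt h.
by case: ifP => _; [apply: sdef_var|apply: sdef_empty].
Qed.

(** The bridge between functions of lists of fixed length and functions of environments. From left
    to right F is applied to the first k numbers and l strings of the environment. *)
Lemma FAC0_strP k l F : FAC0_str m k l F <-> exists F', sdef m F' /\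
  forall xs Xs, size xs = k -> size Xs = l -> F xs Xs = F' (num_env xs) (str_env Xs).
Proof.
split=> [[pF /AC0m_gdef [q hq]]|[F' [[[b hb] [q hq]] hF]]].
  exists (fun r1 r2 => F (mkseq r1 k) (mkseq r2 l)); split; last first.
    by move=> xs Xs hx hX; rewrite mkseq_env // mkseq_senv.
  apply: (sdef_call (ns := fun r1 _ => mkseq r1 k) (ss := fun _ r2 => mkseq r2 l) pF) => [|r1 r2|r1 r2|n|n]; try by rewrite ?size_mkseq.
  - by exists q => z xs Xs hx hX; rewrite -hq //=; rewrite hx.
  - exact: ndef_mkseq.
  - exact: sdef_mkseq.
have [c hc] := teval_argsize b; split.
  by exists c => xs Xs hx hX; rewrite hF //; apply: leq_trans (hb _ _) (hc _ _).
apply/AC0m_gdef; exists q => ys Xs hy hX; rewrite -hq /bitgraph hF //; last by rewrite size_behead hy.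
by rewrite (num_env_behead hy).
Qed.

Lemma FAC0_numP k l f : FAC0_num m k l f <-> exists f', ndef m f' /\
  forall xs Xs, size xs = k -> size Xs = l -> f xs Xs = f' (num_env xs) (str_env Xs).
Proof.
split=> [[pF /AC0m_gdef [q hq]]|[F' [[[b hb] [q hq]] hF]]].
  exists (fun r1 r2 => f (mkseq r1 k) (mkseq r2 l)); split; last first.
    by move=> xs Xs hx hX; rewrite mkseq_env // mkseq_senv.
  apply: (ndef_call (ns := fun r1 _ => mkseq r1 k) (ss := fun _ r2 => mkseq r2 l) pF) => [|r1 r2|r1 r2|n|n]; try by rewrite ?size_mkseq.
  - by exists q => z xs Xs hx hX; rewrite -hq //=; rewrite hx.
  - exact: ndef_mkseq.
  - exact: sdef_mkseq.
have [c hc] := teval_argsize b; split.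
  by exists c => xs Xs hx hX; rewrite hF //; apply: leq_trans (hb _ _) (hc _ _).
apply/AC0m_gdef; exists q => ys Xs hy hX; rewrite -hq /graph hF //; last by rewrite size_behead hy.
by rewrite (num_env_behead hy).
Qed.
End XG.

(** * Witnessing *)

Lemma ultrafilter_exists (T : Type) (P : (T -> Prop) -> Prop) :
  P (fun _ => True) -> (forall A B, P A -> P B -> P (fun e => A e /\ B e)) ->
  (forall A B : T -> Prop, (forall e, A e -> B e) -> P A -> P B) -> ~ P (fun _ => False) ->
  exists U : (T -> Prop) -> Prop, [/\ (forall A, P A -> U A),
    (forall A B : T -> Prop, (forall e, A e -> B e) -> U A -> U B),
    (forall A B, U A -> U B -> U (fun e => A e /\ B e)), ~ U (fun _ => False) &
    forall A, U A \/ U (fun e => ~ A e)].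
Proof.
move=> PT PI PS P0.
have FF : filter.ProperFilter P.
  by split => //; split => // A B; apply: PS.
have [U [UF sub]] := filter.ultraFilterLemma FF; exists U.
have UP := @filter.ultra_proper _ _ UF; have UP' := filter.filter_filter.
split=> //.
- by move=> A B; apply: filter.filterS.
- by move=> A B; apply: filter.filterI.
- exact: filter.filter_not_empty.
- by move=> A; apply: filter.in_ultra_setVsetC.
Qed.

(** * Case distinction and least witnesses *)

Section GdefMore.
Variable m : nat.

Lemma gdef_eqs F G : sdef m F -> sdef m G -> gdef m (fun r1 r2 => F r1 r2 = G r1 r2).
Proof.
move=> hs hs'.
have hl := ndef_add (ndef_len hs) (ndef_len hs').
have h := gdef_all hl (gdef_iff (gdef_mem (sdef_wk hs) (ndef_var m 0))
                                (gdef_mem (sdef_wk hs') (ndef_var m 0))).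
apply: gdef_ext h => r1 r2 /=; split=> [->|h] //; apply: str_ext => z.
by apply/idP/idP => hz; apply/h => //; have := smem_lt hz; lia.
Qed.

Lemma teval_shift1 x r1 r2 t : teval (scons x r1) r2 (shift1t t) = teval r1 r2 t.
Proof. by rewrite /shift1t teval_subst. Qed.

Lemma gdef_sat p : sigB0 p -> gdef m (fun r1 r2 => sat r1 r2 p).
Proof.
elim=> {p} /=.
- exact: gdef_bot.
- by move=> t u; apply: gdef_le; apply: ndef_term0.
- by move=> t u; apply: gdef_eq; apply: ndef_term0.
- by move=> t X; apply: gdef_mem; [apply: sdef_var|apply: ndef_term0].
- by move=> X Y; apply: gdef_eqs; apply: sdef_var.
- by move=> p q _ hp _ hq; apply: gdef_imp.
- by move=> p q _ hp _ hq; apply: gdef_and.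
- by move=> p q _ hp _ hq; apply: gdef_or.
- move=> t p _ hp; apply: gdef_ext (gdef_ex (ndef_term0 m t) hp) => r1 r2.
  by split=> -[x [h h']]; exists x; split => //; move: h; rewrite teval_shift1.
- move=> t p _ hp; apply: gdef_ext (gdef_ex (ndef_term0 m t)
    (gdef_and (gdef_lt (ndef_var m 0) (ndef_term0 m (shift1t t))) hp)) => r1 r2.
  split=> -[x h]; exists x; move: h; rewrite /= teval_shift1.
    by move=> [[h1 h2] h3]; do 2!split => //; lia.
  by move=> [_ [h1 h3]]; split => //; lia.
- move=> t p _ hp; apply: gdef_ext (gdef_all (ndef_term0 m t) hp) => r1 r2.
  by split=> h x; move: (h x); rewrite teval_shift1.
- move=> t p _ hp; apply: gdef_ext (gdef_all (ndef_term0 m t)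
    (gdef_imp (gdef_lt (ndef_var m 0) (ndef_term0 m (shift1t t))) hp)) => r1 r2.
  split=> h x; move: (h x); rewrite /= teval_shift1.
    by move=> {}h _ h2; apply: h; split; lia.
  by move=> {}h [h1 h2]; apply: h => //; lia.
Qed.

Lemma ndef_if A f g : gdef m A -> ndef m f -> ndef m g ->
  ndef m (fun r1 r2 => if `[< A r1 r2 >] then f r1 r2 else g r1 r2).
Proof.
move=> hA [bf hf] [bg hg]; split.
  by apply: tbnd_le (tbnd_add bf bg) => r1 r2; case: ifP => _; lia.
apply: gdef_ext (gdef_or (gdef_and (gdef_wk hA) hf) (gdef_and (gdef_not (gdef_wk hA)) hg)) => r1 r2.
by case: asboolP => h; tauto.
Qed.

Lemma sdef_if A F G : gdef m A -> sdef m F -> sdef m G ->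
  sdef m (fun r1 r2 => if `[< A r1 r2 >] then F r1 r2 else G r1 r2).
Proof.
move=> hA [bf hf] [bg hg]; split.
  by apply: tbnd_le (tbnd_add bf bg) => r1 r2; case: ifP => _; lia.
apply: gdef_ext (gdef_or (gdef_and (gdef_wk hA) hf) (gdef_and (gdef_not (gdef_wk hA)) hg)) => r1 r2.
by case: asboolP => h; tauto.
Qed.

Lemma skolem g R : ndef m g -> gdef m R -> exists f, ndef m f /\
  forall r1 r2, (exists x, x <= g r1 r2 /\ R (scons x r1) r2) ->
    f r1 r2 <= g r1 r2 /\ R (scons (f r1 r2) r1) r2.
Proof.
move=> hg hR.
(* The search stops before g and returns g itself on failure, which is correct when g is the only
   witness. *)
pose f r1 r2 := find (fun x => `[< R (scons x r1) r2 >]) (iota 0 (g r1 r2)).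
have fle r1 r2 : f r1 r2 <= g r1 r2.
  by apply: leq_trans (find_size _ _) _; rewrite size_iota.
have fR r1 r2 : f r1 r2 < g r1 r2 -> R (scons (f r1 r2) r1) r2.
  move=> h; have : has (fun x => `[< R (scons x r1) r2 >]) (iota 0 (g r1 r2)).
    by rewrite has_find size_iota.
  by move=> /(nth_find 0) /asboolP; rewrite nth_iota.
have fN r1 r2 x : x < f r1 r2 -> ~ R (scons x r1) r2.
  move=> h; have := before_find 0 h; rewrite nth_iota ?add0n; last exact: leq_trans h (fle _ _).
  by move/asboolP.
exists f; split; last first.
  move=> r1 r2 [x [hx hR']]; split => //.
  have : f r1 r2 <= x by rewrite leqNgt; apply/negP => /fN.
  rewrite leq_eqVlt => /orP [/eqP -> //|h]; apply: fR; exact: leq_trans h hx.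
split; first by case: hg => hb _; apply: tbnd_le hb.
have v0 := ndef_var m 0; have v1 := ndef_var m 1.
have hR1 : gdef m (fun r1 r2 => R (scons (r1 0) (fun n => r1 n.+2)) r2).
  apply: gdef_ext (gdef_ren (fun n => if n is k.+1 then k.+2 else 0) id hR) => r1 r2.
  by rewrite (_ : scons _ _ = (fun n => r1 (if n is k.+1 then k.+2 else 0))) //; apply: funext => -[].
apply: gdef_ext (gdef_and (gdef_le v0 (ndef_wk hg)) (gdef_and
   (gdef_all v0 (gdef_imp (gdef_lt v0 v1) (gdef_not hR1)))
   (gdef_or (gdef_eq v0 (ndef_wk hg)) hR))) => r1 r2 /=.
have -> : R r1 r2 = R (scons (r1 0) (fun n => r1 n.+1)) r2 by rewrite scons_eta.
move: (r1 0) (fun n => r1 n.+1) => y r.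
split=> [->|[h1 [h2 h3]]].
  split; first exact: fle.
  split; first by move=> x _ /fN.
  have := fle r r2; rewrite leq_eqVlt => /orP [/eqP h|/fR h]; [by left|by right].
have : f r r2 <= y.
  rewrite leqNgt; apply/negP => hlt; case: h3 => [E|]; last exact: fN.
  have := fle r r2; lia.
rewrite leq_eqVlt => /orP [/eqP -> //|h]; case: (h2 (f r r2) (ltnW h) h); apply: fR; lia.
Qed.
End GdefMore.

(** * Pairing and tables of residues *)

Definition pairn (z y : nat) : nat := (z + y) * (z + y + 1) + 2 * y.

Lemma pairn_inj z y z' y' : pairn z y = pairn z' y' -> z = z' /\ y = y'.
Proof.
(* Pairs of sum n have values between n(n+1) and n(n+1)+2n, which is below (n+1)(n+2), so the value
   determines the sum. *)
rewrite /pairn => E; suff S : z + y = z' + y' by nia.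
have aux a b c d : a + b < c + d -> (a + b) * (a + b + 1) + 2 * b < (c + d) * (c + d + 1) + 2 * d.
  move=> h; have : (a + b).+1 * ((a + b).+1 + 1) <= (c + d) * (c + d + 1) by apply: leq_mul; lia.
  nia.
by case: (ltngtP (z + y) (z' + y')) => // /aux; rewrite E ltnn.
Qed.

Lemma pairn_mono z y z' y' : z <= z' -> y <= y' -> pairn z y <= pairn z' y'.
Proof. by move=> h1 h2; rewrite /pairn; apply: leq_add; [apply: leq_mul|]; lia. Qed.

(** The table of all prefix counts of X modulo d, with no other bits set. The bound y <= d beside y
    < d gives the quantifier the weak bound that [gdef_ex] expects. *)
Definition modstr (d : nat) (X : str) : str :=
  strof (pairn (slen X) d)
    (fun w => `[< exists z, z <= slen X /\ exists y, y <= d /\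
                    (y < d /\ w = pairn z y /\ modm d z X = y) >]).

Lemma smem_modstr d X z y : z <= slen X -> y < d ->
  smem (modstr d X) (pairn z y) = (modm d z X == y).
Proof.
move=> hz hy; rewrite smem_strof.
have -> : pairn z y < pairn (slen X) d.
  by apply: (@leq_trans (pairn z y.+1)); [rewrite /pairn; nia|apply: pairn_mono].
apply/asboolP/eqP => [[z' [_ [y' [_ [_ [/pairn_inj [-> ->] //]]]]]]|E].
by exists z; split => //; exists y; split; [apply: ltnW|].
Qed.

Lemma modmS d z X : modm d z.+1 X = (modm d z X + smem X z) %% d.
Proof. by rewrite /modm -addn1 iotaD count_cat /= add0n addn0 modnDml. Qed.

Lemma modm_lt d z X : 0 < d -> modm d z X < d.
Proof. by move=> h; rewrite ltn_mod. Qed.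

Definition modmx (d : nat) : form := FAnd (modA d) (FAnd modB (modC d)).

Lemma sat_modmx d r1 r2 X : 0 < d -> sat r1 (scons (modstr d X) (scons X r2)) (modmx d).
Proof.
move=> d0; split; last split.
- move=> z /=; rewrite -/(pairn _ _) => hz; exists (modm d z X); rewrite !tnumeral /=.
  have h := modm_lt z X d0; split; first by split; lia.
  rewrite -[_ + _]/(pairn z (modm d z X)) smem_modstr //; split => // y; rewrite tnumeral => -[hy hy'].
  rewrite -[_ + _]/(pairn z y) smem_modstr; [|lia..].
  by move/eqP.
- by rewrite /= -[_ + _]/(pairn 0 0) smem_modstr // /modm /= mod0n.
- move=> z /= [hz hz'] y; rewrite tnumeral => -[hy hy'].
  rewrite -[_ + _]/(pairn z y) smem_modstr; [|lia..].
  move/eqP => E; split=> hX.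
    exists ((y + 1) %% d); rewrite tnumeral; split.
      have := ltn_pmod (y + 1) d0; lia.
    exists ((y + 1) %/ d); rewrite tnumeral; split; first exact: leq_div.
    split; first exact: divn_eq.
    rewrite -[_ + _]/(pairn (z + 1) ((y + 1) %% d)) smem_modstr; [|lia|exact: ltn_pmod].
    by rewrite addn1 modmS E hX.
  rewrite -[_ + _]/(pairn (z + 1) y) smem_modstr; [|lia..].
  by rewrite addn1 modmS E; case: (smem X z) hX => [[]//|_]; rewrite addn0 modn_small //; lia.
Qed.

Lemma shift1_numeral d : shift1t (numeral d) = numeral d.
Proof. by elim: d => //= d; rewrite /shift1t /= => ->. Qed.

Lemma sB0_exnum d p : sigB0 p -> sigB0 (FEx1 (FAnd (flt (TVar 0) (numeral d)) p)).
Proof. by move=> h; have := sB0_exlt (numeral d) h; rewrite shift1_numeral. Qed.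

Lemma sB0_allnum d p : sigB0 p -> sigB0 (FAll1 (FImp (flt (TVar 0) (numeral d)) p)).
Proof. by move=> h; have := sB0_alllt (numeral d) h; rewrite shift1_numeral. Qed.

Lemma sigB0_modmx d : sigB0 (modmx d).
Proof.
apply: sB0_and; last apply: sB0_and.
- apply: (@sB0_allle (TLen 1)); apply: sB0_exnum.
  by apply: sB0_and; [constructor|apply: sB0_allnum; do !constructor].
- by constructor.
- apply: (@sB0_alllt (TLen 1)); apply: sB0_allnum.
  apply: sB0_imp; first by constructor.
  apply: sB0_and; last by do !constructor.
  apply: sB0_imp; first by constructor.
  apply: sB0_exnum.
  by apply: (@sB0_exle (TPlus (TVar 1) TOne)); do !constructor.
Qed.

(** * Axioms in the standard model *)

(** True universal closures of Sigma^B_0 formulas; these pass to the ultrapower as soon as Los's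
    theorem is known for the kernel. *)
Inductive univ : form -> Prop :=
| univ0 p : sigB0 p -> (forall r1 r2, sat r1 r2 p) -> univ p
| univ1 p : univ p -> univ (FAll1 p)
| univ2 p : univ p -> univ (FAll2 p).

Lemma univ_basic q : basic_ax q -> univ q.
Proof.
rewrite /basic_ax /=.
move=> [<-|[<-|[<-|[<-|[<-|[<-|[<-|[<-|[<-|[<-|[<-|[<-|[<-|[<-|[<-|//]]]]]]]]]]]]]]].
- by apply/univ1/univ0 => [|r1 r2 /=]; [do !constructor|lia].
- by do 2!apply: univ1; apply: univ0 => [|r1 r2 /=]; [do !constructor|lia].
- by apply/univ1/univ0 => [|r1 r2 /=]; [do !constructor|lia].
- by do 2!apply: univ1; apply: univ0 => [|r1 r2 /=]; [do !constructor|lia].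
- by apply/univ1/univ0 => [|r1 r2 /=]; [do !constructor|lia].
- by do 2!apply: univ1; apply: univ0 => [|r1 r2 /=]; [do !constructor|lia].
- by do 2!apply: univ1; apply: univ0 => [|r1 r2 /=]; [do !constructor|lia].
- by do 2!apply: univ1; apply: univ0 => [|r1 r2 /=]; [do !constructor|lia].
- by apply/univ1/univ0 => [|r1 r2 /=]; [do !constructor|lia].
- by do 2!apply: univ1; apply: univ0 => [|r1 r2 /=]; [do !constructor|lia].
- by do 2!apply: univ1; apply: univ0 => [|r1 r2 /=]; [do !constructor|lia].
- apply/univ1/univ0 => [|r1 r2 /=]; last by move=> h; exists (r1 0).-1; lia.
  by apply: sB0_imp; [do !constructor|apply: (@sB0_exlt (TVar 0)); constructor].
- apply/univ2/univ1/univ0 => [|r1 r2 /= h]; first by do !constructor.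
  by have := smem_lt h; lia.
- apply/univ2/univ1/univ0 => [|r1 r2 /= h]; first by do !constructor.
  by apply: smem_last; rewrite -h addn1.
- do 2!apply: univ2; apply: univ0 => [|r1 r2 /=].
    apply: sB0_and; apply: sB0_imp; try (by constructor); apply: sB0_and; try (by constructor);
      by apply: (@sB0_alllt (TLen 1)); do !constructor.
  split=> [->|[E h]] //; apply: str_ext => z.
  case: (ltnP z (slen (r2 1))) => hz; first by have [|a b] := h z; [lia|apply/idP/idP].
  by apply/idP/idP => /smem_lt; lia.
Qed.

Definition bodyf (p : form) : form :=
  FAnd (FLe (TLen 0) (nv 0))
    (FAll1 (FImp (flt (nv 0) (nv 1))
       (fiff (FIn (nv 0) 0) (fsubst (scons (nv 0) (fun i => nv i.+2)) S p)))).

Lemma sigB0_bodyf p : sigB0 p -> sigB0 (bodyf p).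
Proof.
move=> hp; apply: sB0_and; first by constructor.
apply: (@sB0_alllt (TVar 0)); have hp' := sigB0_fsubst (scons (nv 0) (fun i => nv i.+2)) S hp.
by apply: sB0_and; apply: sB0_imp => //; constructor.
Qed.

Lemma msat_bodyf M r1 r2 X p : @msat M r1 (scons X r2) (bodyf p) <->
  mle (mlen X) (r1 0) /\ forall z, mle z (r1 0) -> ~ meq1 z (r1 0) ->
    (mmem X z <-> msat (scons z (fun n => r1 n.+1)) r2 p).
Proof.
have E z : msat (scons z r1) (scons X r2) (fsubst (scons (nv 0) (fun i => nv i.+2)) S p) =
   msat (scons z (fun n => r1 n.+1)) r2 p.
  by rewrite msat_subst; congr msat; apply: funext => -[].
rewrite /bodyf /=; split=> -[h1 h2]; split=> // z; have := h2 z; rewrite E; tauto.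
Qed.

Lemma sat_bodyf r1 r2 p :
  sat r1 (scons (strof (r1 0) (fun z => `[< sat (scons z (fun n => r1 n.+1)) r2 p >])) r2) (bodyf p).
Proof.
rewrite -msat_std; apply/msat_bodyf; rewrite /=; split; first exact: slen_strof.
move=> z h n; rewrite msat_std smem_strof; have -> : z < r1 0 by lia.
by split=> /asboolP.
Qed.

Lemma stdM_strict : strict stdM.
Proof. by []. Qed.

Lemma msat_univ_std p r1 r2 : univ p -> @msat stdM r1 r2 p.
Proof.
move=> h; elim: h r1 r2 => {p} [p _ h r1 r2|p _ IH r1 r2 x|p _ IH r1 r2 X]; last 2 first.
- exact: IH.
- exact: IH.
- by rewrite msat_std.
Qed.

Lemma std_V0m m : 0 < m -> models stdM (V0m m).
Proof.
move=> hm q [[hq|[p [n [l [hp [-> _]]]]]]| ->] r1 r2.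
- exact: msat_univ_std (univ_basic hq).
- move: r1 r2; apply/msat_close => r1 r2; rewrite msat_std.
  by exists (strof (r1 0) (fun z => `[< sat (scons z (fun n => r1 n.+1)) r2 p >])); apply: sat_bodyf.
- by rewrite msat_std => X; exists (modstr m X); apply: sat_modmx.
Qed.

(** Contains both Sigma^1_1 and Sigma^B_1: conjunction makes room for the length bounds that stand
    between the string quantifiers, so one witnessing argument serves both classes. *)
Inductive sigX : form -> Prop :=
| sX_base p : sigB0 p -> sigX p
| sX_and p q : sigX p -> sigX q -> sigX (FAnd p q)
| sX_ex p : sigX p -> sigX (FEx2 p).

Lemma sig11_X p : sig11 p -> sigX p.
Proof. by elim=> *; [apply: sX_base|apply: sX_ex]. Qed.

Lemma sigB1_X p : sigB1 p -> sigX p.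
Proof.
elim=> [q hq|t q _ hq]; first exact: sX_base.
by apply: sX_ex; apply: sX_and => //; apply: sX_base; constructor.
Qed.

Lemma ndef_modn m d f : 0 < d -> ndef m f -> ndef m (fun r1 r2 => f r1 r2 %% d).
Proof.
move=> d0 hf; split; first by case: hf => hb _; apply: tbnd_le hb => r1 r2; apply: leq_mod.
have v0 := ndef_var m 0; have v1 := ndef_var m 1; have c := ndef_const m d.
have hf1 := ndef_wk hf; have hf2 := ndef_wk hf1.
apply: gdef_ext (gdef_and (gdef_lt v0 c) (gdef_ex hf1 (gdef_eq hf2 (ndef_add (ndef_mul v0 c) v1)))) => r1 r2 /=.
split=> [->|[h [q [_ ->]]]]; last by rewrite modnMDl modn_small.
split; first exact: ltn_pmod.
by exists (f (fun n => r1 n.+1) r2 %/ d); split; [exact: leq_div|exact: divn_eq].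
Qed.

Lemma modm_dvd m d z X : d %| m -> modm d z X = modm m z X %% d.
Proof. by move=> h; rewrite /modm modn_dvdm. Qed.

(** Each entry of the table is a count modulo m reduced modulo d, so the quantifier for m alone
    defines the tables for all its divisors. *)
Lemma sdef_modstr m d F : 0 < d -> d %| m -> sdef m F -> sdef m (fun r1 r2 => modstr d (F r1 r2)).
Proof.
move=> d0 dm hF.
have v0 := ndef_var m 0; have v1 := ndef_var m 1; have v2 := ndef_var m 2; have c := ndef_const m d.
have hp (f g : (nat -> nat) -> (nat -> str) -> nat) : ndef m f -> ndef m g ->
    ndef m (fun r1 r2 => pairn (f r1 r2) (g r1 r2)).
  move=> hf hg; have hs := ndef_add hf hg.
  exact: (ndef_add (ndef_mul hs (ndef_add hs (ndef_const m 1))) (ndef_mul (ndef_const m 2) hg)).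
have hl := ndef_len hF.
have hm := ndef_modn d0 (ndef_mod v1 (sdef_wk (sdef_wk (sdef_wk hF)))).
have h := gdef_ex (ndef_wk hl) (gdef_ex c (gdef_and (gdef_lt v0 c) (gdef_and (gdef_eq v2 (hp _ _ v1 v0)) (gdef_eq hm v0)))).
apply: sdef_ext (sdef_strof (hp _ _ hl c) h) => r1 r2 /=; rewrite /modstr.
congr strof; apply: funext => w; apply: asbool_equiv_eq.
by split=> -[z [hz [y [hy [h1 [h2 h3]]]]]]; exists z; split => //; exists y; split => //; split => //;
  split => //; move: h3; rewrite (modm_dvd _ _ dm).
Qed.

(** * The ultrapower of definable functions *)

Section Ultrapower.
Variable m : nat.
Definition env : Type := ((nat -> nat) * (nat -> str))%type.
Variable U : (env -> Prop) -> Prop.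
Hypotheses (US : forall A B : env -> Prop, (forall e, A e -> B e) -> U A -> U B)
  (UI : forall A B, U A -> U B -> U (fun e => A e /\ B e)) (U0 : ~ U (fun _ => False))
  (UC : forall A, U A \/ U (fun e => ~ A e)).

Lemma UT A : (forall e, A e) -> U A.
Proof. by move=> h; case: (UC A) => // n; case: U0; apply: US n => e; apply. Qed.

Definition nfun := {f : (nat -> nat) -> (nat -> str) -> nat | ndef m f}.
Definition sfun := {F : (nat -> nat) -> (nat -> str) -> str | sdef m F}.

Definition upM : struc :=
  @Struc nfun sfun (exist _ _ (ndef_const m 0)) (exist _ _ (ndef_const m 1))
    (fun f g => exist _ _ (ndef_add (svalP f) (svalP g)))
    (fun f g => exist _ _ (ndef_mul (svalP f) (svalP g)))
    (fun F => exist _ _ (ndef_len (svalP F)))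
    (fun f g => U (fun e => sval f e.1 e.2 <= sval g e.1 e.2))
    (fun f g => U (fun e => sval f e.1 e.2 = sval g e.1 e.2))
    (fun F f => U (fun e => smem (sval F e.1 e.2) (sval f e.1 e.2)))
    (fun F G => U (fun e => sval F e.1 e.2 = sval G e.1 e.2)).

Definition ev1 (r1 : nat -> nfun) (e : env) : nat -> nat := fun n => sval (r1 n) e.1 e.2.
Definition ev2 (r2 : nat -> sfun) (e : env) : nat -> str := fun n => sval (r2 n) e.1 e.2.

Lemma upM_normal : normal upM.
Proof.
split; last split => /=.
- by move=> f; apply: UT.
- by move=> f g; apply: US => e.
- by move=> f g h a b; apply: US (UI a b) => e [-> ->].
- move=> f f' g g' a b; split; try by apply: US (UI a b) => e /= [-> ->].
  by move=> c; apply: US (UI (UI a b) c) => e /= [[-> ->]].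
- by move=> f; apply: UT.
- by move=> f g; apply: US => e.
- by move=> f g h a b; apply: US (UI a b) => e [-> ->].
- by move=> f g; apply: US => e /= ->.
- by move=> F G f g a b c; apply: US (UI (UI a b) c) => e /= [[-> ->]].
Qed.

Lemma upM_eval r1 r2 t e : sval (@meval upM r1 r2 t) e.1 e.2 = teval (ev1 r1 e) (ev2 r2 e) t.
Proof. by elim: t => //= [t -> u ->|t -> u ->]. Qed.

Lemma ev1_scons f r1 e : ev1 (scons f r1) e = scons (sval f e.1 e.2) (ev1 r1 e).
Proof. by apply: funext => -[]. Qed.
Lemma ev2_scons F r2 e : ev2 (scons F r2) e = scons (sval F e.1 e.2) (ev2 r2 e).
Proof. by apply: funext => -[]. Qed.

Lemma gdef_ev (p : form) r1 r2 : sigB0 p -> gdef m (fun e1 e2 => sat (ev1 r1 (e1, e2)) (ev2 r2 (e1, e2)) p).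
Proof.
move=> hp; apply: (gdef_comp (gdef_sat m hp) (th1 := fun n => sval (r1 n)) (th2 := fun n => sval (r2 n))).
  by move=> n; apply: svalP.
by move=> n; apply: svalP.
Qed.

Lemma los_ex (t : term) p (r1 : nat -> nfun) (r2 : nat -> sfun) : sigB0 p ->
  (exists f : nfun, U (fun e => sval f e.1 e.2 <= teval (ev1 r1 e) (ev2 r2 e) t /\
                   sat (ev1 (scons f r1) e) (ev2 r2 e) p)) <->
  U (fun e => exists x, x <= teval (ev1 r1 e) (ev2 r2 e) t /\ sat (scons x (ev1 r1 e)) (ev2 r2 e) p).
Proof.
move=> hp; split=> [[f]|h].
  by apply: US => e; rewrite ev1_scons => h; exists (sval f e.1 e.2).
have hg : ndef m (fun e1 e2 => teval (ev1 r1 (e1, e2)) (ev2 r2 (e1, e2)) t).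
  by apply: (ndef_term t (th1 := fun n => sval (r1 n)) (th2 := fun n => sval (r2 n))) => n; apply: svalP.
pose th1 n : (nat -> nat) -> (nat -> str) -> nat :=
  if n is k.+1 then fun e1 e2 => sval (r1 k) (fun i => e1 i.+1) e2 else fun e1 _ => e1 0.
pose th2 n : (nat -> nat) -> (nat -> str) -> str := fun e1 e2 => sval (r2 n) (fun i => e1 i.+1) e2.
have h1 n : ndef m (th1 n) by case: n => [|n]; [exact: ndef_var|exact: (ndef_wk (svalP (r1 n)))].
have h2 n : sdef m (th2 n) by exact: (sdef_wk (svalP (r2 n))).
have [f [hf H]] := skolem hg (gdef_comp (gdef_sat m hp) h1 h2).
have E x e1 e2 : (fun n => th1 n (scons x e1) e2) = scons x (ev1 r1 (e1, e2)).
  by apply: funext => -[].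
exists (exist _ f hf); apply: US h => -[e1 e2] [x [hx hs]].
have [|a b] := H e1 e2; first by exists x; split => //; rewrite E.
by rewrite ev1_scons; split => //; rewrite -E.
Qed.

(** Together with [msat_all] this reduces the four forms of bounded quantifier to the existential
    one with weak bound, the only one that Los's theorem treats directly. *)
Lemma msat_exlt M r1 r2 t q :
  @msat M r1 r2 (FEx1 (FAnd (flt (TVar 0) (shift1t t)) q)) <->
  @msat M r1 r2 (FEx1 (FAnd (FLe (TVar 0) (shift1t t)) (FAnd (fneg (FEq1 (TVar 0) (shift1t t))) q))).
Proof. by split=> -[x [h h']]; exists x; move: h h' => /=; tauto. Qed.

Lemma msat_all M r1 r2 a q :
  @msat M r1 r2 (FAll1 (FImp a q)) <-> @msat M r1 r2 (fneg (FEx1 (FAnd a (fneg q)))).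
Proof.
split=> [h [x [h1 h2]]|h x h1]; first by apply: h2; apply: h.
by apply: contrapT => h2; apply: h; exists x.
Qed.

Definition lossat (p : form) : Prop := forall r1 r2,
  @msat upM r1 r2 p <-> U (fun e => sat (ev1 r1 e) (ev2 r2 e) p).

Lemma Uiff (A B : env -> Prop) : (forall e, A e <-> B e) -> U A <-> U B.
Proof. by move=> h; split; apply: US => e /h. Qed.

Lemma los_eqv p q : (forall M r1 r2, @msat M r1 r2 p <-> msat r1 r2 q) -> lossat q -> lossat p.
Proof.
move=> h hq r1 r2; rewrite h hq; apply: Uiff => e.
by rewrite -!msat_std h.
Qed.

Lemma los_imp p q : lossat p -> lossat q -> lossat (FImp p q).
Proof.
move=> IHp IHq r1 r2 /=; rewrite IHp IHq; split=> [h|h1 h2].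
  case: (UC (fun e => sat (ev1 r1 e) (ev2 r2 e) p)) => [/h|]; first by apply: US => e.
  by apply: US => e n /n.
by apply: US (UI h1 h2) => e [h]; apply: h.
Qed.

Lemma los_and p q : lossat p -> lossat q -> lossat (FAnd p q).
Proof.
move=> IHp IHq r1 r2 /=; rewrite IHp IHq; split=> [[h1 h2]|h]; first exact: UI.
by split; apply: US h => e [].
Qed.

Lemma los_bot : lossat FBot.
Proof. by move=> r1 r2; split=> // /U0. Qed.

Lemma los_exle t q : sigB0 q -> lossat q -> lossat (FEx1 (FAnd (FLe (TVar 0) (shift1t t)) q)).
Proof.
move=> hq IH r1 r2.
have [e1 e2] := los_ex t r1 r2 hq.
have Es : U (fun e => sat (ev1 r1 e) (ev2 r2 e) (FEx1 (FAnd (FLe (TVar 0) (shift1t t)) q))) <->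
   U (fun e => exists x, x <= teval (ev1 r1 e) (ev2 r2 e) t /\ sat (scons x (ev1 r1 e)) (ev2 r2 e) q).
  by apply: Uiff => e; split=> -[x [h h']]; exists x; split => //; move: h => /=; rewrite teval_shift1.
have El f : @msat upM (scons f r1) r2 (FLe (TVar 0) (shift1t t)) <->
    U (fun e => sval f e.1 e.2 <= teval (ev1 r1 e) (ev2 r2 e) t).
  by apply: Uiff => e; rewrite !upM_eval ev1_scons teval_shift1.
rewrite Es; split=> [[f [/El h1 /IH h2]]|/e2 [f h]].
  by apply: e1; exists f; apply: UI.
by exists f; split; [apply/El|apply/IH]; apply: US h => e [].
Qed.

Lemma los p : sigB0 p -> lossat p.
Proof.
elim=> {p}.
- exact: los_bot.
- by move=> t u r1 r2; apply: Uiff => e; rewrite !upM_eval.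
- by move=> t u r1 r2; apply: Uiff => e; rewrite !upM_eval.
- by move=> t X r1 r2; apply: Uiff => e; rewrite !upM_eval.
- by [].
- by move=> p q _ IHp _ IHq; apply: los_imp.
- by move=> p q _ IHp _ IHq; apply: los_and.
- move=> p q _ IHp _ IHq r1 r2 /=; rewrite IHp IHq; split=> [[]|h]; try by apply: US => e; tauto.
  case: (UC (fun e => sat (ev1 r1 e) (ev2 r2 e) p)) => [|n]; [by left|right].
  by apply: US (UI h n) => e []; tauto.
- by move=> t q; apply: los_exle.
- move=> t q hq IH; apply: los_eqv; first by move=> *; apply: msat_exlt.
  have at1 : lossat (FEq1 (TVar 0) (shift1t t)) by move=> r1 r2; apply: Uiff => e; rewrite !upM_eval.
  apply: los_exle; first by do !constructor.
  by apply: los_and => //; apply: los_imp => //; apply: los_bot.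
- move=> t q hq IH; apply: los_eqv; first by move=> *; apply: msat_all.
  apply: los_imp los_bot; apply: los_exle; first by do !constructor.
  by apply: los_imp los_bot.
- move=> t q hq IH; apply: los_eqv; first by move=> *; apply: msat_all.
  apply: los_imp los_bot; apply: los_eqv; first by move=> *; apply: msat_exlt.
  have at1 : lossat (FEq1 (TVar 0) (shift1t t)) by move=> r1 r2; apply: Uiff => e; rewrite !upM_eval.
  apply: los_exle; first by do !constructor.
  by apply: los_and; [apply: los_imp los_bot|apply: los_imp los_bot].
Qed.

Lemma upM_univ p r1 r2 : univ p -> @msat upM r1 r2 p.
Proof.
move=> h; elim: h r1 r2 => {p} [p hp h r1 r2|p _ IH r1 r2 x|p _ IH r1 r2 X]; last 2 first.
- exact: IH.
- exact: IH.
- by apply/(los hp); apply: UT => e; apply: h.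
Qed.

Lemma upM_models T : (forall q, T q -> V0 q \/ exists d, [/\ 0 < d, d %| m & q = MODax d]) ->
  models upM T.
Proof.
move=> hT q /hT [[hq|[p [n [l [hp [-> _]]]]]]|[d [d0 dm ->]]] r1 r2.
- exact: upM_univ (univ_basic hq).
- move: r1 r2; apply/msat_close => r1 r2.
  (* Comprehension is carried out separately at each input; the resulting function is definable
     because p is Sigma^B_0. *)
  pose F e1 e2 := strof (ev1 r1 (e1, e2) 0) (fun z => `[< sat (scons z (fun n => ev1 r1 (e1, e2) n.+1)) (ev2 r2 (e1, e2)) p >]).
  have hF : sdef m F.
    pose th1 n : (nat -> nat) -> (nat -> str) -> nat :=
      if n is k.+1 then fun e1 e2 => sval (r1 n) (fun i => e1 i.+1) e2 else fun e1 _ => e1 0.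
    pose th2 n : (nat -> nat) -> (nat -> str) -> str := fun e1 e2 => sval (r2 n) (fun i => e1 i.+1) e2.
    have h1 k : ndef m (th1 k) by case: k => [|k]; [exact: ndef_var|exact: (ndef_wk (svalP (r1 k.+1)))].
    have h2 k : sdef m (th2 k) by exact: (sdef_wk (svalP (r2 k))).
    apply: sdef_ext (sdef_strof (svalP (r1 0)) (gdef_comp (gdef_sat m hp) h1 h2)) => e1 e2.
    congr strof; apply: funext => z; congr (`[< sat _ _ _ >]).
    by apply: funext => -[].
  exists (exist _ F hF); apply/(los (sigB0_bodyf hp)); apply: UT => -[e1 e2].
  by rewrite ev2_scons; apply: sat_bodyf.
- move=> X; exists (exist _ _ (sdef_modstr d0 dm (svalP X))).
  apply/(los (sigB0_modmx d)); apply: UT => -[e1 e2].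
  by rewrite !ev2_scons; apply: sat_modmx.
Qed.

(** With string quantifiers in p, the set of inputs where p holds need not be definable. A definable
    member A of U inside it is kept instead, to be used in case distinctions. *)
Lemma upM_sigX p r1 r2 : sigX p -> @msat upM r1 r2 p ->
  exists A, [/\ gdef m A, U (fun e => A e.1 e.2) &
    forall e1 e2, A e1 e2 -> sat (ev1 r1 (e1, e2)) (ev2 r2 (e1, e2)) p].
Proof.
move=> h; elim: h r1 r2 => {p} [p hp|p q _ IHp _ IHq|p _ IH] r1 r2.
- move/(los hp) => h.
  exists (fun e1 e2 => sat (ev1 r1 (e1, e2)) (ev2 r2 (e1, e2)) p); split=> //.
  exact: gdef_ev.
- move=> [/IHp [A [hA UA h1]] /IHq [B [hB UB h2]]].
  exists (fun e1 e2 => A e1 e2 /\ B e1 e2); split; [exact: gdef_and|exact: UI|].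
  by move=> e1 e2 [/h1 a /h2].
- move=> [X /IH [A [hA UA h]]]; exists A; split=> // e1 e2 /h; rewrite ev2_scons => hs.
  by exists (sval X e1 e2).
Qed.
End Ultrapower.

(** * Gluing the local witnesses *)

Section Witness.
Variables (m : nat) (T : form -> Prop) (k l : nat).
Hypothesis hT : forall q, T q -> V0 q \/ exists d, [/\ 0 < d, d %| m & q = MODax d].

Definition sized (e : env) : Prop :=
  exists xs Xs, [/\ size xs = k, size Xs = l & e = (num_env xs, str_env Xs)].

(** A compactness argument: if no good set covered all inputs, the complements of good sets would
    generate a proper filter, and an ultrafilter above it could not contain any good set. *)
Lemma cover_principle (good : ((nat -> nat) -> (nat -> str) -> Prop) -> Prop) :
  good (fun _ _ => False) ->
  (forall A B, good A -> good B -> good (fun e1 e2 => A e1 e2 \/ B e1 e2)) ->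
  (forall U : (env -> Prop) -> Prop, U sized ->
    (forall A B : env -> Prop, (forall e, A e -> B e) -> U A -> U B) ->
    (forall A B, U A -> U B -> U (fun e => A e /\ B e)) -> ~ U (fun _ => False) ->
    (forall A, U A \/ U (fun e => ~ A e)) ->
    exists A, good A /\ U (fun e => A e.1 e.2)) ->
  exists A, good A /\ forall e, sized e -> A e.1 e.2.
Proof.
move=> g0 gU h; apply: contrapT => n.
(* The filter generated by the complements of good sets within the inputs of the right arity. *)
pose P (S : env -> Prop) := exists A, good A /\ forall e, sized e -> ~ A e.1 e.2 -> S e.
have [||||U [PU US UI U0 UC]] := @ultrafilter_exists env P.
- by exists (fun _ _ => False).
- move=> A B [A' [gA hA]] [B' [gB hB]]; exists (fun e1 e2 => A' e1 e2 \/ B' e1 e2).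
  split; first exact: gU.
  by move=> e he /not_orP [a b]; split; [apply: hA|apply: hB].
- by move=> A B AB [A' [gA hA]]; exists A'; split=> // e he na; apply/AB/hA.
- by move=> [A [gA hA]]; apply: n; exists A; split=> // e he; apply: contrapT => /(hA _ he).
have [|A [gA UA]] := h U _ US UI U0 UC.
  by apply: PU; exists (fun _ _ => False); split.
have U1 : U sized by apply: PU; exists (fun _ _ => False); split.
have U2 : U (fun e => sized e -> ~ A e.1 e.2) by apply: PU; exists A; split.
by apply/U0/(US _ _ _ (UI _ _ UA (UI _ _ U1 U2))) => e [a [b c]]; apply: c.
Qed.

Lemma witness_str F p : sigX p ->
  (forall xs Xs Y, size xs = k -> size Xs = l ->
       (Y = F xs Xs <-> sat (num_env xs) (scons Y (str_env Xs)) p)) ->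
  Provable T (close k l (exU2 p)) -> FAC0_str m k l F.
Proof.
move=> hp hF pr.
(* A itself must be definable, so that two functions G can be combined by a case distinction. *)
pose good A := gdef m A /\ exists G, sdef m G /\ forall xs Xs, size xs = k -> size Xs = l ->
  A (num_env xs) (str_env Xs) -> F xs Xs = G (num_env xs) (str_env Xs).
suff [A [[gA [G [hG h]]] hA]] : exists A, good A /\ forall e, sized e -> A e.1 e.2.
  apply/FAC0_strP; exists G; split => // xs Xs hx hX; apply: h => //.
  by apply: (hA (num_env xs, str_env Xs)); exists xs, Xs.
apply: cover_principle.
- by split; [exact: gdef_bot|exists (fun _ _ => sempty); split; [exact: sdef_empty|]].
- move=> A B [gA [G [hG hA]]] [gB [H [hH hB]]]; split; first exact: gdef_or.
  exists (fun e1 e2 => if `[< A e1 e2 >] then G e1 e2 else H e1 e2); split; first exact: sdef_if.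
  move=> xs Xs hx hX; case: asboolP => [a _|n [//|b]]; [exact: hA|exact: hB].
- move=> U Us US UI U0 UC.
  have nM : normal (upM m U) by apply: upM_normal.
  have mM : models (upM m U) T by apply: upM_models.
  have := provable_models nM mM pr.
  (* The projections form the generic input: at them the provable existence statement yields an
     element Y of the ultrapower, which is a definable function of the input. *)
  move/msat_close => /(_ (fun n => exist _ _ (ndef_var m n)) (fun n => exist _ _ (sdef_var m n))).
  move=> [Y [/(upM_sigX US UI U0 UC hp) [A [gA UA hA]] _]].
  exists A; split => //; split => //; exists (sval Y); split; first exact: svalP.
  move=> xs Xs hx hX /hA; rewrite ev2_scons => hs; apply/esym/hF => //; exact: hs.
Qed.

Lemma witness_num f p : sigX p ->
  (forall xs Xs y, size xs = k -> size Xs = l ->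
       (y = f xs Xs <-> sat (scons y (num_env xs)) (str_env Xs) p)) ->
  Provable T (close k l (exU1 p)) -> FAC0_num m k l f.
Proof.
move=> hp hF pr.
pose good A := gdef m A /\ exists G, ndef m G /\ forall xs Xs, size xs = k -> size Xs = l ->
  A (num_env xs) (str_env Xs) -> f xs Xs = G (num_env xs) (str_env Xs).
suff [A [[gA [G [hG h]]] hA]] : exists A, good A /\ forall e, sized e -> A e.1 e.2.
  apply/FAC0_numP; exists G; split => // xs Xs hx hX; apply: h => //.
  by apply: (hA (num_env xs, str_env Xs)); exists xs, Xs.
apply: cover_principle.
- by split; [exact: gdef_bot|exists (fun _ _ => 0); split; [exact: ndef_const|]].
- move=> A B [gA [G [hG hA]]] [gB [H [hH hB]]]; split; first exact: gdef_or.
  exists (fun e1 e2 => if `[< A e1 e2 >] then G e1 e2 else H e1 e2); split; first exact: ndef_if.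
  move=> xs Xs hx hX; case: asboolP => [a _|n [//|b]]; [exact: hA|exact: hB].
- move=> U Us US UI U0 UC.
  have nM : normal (upM m U) by apply: upM_normal.
  have mM : models (upM m U) T by apply: upM_models.
  have := provable_models nM mM pr.
  move/msat_close => /(_ (fun n => exist _ _ (ndef_var m n)) (fun n => exist _ _ (sdef_var m n))).
  move=> [Y [/(upM_sigX US UI U0 UC hp) [A [gA UA hA]] _]].
  exists A; split => //; split => //; exists (sval Y); split; first exact: svalP.
  move=> xs Xs hx hX /hA; rewrite ev1_scons => hs; apply/esym/hF => //; exact: hs.
Qed.
End Witness.

Lemma witness_V0m_str m k l F p : 2 <= m -> sigX p ->
  (forall xs Xs Y, size xs = k -> size Xs = l ->
       (Y = F xs Xs <-> sat (num_env xs) (scons Y (str_env Xs)) p)) ->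
  Provable (V0m m) (close k l (exU2 p)) -> FAC0_str m k l F.
Proof.
move=> m2; apply: witness_str.
by move=> q [|->]; [left|right; exists m; split; [lia|exact: dvdnn|]].
Qed.

Lemma witness_V0m_num m k l f p : 2 <= m -> sigX p ->
  (forall xs Xs y, size xs = k -> size Xs = l ->
       (y = f xs Xs <-> sat (scons y (num_env xs)) (str_env Xs) p)) ->
  Provable (V0m m) (close k l (exU1 p)) -> FAC0_num m k l f.
Proof.
move=> m2; apply: witness_num.
by move=> q [|->]; [left|right; exists m; split; [lia|exact: dvdnn|]].
Qed.

(* A proof uses finitely many of the axioms MOD_d, and all of them hold modulo a common multiple m. *)
Lemma VACC_finite p : Provable VACC p -> exists m T, [/\ 2 <= m,
  (forall q, T q -> V0 q \/ exists d, [/\ 0 < d, d %| m & q = MODax d]) & Provable T p].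
Proof.
move=> [G [hG d]].
suff [m [m2 hm]] : exists m, 2 <= m /\ forall q, List.In q G -> V0 q \/ exists d, [/\ 0 < d, d %| m & q = MODax d].
  by exists m, (fun q => List.In q G); split => //; exists G; split.
elim: G hG {d} => [|q G IH] hG; first by exists 2.
have [|m [m2 hm]] := IH; first by move=> r hr; apply: hG; right.
have [hq|[d [d2 ->]]] := hG q (or_introl erefl).
  by exists m; split => // r /= [<-|/hm]; [left|].
exists (d * m); split; first by nia.
move=> r /= [<-|/hm [|[c [c0 cm ->]]]]; [right|by left|right].
  by exists d; split; [lia|exact: dvdn_mulr|].
by exists c; split; [|exact: dvdn_mull|].
Qed.

Lemma witness_VACC_str k l F p : sigX p ->
  (forall xs Xs Y, size xs = k -> size Xs = l ->
       (Y = F xs Xs <-> sat (num_env xs) (scons Y (str_env Xs)) p)) ->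
  Provable VACC (close k l (exU2 p)) -> FACC_str k l F.
Proof.
move=> hp hF /VACC_finite [m [T [m2 hT pr]]]; exists m; split => //.
exact: (witness_str hT hp hF pr).
Qed.

Lemma witness_VACC_num k l f p : sigX p ->
  (forall xs Xs y, size xs = k -> size Xs = l ->
       (y = f xs Xs <-> sat (scons y (num_env xs)) (str_env Xs) p)) ->
  Provable VACC (close k l (exU1 p)) -> FACC_num k l f.
Proof.
move=> hp hF /VACC_finite [m [T [m2 hT pr]]]; exists m; split => //.
exact: (witness_num hT hp hF pr).
Qed.

(** * Arithmetic in models of V0(m) *)

(** Forbids the bits of Y that MOD_m leaves undetermined, namely those that do not encode a pair of
    a position up to |X| and a residue; this makes Y unique. *)
Definition normf (m : nat) : form :=
  FAll1 (FImp (flt (TVar 0) (TLen 0)) (FImp (FIn (TVar 0) 0)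
    (FEx1 (FAnd (FLe (TVar 0) (TLen 1)) (FEx1 (FAnd (flt (TVar 0) (numeral m))
       (FEq1 (TVar 2) (tpair (TVar 1) (TVar 0))))))))).

(** A step is a length bound, evaluated before the new string exists, and a condition in which the
    new string is variable 0; hence the shifts of t and p. *)
Definition compstep (t : term) (p : form) : term * form :=
  (t, FAll1 (FImp (flt (TVar 0) (shift1t (shift2t t)))
        (fiff (FIn (TVar 0) 0) (fsubst TVar S p)))).
(** Applies to the newest string X, which is variable 0 in the bound and variable 1 in the
    condition. The summand 1 puts all relevant pairs strictly below the bound by weak monotonicity
    of pairing. *)
Definition modstep (m : nat) : term * form :=
  (TPlus (tpair (TLen 0) (numeral m)) TOne, FAnd (normf m) (modmx m)).

Section Model.
Variables (m : nat) (hm : 0 < m) (M : struc) (sM : strict M) (mM : models M (V0m m)) (S0 : strg M).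

Notation "0" := (m0 M).
Notation "1" := (m1 M).
Notation "x + y" := (@madd M x y).
Notation "x * y" := (@mmul M x y).
Notation "x <= y" := (@mle M x y).
Definition mlt (x y : num M) := x <= y /\ x <> y.
Notation "x < y" := (mlt x y).

Let e1 x y : @meq1 M x y = (x = y).
Proof. by apply: propext; case: sM => h _; apply: h. Qed.
Let e2 x y : @meq2 M x y = (x = y).
Proof. by apply: propext; case: sM => _ h; apply: h. Qed.
Let r0 : nat -> num M := fun _ => 0.
Let s0 : nat -> strg M := fun _ => S0.

Let ax q (h : basic_ax q) : @msat M r0 s0 q.
Proof. by apply: mM; left; left. Qed.

Lemma modelB1 x : x + 1 <> 0.
Proof. by have := ax (q := B1) ltac:(rewrite /basic_ax /=; tauto) x; rewrite /= e1. Qed.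
Lemma modelB2 x y : x + 1 = y + 1 -> x = y.
Proof. by have := ax (q := B2) ltac:(rewrite /basic_ax /=; tauto) x y; rewrite /= !e1. Qed.
Lemma modelB3 x : x + 0 = x.
Proof. by have := ax (q := B3) ltac:(rewrite /basic_ax /=; tauto) x; rewrite /= e1. Qed.
Lemma modelB4 x y : x + (y + 1) = (x + y) + 1.
Proof. by have := ax (q := B4) ltac:(rewrite /basic_ax /=; tauto) x y; rewrite /= e1. Qed.
Lemma modelB5 x : x * 0 = 0.
Proof. by have := ax (q := B5) ltac:(rewrite /basic_ax /=; tauto) x; rewrite /= e1. Qed.
Lemma modelB6 x y : x * (y + 1) = x * y + x.
Proof. by have := ax (q := B6) ltac:(rewrite /basic_ax /=; tauto) x y; rewrite /= e1. Qed.
Lemma modelB7 x y : x <= y -> y <= x -> x = y.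
Proof. by have := ax (q := B7) ltac:(rewrite /basic_ax /=; tauto) x y; rewrite /= e1; tauto. Qed.
Lemma modelB8 x y : x <= x + y.
Proof. exact: (ax (q := B8) ltac:(rewrite /basic_ax /=; tauto) x y). Qed.
Lemma modelB9 x : 0 <= x.
Proof. exact: (ax (q := B9) ltac:(rewrite /basic_ax /=; tauto) x). Qed.
Lemma modelB10 x y : x <= y \/ y <= x.
Proof. exact: (ax (q := B10) ltac:(rewrite /basic_ax /=; tauto) x y). Qed.
Lemma modelB11 x y : x <= y <-> x < y + 1.
Proof. by have := ax (q := B11) ltac:(rewrite /basic_ax /=; tauto) x y; rewrite /= e1 /mlt; tauto. Qed.
Lemma modelB12 x : x <> 0 -> exists y, y + 1 = x.
Proof.
have := ax (q := B12) ltac:(rewrite /basic_ax /=; tauto) x; rewrite /= e1 => h /h [y [_]].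
by rewrite e1; exists y.
Qed.
Lemma modelL1 (X : strg M) y : mmem X y -> y < mlen X.
Proof. by have := ax (q := L1) ltac:(rewrite /basic_ax /=; tauto) X y; rewrite /= e1. Qed.
Lemma modelL2 (X : strg M) y : y + 1 = mlen X -> mmem X y.
Proof. by have := ax (q := L2) ltac:(rewrite /basic_ax /=; tauto) X y; rewrite /= e1. Qed.
Lemma modelSE (X Y : strg M) : mlen X = mlen Y -> (forall z, mmem X z <-> mmem Y z) -> X = Y.
Proof.
have := ax (q := SE) ltac:(rewrite /basic_ax /=; tauto) X Y; rewrite /= !e1 e2 => -[_ h] E hz.
by apply: h; split => // z _; have := hz z; tauto.
Qed.

Lemma mle_refl x : x <= x.
Proof. by have := modelB8 x 0; rewrite modelB3. Qed.
Lemma mle_S x y : x <= y -> x <= y + 1.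
Proof. by move=> /modelB11 []. Qed.
Lemma mle_Sr x y : x <= y + 1 -> x = y + 1 \/ x <= y.
Proof.
by move=> h; case: (pselect (x = y + 1)) => n; [left|right; apply/modelB11].
Qed.
Lemma mle0 x : x <= 0 -> x = 0.
Proof. by move=> h; apply: modelB7 h (modelB9 x). Qed.
Lemma mlt_le x y : x < y -> x + 1 <= y.
Proof.
move=> [h n]; case: (modelB10 (x + 1) y) => // /mle_Sr [->|h']; first exact: mle_refl.
by case: n; apply: modelB7.
Qed.
Lemma mltS x : x < x + 1.
Proof. by apply/modelB11/mle_refl. Qed.
Lemma mleS_not x : ~ x + 1 <= x.
Proof. by move=> /modelB11 []. Qed.
Lemma mle_pred x y : x + 1 <= y -> x < y.
Proof.
move=> h; have n : x <> y by move=> E; apply: (@mleS_not x); rewrite {2}E.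
split => //; case: (modelB10 x y) => // h'; have E := modelB7 h (mle_S h').
by have := mltS x; rewrite E => -[].
Qed.

Lemma mcomp p r1 r2 a : sigB0 p -> exists X : strg M, mlen X <= a /\
  forall z, z < a -> (mmem X z <-> @msat M (scons z r1) r2 p).
Proof.
move=> hp; have [n [h1 h2]] := fnb_ex (compf p).
have hV : V0m m (close n n (compf p)).
  by left; right; exists p, n, n; split => //; split => //; exact: closed_close.
have /msat_close h := mM hV; have [X /msat_bodyf [a1 a2]] := h (scons a r1) r2.
by exists X; split => // z [b c]; apply: a2 => //; rewrite e1.
Qed.

(** Comprehension gives the set of all z <= a up to which the formula holds. By B12 and L2 it has a
    largest element |X| - 1, and this must be a, because otherwise the induction step would put its
    successor into the set. *)
Lemma mind p r1 r2 : sigB0 p -> @msat M (scons 0 r1) r2 p ->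
  (forall z, @msat M (scons z r1) r2 p -> @msat M (scons (z + 1) r1) r2 p) ->
  forall a, @msat M (scons a r1) r2 p.
Proof.
move=> hp h0 hS a; set P := fun z => @msat M (scons z r1) r2 p; apply: contrapT => na.
pose q := FAll1 (FImp (FLe (TVar 0) (shift1t (TVar 0)))
  (fsubst (scons (TVar 0) (fun i => TVar i.+2)) id p)).
have hq z : @msat M (scons z r1) r2 q <-> forall y, y <= z -> P y.
  have E y : @msat M (scons y (scons z r1)) r2 (fsubst (scons (TVar 0) (fun i => TVar i.+2)) id p) = P y.
    by rewrite msat_subst; congr msat; apply: funext => -[].
  by rewrite /q /=; split=> h y hy; [rewrite -E|rewrite E]; apply: h.
have sq : sigB0 q by apply: sB0_allle; apply: sigB0_fsubst.
have [X [lX hX]] := mcomp r1 r2 (a + 1) sq.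
have X0 : mmem X 0.
  apply/hX; first by apply/modelB11/modelB9.
  by apply/hq => y /mle0 ->.
have [u Eu] : exists u, u + 1 = mlen X.
  by apply: modelB12 => E; have [_ n] := modelL1 X0; apply: n.
have ua : u <= a.
  move: lX; rewrite -Eu => /mle_Sr [/modelB2 ->|/mle_pred []//]; exact: mle_refl.
have /hq h := proj1 (hX u (proj1 (modelB11 u a) ua)) (modelL2 Eu).
have nua : u <> a by move=> E; apply: na; rewrite -E; apply: h; exact: mle_refl.
have u1a : u + 1 <= a by apply: mlt_le.
have : mmem X (u + 1).
  apply/hX; first by apply/modelB11.
  apply/hq => y /mle_Sr [->|]; last exact: h.
  by apply: hS; apply: h; exact: mle_refl.
by move=> /modelL1; rewrite Eu => -[].
Qed.

(** Transitivity is not an axiom; it comes from induction on the largest of the three numbers. *)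
Lemma mle_trans y x z : x <= y -> y <= z -> x <= z.
Proof.
pose p := FImp (FLe (TVar 1) (TVar 2)) (FImp (FLe (TVar 2) (TVar 0)) (FLe (TVar 1) (TVar 0))).
apply: (@mind p (scons x (scons y r0)) s0) => [||{}z /= h hxy /mle_Sr [<- //|hyz]].
- by do !constructor.
- by move=> /= h /mle0 <-.
- by apply: mle_S; apply: h.
Qed.

Lemma mlt_le_trans y x z : x < y -> y <= z -> x < z.
Proof.
move=> [h n] h1; split; first exact: mle_trans h h1.
by move=> E; subst z; apply: n; apply: modelB7.
Qed.

Lemma mleS2 x y : x <= y -> x + 1 <= y + 1.
Proof. by move=> /modelB11 /mlt_le. Qed.

Lemma madd_monor x y y' : y <= y' -> x + y <= x + y'.
Proof.
pose p := FImp (FLe (TVar 2) (TVar 0)) (FLe (TPlus (TVar 1) (TVar 2)) (TPlus (TVar 1) (TVar 0))).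
apply: (@mind p (scons x (scons y r0)) s0) => [||z /= h /mle_Sr [<-|hyz]].
- by do !constructor.
- by move=> /= /mle0 ->; apply: mle_refl.
- exact: mle_refl.
- by rewrite modelB4; apply: mle_S; apply: h.
Qed.

Lemma madd_monol x x' y : x <= x' -> x + y <= x' + y.
Proof.
move=> hx; pose p := FLe (TPlus (TVar 1) (TVar 0)) (TPlus (TVar 2) (TVar 0)).
apply: (@mind p (scons x (scons x' r0)) s0) => [||z /= h].
- by do !constructor.
- by rewrite /= !modelB3.
- by rewrite !modelB4; apply: mleS2.
Qed.

Lemma madd_mono x x' y y' : x <= x' -> y <= y' -> x + y <= x' + y'.
Proof. by move=> h1 h2; apply: mle_trans (madd_monol _ h1) (madd_monor _ h2). Qed.

Lemma mmul_monor x y y' : y <= y' -> x * y <= x * y'.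
Proof.
pose p := FImp (FLe (TVar 2) (TVar 0)) (FLe (TTimes (TVar 1) (TVar 2)) (TTimes (TVar 1) (TVar 0))).
apply: (@mind p (scons x (scons y r0)) s0) => [||z /= h /mle_Sr [<-|hyz]].
- by do !constructor.
- by move=> /= /mle0 ->; apply: mle_refl.
- exact: mle_refl.
- by rewrite modelB6; apply: mle_trans (h hyz) (modelB8 _ _).
Qed.

Lemma mmul_monol x x' y : x <= x' -> x * y <= x' * y.
Proof.
move=> hx; pose p := FLe (TTimes (TVar 1) (TVar 0)) (TTimes (TVar 2) (TVar 0)).
apply: (@mind p (scons x (scons x' r0)) s0) => [||z /= h].
- by do !constructor.
- by rewrite /= !modelB5; exact: mle_refl.
- by rewrite !modelB6; apply: madd_mono.
Qed.

Lemma mmul_mono x x' y y' : x <= x' -> y <= y' -> x * y <= x' * y'.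
Proof. by move=> h1 h2; apply: mle_trans (mmul_monol _ h1) (mmul_monor _ h2). Qed.

Definition mpair x y := meval (scons x (scons y r0)) s0 (tpair (TVar 0) (TVar 1)).

Lemma mpair_mono x x' y y' : x <= x' -> y <= y' -> mpair x y <= mpair x' y'.
Proof.
move=> h1 h2; have h := madd_mono h1 h2; rewrite /mpair /=.
by apply: madd_mono; apply: mmul_mono => //; [apply: mleS2|apply: mle_refl].
Qed.

Fixpoint nm (n : nat) : num M := if n is k.+1 then nm k + 1 else 0.

Lemma meval_numeral r1 r2 n : @meval M r1 r2 (numeral n) = nm n.
Proof. by elim: n => //= n ->. Qed.
(** Nothing nonstandard lies below a numeral, so the residues and quotients that occur in MOD_m can
    be computed in [nat]. *)
Lemma nm_le n x : x <= nm n -> exists2 k, (k <= n)%N & x = nm k.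
Proof.
elim: n => [|n IH] /=; first by move/mle0; exists 0%N.
by move/mle_Sr => [->|/IH [k hk ->]]; [exists n.+1|exists k => //; apply: leqW].
Qed.
Lemma nm_inj a b : nm a = nm b -> a = b.
Proof.
elim: a b => [|a IH] [|b] //=.
- by move=> E; case: (@modelB1 (nm b)).
- by move=> /modelB1.
- by move=> /modelB2 /IH ->.
Qed.
Lemma nm_leq a b : (a <= b)%N -> nm a <= nm b.
Proof.
elim: b => [|b IH]; first by case: a => // _; exact: mle_refl.
by rewrite leq_eqVlt => /orP [/eqP ->|/IH h]; [exact: mle_refl|exact: mle_S].
Qed.
Lemma nm_lt n x : x < nm n <-> exists2 k, (k < n)%N & x = nm k.
Proof.
split=> [[/nm_le [k hk ->] n0]|[k hk ->]].
  by exists k => //; rewrite ltn_neqAle hk andbT; apply/eqP => E; apply: n0; rewrite E.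
by split; [apply: nm_leq; apply: ltnW|move=> /nm_inj E; rewrite E ltnn in hk].
Qed.
Lemma nm_add a b : nm a + nm b = nm (a + b)%N.
Proof. by elim: b => [|b IH]; rewrite ?addn0 ?modelB3 // addnS /= modelB4 IH. Qed.
Lemma nm_mul a b : nm a * nm b = nm (a * b)%N.
Proof. by elim: b => [|b IH]; rewrite ?muln0 ?modelB5 // mulnS /= modelB6 IH nm_add addnC. Qed.

Lemma mext (X Y : strg M) : (forall z, mmem X z <-> mmem Y z) -> X = Y.
Proof.
move=> h; apply: modelSE => //.
have aux (X' Y' : strg M) : (forall z, mmem X' z -> mmem Y' z) -> mlen X' <= mlen Y'.
  move=> h'; case: (pselect (mlen X' = 0)) => [->|/modelB12 [u Eu]]; first exact: modelB9.
  by rewrite -Eu; apply: mlt_le; apply: modelL1; apply: h'; apply: modelL2.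
by apply: modelB7; apply: aux => z /h.
Qed.

Definition MD (X Y : strg M) : Prop :=
  [/\ forall z, z <= mlen X -> exists y, [/\ y < nm m, mmem Y (mpair z y) &
        forall y', y' < nm m -> mmem Y (mpair z y') -> y' = y],
      mmem Y (mpair 0 0) &
      forall z, z < mlen X -> forall y, y < nm m -> mmem Y (mpair z y) ->
       (mmem X z -> exists r, r < nm m /\ exists q, [/\ q <= y + 1, y + 1 = q * nm m + r & mmem Y (mpair (z + 1) r)])
       /\ (~ mmem X z -> mmem Y (mpair (z + 1) y))].

Lemma msat_modmx r1 r2 X Y : @msat M r1 (scons Y (scons X r2)) (modmx m) <-> MD X Y.
Proof.
rewrite /modmx /MD /=; split.
  move=> [hA [hB hC]]; split => //.
  - move=> z /hA [y]; rewrite !meval_numeral !e1 => -[hy [h h']]; exists y; split=> // y'.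
    by move=> hy' h1; have := h' y'; rewrite meval_numeral !e1; apply.
  - move=> z hz y hy h; have := hC z; rewrite e1 => /(_ hz y); rewrite !meval_numeral !e1 => /(_ hy h) [a b].
    split => // /a [r]; rewrite !meval_numeral e1 => -[hr [q]]; rewrite e1 meval_numeral => -[hq [E hY]].
    by exists r; split => //; exists q.
move=> [hA hB hC]; split; last split => //.
- move=> z /hA [y [hy h h']]; exists y; rewrite !meval_numeral !e1; split=> //; split => // y'.
  by rewrite meval_numeral !e1; apply: h'.
- move=> z; rewrite e1 => hz y; rewrite !meval_numeral !e1 => hy h; have [a b] := hC z hz y hy h.
  split => // /a [r [hr [q [hq E hY]]]]; exists r; rewrite !meval_numeral e1; split => //.
  by exists q; rewrite e1 meval_numeral.
Qed.

Lemma msat_normf r1 r2 X Y : @msat M r1 (scons Y (scons X r2)) (normf m) <->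
  forall w, mmem Y w -> exists z y, [/\ z <= mlen X, y < nm m & w = mpair z y].
Proof.
rewrite /normf /=; split=> h w.
  move=> hw; have := h w; rewrite e1 => /(_ (modelL1 hw) hw) [z [hz [y]]]; rewrite meval_numeral !e1.
  by move=> [hy E]; exists z, y.
move=> _ /h [z [y [hz hy E]]]; exists z; split => //; exists y; rewrite meval_numeral !e1.
by split.
Qed.

(** Induction on the row z, where a formula comparing the two rows is Sigma^B_0. Row 0 is fixed by
    the bit (0,0); the next row is determined because y + 1 and its quotient and remainder by m are
    numerals, where division is unique. *)
Lemma MD_unique X Y Y' : MD X Y -> MD X Y' ->
  forall z y, z <= mlen X -> y < nm m -> (mmem Y (mpair z y) <-> mmem Y' (mpair z y)).
Proof.
move=> [hA hB hC] [hA' hB' hC'] z y hz hy.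
pose p := FImp (FLe (TVar 0) (TLen 2)) (FAll1 (FImp (flt (TVar 0) (numeral m))
   (fiff (FIn (tpair (TVar 1) (TVar 0)) 0) (FIn (tpair (TVar 1) (TVar 0)) 1)))).
pose P z := z <= mlen X -> forall y, y < nm m -> (mmem Y (mpair z y) <-> mmem Y' (mpair z y)).
pose s2 := scons Y (scons Y' (scons X s0)).
have hp z' : @msat M (scons z' r0) s2 p <-> P z'.
  rewrite /p /P /=; split=> h hz' y' hy'.
    by have := h hz' y'; rewrite meval_numeral !e1 => /(_ hy'); tauto.
  by move: hy'; rewrite meval_numeral e1 => hy'; have [a b] := h hz' y' hy'; split; [exact: a|exact: b].
suff H : forall a, @msat M (scons a r0) s2 p by apply: (proj1 (hp z) (H z)).
apply: mind.
- apply: sB0_imp; first by constructor.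
  by apply: sB0_allnum; do !constructor.
- apply/hp => _ y' hy'; have [y0 [h1 h2 h3]] := hA 0 (modelB9 _); have [y1 [g1 g2 g3]] := hA' 0 (modelB9 _).
  have z0 : 0 < nm m by apply/nm_lt; exists 0%N.
  have E0 := h3 _ z0 hB; have E1 := g3 _ z0 hB'.
  by split=> h; [have -> := h3 _ hy' h; rewrite -E0|have -> := g3 _ hy' h; rewrite -E1].
- move=> a /hp IH; apply/hp => ha y' hy'.
  have [la na] := mle_pred ha; have {}IH := IH la.
  have [y0 [h1 h2 _]] := hA a la; have h2' := proj1 (IH y0 h1) h2.
  suff [r [hr a1 a2]] : exists r, [/\ r < nm m, mmem Y (mpair (a + 1) r) & mmem Y' (mpair (a + 1) r)].
    have [y1 [_ _ u]] := hA _ ha; have [y2 [_ _ u']] := hA' _ ha.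
    split=> h; first by rewrite (u _ hy' h) -(u _ hr a1).
    by rewrite (u' _ hy' h) -(u' _ hr a2).
  have [b1 b2] := hC a (conj la na) y0 h1 h2; have [c1 c2] := hC' a (conj la na) y0 h1 h2'.
  case: (pselect (mmem X a)) => hX; last by exists y0; split; [|exact: b2|exact: c2].
  have [r [hr [q [hq E hY]]]] := b1 hX; have [r' [hr' [q' [hq' E' hY']]]] := c1 hX.
  exists r; split => //; suff -> : r = r' by [].
  have /nm_lt [y0n _ Ey0] := h1; rewrite Ey0 in hq E hq' E'.
  have [qn _ Eq] := nm_le (n := y0n.+1) hq; have [qn' _ Eq'] := nm_le (n := y0n.+1) hq'.
  have /nm_lt [rn hrn Er] := hr; have /nm_lt [rn' hrn' Er'] := hr'.
  move: E E'; rewrite Eq Eq' Er Er' !nm_mul !nm_add -[nm y0n + 1]/(nm y0n.+1) => /nm_inj F /nm_inj F'.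
  congr nm; have -> : rn = y0n.+1 %% m by rewrite F modnMDl modn_small.
  by rewrite F' modnMDl modn_small.
Qed.

Lemma modstep_ex X r1 r2 : exists Y, mlen Y <= @meval M r1 (scons X r2) (modstep m).1 /\
  msat r1 (scons Y (scons X r2)) (modstep m).2.
Proof.
have [Y0 hY0] : exists Y, @msat M r1 (scons Y (scons X r2)) (modmx m).
  have hV : V0m m (MODax m) by right.
  exact: (mM hV r1 r2 X).
have [hA hB hC] := proj1 (msat_modmx _ _ _ _) hY0.
(* The string given by the axiom may carry junk; comprehension with q keeps only the bits at
   relevant pairs. *)
pose q := FAnd (FIn (TVar 0) 0) (FEx1 (FAnd (FLe (TVar 0) (TLen 1)) (FEx1 (FAnd (flt (TVar 0) (numeral m))
       (FEq1 (TVar 2) (tpair (TVar 1) (TVar 0))))))).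
have sq : sigB0 q.
  apply: sB0_and; first by constructor.
  by apply: (@sB0_exle (TLen 1)); apply: sB0_exnum; constructor.
set B := @meval M r1 (scons X r2) (modstep m).1.
have EB : B = mpair (mlen X) (nm m) + 1 by rewrite -(meval_numeral r1 (scons X r2)).
have [Y [lY hY]] := mcomp r1 (scons Y0 (scons X r2)) B sq.
have hq w : @msat M (scons w r1) (scons Y0 (scons X r2)) q <->
   mmem Y0 w /\ exists z y, [/\ z <= mlen X, y < nm m & w = mpair z y].
  rewrite /q /=; split=> -[h p]; split=> //; move: p.
    by move=> [z [hz [y]]]; rewrite meval_numeral !e1 => -[hy E]; exists z, y.
  by move=> [z [y [hz hy E]]]; exists z; split => //; exists y; rewrite meval_numeral !e1.
have YE z y : z <= mlen X -> y < nm m -> (mmem Y (mpair z y) <-> mmem Y0 (mpair z y)).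
  move=> hz hy; rewrite hY ?hq.
    by split=> [[]|h] //; split => //; exists z, y.
  rewrite EB; apply/modelB11; apply: mpair_mono => //; by case: hy.
have zS z : z < mlen X -> z + 1 <= mlen X by apply: mlt_le.
exists Y; split => //; split.
  apply/msat_normf => w hw.
  have wB : w < B by apply: mlt_le_trans (modelL1 hw) lY.
  by have /(hY _ wB) /hq [_] := hw.
apply/msat_modmx; split.
- move=> z hz; have [y [hy h h']] := hA z hz; exists y; split => //; first exact/YE.
  by move=> y' hy' /(YE _ _ hz hy'); apply: h'.
- by apply/YE => //; [apply: modelB9|apply/nm_lt; exists 0%N].
- move=> z hz y hy /(YE _ _ (proj1 hz) hy) h; have [a b] := hC z hz y hy h; split.
    move=> /a [r [hr [q' [h1 h2 h3]]]]; exists r; split => //; exists q'; split => //.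
    by apply/YE => //; apply: zS.
  by move=> /b h3; apply/YE => //; apply: zS.
Qed.

Lemma modstep_unique X r1 r2 Y Y' : @msat M r1 (scons Y (scons X r2)) (modstep m).2 ->
  @msat M r1 (scons Y' (scons X r2)) (modstep m).2 -> Y = Y'.
Proof.
move=> [/msat_normf n1 /msat_modmx h1] [/msat_normf n2 /msat_modmx h2].
apply: mext => w; split=> hw.
  by have [z [y [hz hy E]]] := n1 w hw; subst w; apply/(MD_unique h1 h2 hz hy).
by have [z [y [hz hy E]]] := n2 w hw; subst w; apply/(MD_unique h1 h2 hz hy).
Qed.

Lemma msat_compstep t p r1 r2 X : @msat M r1 (scons X r2) (compstep t p).2 <->
  forall z, z < meval r1 r2 t -> (mmem X z <-> msat (scons z r1) r2 p).
Proof.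
have E z : @msat M (scons z r1) (scons X r2) (fsubst TVar S p) = msat (scons z r1) r2 p.
  by rewrite msat_subst.
rewrite /compstep /=; split=> h z; have := h z; rewrite E meval_shift1 meval_shift2 e1 /mlt; tauto.
Qed.

Lemma compstep_ex t p r1 r2 : sigB0 p -> exists X, mlen X <= @meval M r1 r2 t /\
  msat r1 (scons X r2) (compstep t p).2.
Proof.
move=> hp; have [X [h1 h2]] := mcomp r1 r2 (meval r1 r2 t) hp.
by exists X; split => //; apply/msat_compstep.
Qed.

Lemma compstep_unique t p r1 r2 X X' :
  mlen X <= @meval M r1 r2 t -> msat r1 (scons X r2) (compstep t p).2 ->
  mlen X' <= @meval M r1 r2 t -> msat r1 (scons X' r2) (compstep t p).2 -> X = X'.
Proof.
move=> l1 /msat_compstep h1 l2 /msat_compstep h2; apply: mext => z; split=> hz.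
  have hzt := mlt_le_trans (modelL1 hz) l1; by apply/h2 => //; apply/h1.
have hzt := mlt_le_trans (modelL1 hz) l2; by apply/h1 => //; apply/h2.
Qed.

Lemma mempty_ex : exists e : strg M, mlen e = 0 /\ forall z, ~ mmem e z.
Proof.
have [X [/mle0 h _]] := mcomp r0 s0 0 sB0_bot; exists X; split => // z /modelL1.
by rewrite h => -[/mle0].
Qed.

Lemma mlen0_empty (X e : strg M) : mlen X = 0 -> mlen e = 0 -> X = e.
Proof.
by move=> h h'; apply: mext => z; split=> /modelL1; rewrite ?h ?h' => -[/mle0].
Qed.

End Model.

(** * Straight-line programs *)

Definition prog := seq (term * form).

Definition stepsat (M : struc) (r1 : nat -> num M) r2 (s : term * form) (W : strg M) : Prop :=
  mle (mlen W) (meval r1 r2 s.1) /\ msat r1 (scons W r2) s.2.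

Fixpoint exec (M : struc) (r1 : nat -> num M) (r2 : nat -> strg M) (P : prog) (ws : seq (strg M)) : Prop :=
  match P, ws with
  | [::], [::] => True
  | s :: P', W :: ws' => stepsat r1 r2 s W /\ exec r1 (scons W r2) P' ws'
  | _, _ => False
  end.

(** The environment after a run: ws is in order of computation, so the last string gets index 0 and
    the inputs move up by the length of ws. *)
Definition ext (A : Type) (r2 : nat -> A) (ws : seq A) : nat -> A :=
  foldl (fun r W => scons W r) r2 ws.

Definition gstep (m : nat) (s : term * form) : Prop :=
  sigB0 s.2 /\ forall M, strict M -> models M (V0m m) -> forall r1 r2,
    (exists W, @stepsat M r1 r2 s W) /\ (forall W W', @stepsat M r1 r2 s W -> stepsat r1 r2 s W' -> W = W').

Fixpoint gprog (m : nat) (P : prog) : Prop :=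
  if P is s :: P' then gstep m s /\ gprog m P' else True.

Lemma gprog_cat m P Q : gprog m P -> gprog m Q -> gprog m (P ++ Q).
Proof. by elim: P => //= s P IH [a b] c; split => //; apply: IH. Qed.

Lemma ext_addn (A : Type) (r2 : nat -> A) ws i : ext r2 ws (size ws + i) = r2 i.
Proof. by elim: ws r2 i => //= W ws IH r2 i; rewrite addSnnS -/(ext _ _) IH. Qed.

Lemma ext_cat (A : Type) (r2 : nat -> A) ws vs : ext r2 (ws ++ vs) = ext (ext r2 ws) vs.
Proof. by rewrite /ext foldl_cat. Qed.

Lemma ext_head (A : Type) (r2 r2' : nat -> A) ws i : i < size ws -> ext r2 ws i = ext r2' ws i.
Proof.
elim/last_ind: ws r2 r2' i => // ws W IH r2 r2' i; rewrite size_rcons -cats1 !ext_cat /=.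
by case: i => //= i hi; apply: IH.
Qed.

Lemma exec_size M r1 r2 P ws : @exec M r1 r2 P ws -> size ws = size P.
Proof. by elim: P r2 ws => [|s P IH] r2 [|W ws] //= [_ /IH ->]. Qed.

Lemma exec_cat M r1 r2 P Q ws vs : size ws = size P ->
  @exec M r1 r2 (P ++ Q) (ws ++ vs) <-> exec r1 r2 P ws /\ exec r1 (ext r2 ws) Q vs.
Proof.
elim: P r2 ws => [|s P IH] r2 [|W ws] //=; first by split=> [|[]].
by move=> [E]; rewrite IH //; tauto.
Qed.

Lemma exec_catP M r1 r2 P Q us : @exec M r1 r2 (P ++ Q) us ->
  exists ws vs, [/\ us = ws ++ vs, exec r1 r2 P ws & exec r1 (ext r2 ws) Q vs].
Proof.
move=> h; have hs := exec_size h; exists (take (size P) us), (drop (size P) us).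
have E : size (take (size P) us) = size P.
  by rewrite size_take hs size_cat; case: ltnP; lia.
by move: h; rewrite -{1}(cat_take_drop (size P) us) (exec_cat _ _ _ _ E) cat_take_drop => -[].
Qed.

Section Gprog.
Variables (m : nat) (M : struc) (sM : strict M) (mM : models M (V0m m)).

Lemma gprog_ex P (r1 : nat -> num M) r2 : gprog m P -> exists ws, exec r1 r2 P ws.
Proof.
elim: P r2 => [|s P IH] r2 /=; first by exists [::].
move=> [[_ /(_ M sM mM r1 r2) [[W hW] _]] /(IH (scons W r2)) [ws h]].
by exists (W :: ws).
Qed.

Lemma gprog_unique P (r1 : nat -> num M) r2 ws ws' : gprog m P ->
  exec r1 r2 P ws -> exec r1 r2 P ws' -> ws = ws'.
Proof.
elim: P r2 ws ws' => [|s P IH] r2 [|W ws] [|W' ws'] //= [[_ g] gP] [h1 h2] [h1' h2'].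
have E := (g M sM mM r1 r2).2 W W' h1 h1'; subst W'.
by congr cons; apply: IH h2 h2'.
Qed.
End Gprog.

Lemma gstep_comp m t p : 0 < m -> sigB0 p -> gstep m (compstep t p).
Proof.
move=> hm hp; split.
  apply: sB0_alllt; have h := sigB0_fsubst TVar S hp.
  by apply: sB0_and; apply: sB0_imp => //; constructor.
move=> M sM mM r1 r2; split.
  exact: (compstep_ex sM mM).
move=> W W' [a b] [c d]; exact: (compstep_unique sM mM (r2 0) a b c d).
Qed.

Lemma gstep_mod m : 0 < m -> gstep m (modstep m).
Proof.
move=> hm; split.
  apply: sB0_and; last exact: sigB0_modmx.
  apply: (@sB0_alllt (TLen 0)); apply: sB0_imp; first by constructor.
  by apply: (@sB0_exle (TLen 1)); apply: sB0_exnum; constructor.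
move=> M sM mM r1 r2; rewrite -(scons_eta r2); split.
  exact: (modstep_ex hm sM mM (r2 0)).
move=> W W' [a b] [c d]; exact: (modstep_unique hm sM mM (r2 0) b d).
Qed.

(** All string quantifiers must precede the Sigma^B_0 part, so the conditions of the steps are
    collected in [acc] on the way down. The flag b tells whether each quantifier also carries its
    length bound, as Sigma^B_1 requires. The renamings f and s2 leave room for the output
    variable. *)
Fixpoint build (b : bool) (f : nat -> nat) (P : prog) (s2 : nat -> nat) (acc out : form) : form :=
  match P with
  | [::] => FAnd acc out
  | s :: P' =>
    let s1 := fun n => TVar (f n) in
    let le := FLe (TLen 0) (shift2t (tsubst s1 s2 s.1)) in
    let rest := build b f P' (up2 s2) (FAnd (shift2 acc) (FAnd le (fsubst s1 (up2 s2) s.2))) out in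
    FEx2 (if b then FAnd le rest else rest)
  end.

Lemma msat_build M b f P s2 acc out r1 r2 : @msat M r1 r2 (build b f P s2 acc out) <->
  msat r1 r2 acc /\ exists ws, exec (fun n => r1 (f n)) (fun j => r2 (s2 j)) P ws /\ msat r1 (ext r2 ws) out.
Proof.
elim: P s2 acc r2 => [|s P IH] s2 acc r2 /=.
  split=> [[a c]|[a [[|W ws] [//]]]] //.
  by split => //; exists [::].
pose le := FLe (TLen 0) (shift2t (tsubst (fun n => TVar (f n)) s2 s.1)).
pose v1 n := r1 (f n); pose v2 j := r2 (s2 j).
have El W : msat r1 (scons W r2) le = mle (mlen W) (meval v1 v2 s.1).
  by rewrite /le /= meval_shift2 meval_subst.
have Es W : (fun j => scons W r2 (up2 s2 j)) = scons W v2 by apply: funext => -[].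
have Ed W : msat r1 (scons W r2) (fsubst (fun n => TVar (f n)) (up2 s2) s.2) = msat v1 (scons W v2) s.2.
  by rewrite msat_subst Es.
have IH' W := IH (up2 s2) (FAnd (shift2 acc) (FAnd le (fsubst (fun n => TVar (f n)) (up2 s2) s.2))) (scons W r2).
have {}IH W : msat r1 (scons W r2) (build b f P (up2 s2) (FAnd (shift2 acc) (FAnd le (fsubst (fun n => TVar (f n)) (up2 s2) s.2))) out)
   <-> (msat r1 r2 acc /\ stepsat v1 v2 s W) /\ exists ws, exec v1 (scons W v2) P ws /\ msat r1 (ext (scons W r2) ws) out.
  rewrite IH' Es /stepsat -El -Ed /= msat_shift2; tauto.
split.
  move=> [W h]; have /IH [[ha hs] [ws [h1 h2]]] : msat r1 (scons W r2) (build b f P (up2 s2) (FAnd (shift2 acc) (FAnd le (fsubst (fun n => TVar (f n)) (up2 s2) s.2))) out).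
    by move: h; case: (b) => [[]|].
  by split => //; exists (W :: ws).
move=> [ha [[|W ws] [] //= [hs he] ho]]; exists W.
have hb : msat r1 (scons W r2) (build b f P (up2 s2) (FAnd (shift2 acc) (FAnd le (fsubst (fun n => TVar (f n)) (up2 s2) s.2))) out).
  by apply/IH; split => //; exists ws.
case: (b) hb => hb //; split => //.
by rewrite -/le El; case: hs.
Qed.

Lemma sigB1_build m f P s2 acc out : gprog m P -> sigB0 acc -> sigB0 out ->
  sigB1 (build true f P s2 acc out).
Proof.
elim: P s2 acc => [|s P IH] s2 acc /=; first by move=> _ ha ho; apply/sB1_base/sB0_and.
move=> [[gs _] gP] ha ho; apply: sB1_ex; apply: IH => //.
by do !apply: sB0_and; [apply: sigB0_fsubst|constructor|apply: sigB0_fsubst].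
Qed.

Lemma sig11_build m f P s2 acc out : gprog m P -> sigB0 acc -> sigB0 out ->
  sig11 (build false f P s2 acc out).
Proof.
elim: P s2 acc => [|s P IH] s2 acc /=; first by move=> _ ha ho; apply/s11_base/sB0_and.
move=> [[gs _] gP] ha ho; apply: s11_ex; apply: IH => //.
by do !apply: sB0_and; [apply: sigB0_fsubst|constructor|apply: sigB0_fsubst].
Qed.

(** * Removing junk variables *)

(** A formula over infinite environments may mention variables beyond the arity, which definability
    forbids. They are replaced by 0 and by the empty string; as the latter has no name, the atoms in
    which it would occur are rewritten. *)
Fixpoint ttr (n l : nat) (t : term) : term :=
  match t with
  | TVar i => if i < n then TVar i else TZero
  | TZero => TZero | TOne => TOne
  | TPlus a b => TPlus (ttr n l a) (ttr n l b)
  | TTimes a b => TTimes (ttr n l a) (ttr n l b)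
  | TLen X => if X < l then TLen X else TZero
  end.

Fixpoint ftr (n l : nat) (p : form) : form :=
  match p with
  | FBot => FBot
  | FLe t u => FLe (ttr n l t) (ttr n l u)
  | FEq1 t u => FEq1 (ttr n l t) (ttr n l u)
  | FIn t X => if X < l then FIn (ttr n l t) X else FBot
  | FEq2 X Y => if X < l then if Y < l then FEq2 X Y else FEq1 (TLen X) TZero
                else if Y < l then FEq1 (TLen Y) TZero else FEq1 TZero TZero
  | FImp a b => FImp (ftr n l a) (ftr n l b)
  | FAnd a b => FAnd (ftr n l a) (ftr n l b)
  | FOr a b => FOr (ftr n l a) (ftr n l b)
  | FAll1 a => FAll1 (ftr n.+1 l a)
  | FEx1 a => FEx1 (ftr n.+1 l a)
  | FAll2 a => FAll2 (ftr n l.+1 a)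
  | FEx2 a => FEx2 (ftr n l.+1 a)
  end.

Lemma ttr_bound n l t : tnb n (ttr n l t) /\ tsb l (ttr n l t).
Proof.
by elim: t => //= [i|t [a b] u [c d]|t [a b] u [c d]|X]; do ?split => //; case: ifP.
Qed.

Lemma ftr_bound n l p : fnb n (ftr n l p) /\ fsb l (ftr n l p).
Proof.
elim: p n l => //=.
- move=> t u n l; have [a b] := ttr_bound n l t; have [c d] := ttr_bound n l u; tauto.
- move=> t u n l; have [a b] := ttr_bound n l t; have [c d] := ttr_bound n l u; tauto.
- by move=> t X n l; have [a b] := ttr_bound n l t; case: ifP => //= ->.
- by move=> X Y n l; case: ifP => //= hX; case: ifP => //= hY; rewrite ?hX ?hY.
- move=> p IHp q IHq n l; have := IHp n l; have := IHq n l; tauto.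
- move=> p IHp q IHq n l; have := IHp n l; have := IHq n l; tauto.
- move=> p IHp q IHq n l; have := IHp n l; have := IHq n l; tauto.
Qed.

Lemma ttr_shift1 n l t : ttr n.+1 l (shift1t t) = shift1t (ttr n l t).
Proof.
rewrite /shift1t; elim: t => //= [i|t -> u ->|t -> u ->|X] //.
  by rewrite ltnS; case: ifP.
by case: ifP.
Qed.
Lemma ttr_shift2 n l t : ttr n l.+1 (shift2t t) = shift2t (ttr n l t).
Proof.
rewrite /shift2t; elim: t => //= [i|t -> u ->|t -> u ->|X] //.
  by case: ifP.
by rewrite ltnS; case: ifP.
Qed.

Lemma sigB0_ftr n l p : sigB0 p -> sigB0 (ftr n l p).
Proof.
move=> h; elim: h n l => {p} /=; try by intros; constructor.
- by move=> t X n l; case: ifP => _; constructor.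
- by move=> X Y n l; case: ifP => _; case: ifP => _; constructor.
- by move=> t p _ hp n l; rewrite ttr_shift1; apply: sB0_exle.
- by move=> t p _ hp n l; rewrite ttr_shift1; apply: sB0_exlt.
- by move=> t p _ hp n l; rewrite ttr_shift1; apply: sB0_allle.
- by move=> t p _ hp n l; rewrite ttr_shift1; apply: sB0_alllt.
Qed.

Lemma sigB1_ftr n l p : sigB1 p -> sigB1 (ftr n l p).
Proof.
move=> h; elim: h n l => {p} [p hp n l|t p _ hp n l]; first by apply/sB1_base/sigB0_ftr.
by rewrite /= ttr_shift2; apply: sB1_ex.
Qed.

Lemma sig11_ftr n l p : sig11 p -> sig11 (ftr n l p).
Proof.
move=> h; elim: h n l => {p} [p hp n l|p _ hp n l]; first by apply/s11_base/sigB0_ftr.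
exact: s11_ex.
Qed.

Definition cutn (A : Type) (n : nat) (z : A) (r : nat -> A) : nat -> A :=
  fun i => if i < n then r i else z.

Lemma cutn_scons (A : Type) n (z x : A) r : cutn n.+1 z (scons x r) = scons x (cutn n z r).
Proof. by apply: funext => -[|i]. Qed.

(** Since e is the only string of length 0, the rewritten atoms that compare a length with 0 express
    equality with e. *)
Lemma msat_ftr M (sM : strict M) (e : strg M) : mlen e = m0 M -> (forall z, ~ mmem e z) ->
  (forall X : strg M, mlen X = m0 M -> X = e) ->
  forall p n l r1 r2, msat r1 r2 (ftr n l p) <-> msat (cutn n (m0 M) r1) (cutn l e r2) p.
Proof.
move=> e0 eN eU.
have ev t n l r1 r2 : @meval M r1 r2 (ttr n l t) = meval (cutn n (m0 M) r1) (cutn l e r2) t.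
  by elim: t => //= [i|t -> u ->|t -> u ->|X] //; rewrite /cutn; case: ifP => //=.
have [sq1 sq2] := sM.
elim=> //=.
- by move=> t u n l r1 r2; rewrite !ev.
- by move=> t u n l r1 r2; rewrite !ev.
- move=> t X n l r1 r2; rewrite [cutn l e r2 X]/cutn; case: ifP => _ /=; rewrite ?ev //.
  by split=> // h; case: (eN _ h).
- move=> X Y n l r1 r2; rewrite /cutn; case: ifP => _; case: ifP => _ //=; rewrite !sq1 ?sq2 //.
  + by split=> [/eU|->].
  + by split=> [/eU|<-].
- by move=> p IHp q IHq n l r1 r2; rewrite IHp IHq.
- by move=> p IHp q IHq n l r1 r2; rewrite IHp IHq.
- by move=> p IHp q IHq n l r1 r2; rewrite IHp IHq.
- by move=> p IH n l r1 r2; split=> h x; have := h x; rewrite IH cutn_scons.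
- by move=> p IH n l r1 r2; split=> -[x h]; exists x; move: h; rewrite IH cutn_scons.
- by move=> p IH n l r1 r2; split=> h x; have := h x; rewrite IH cutn_scons.
- by move=> p IH n l r1 r2; split=> -[x h]; exists x; move: h; rewrite IH cutn_scons.
Qed.

Lemma tb_ren n n' l l' f s2 t : tnb n t -> tsb l t -> (forall i, i < n -> f i < n') ->
  (forall i, i < l -> s2 i < l') ->
  tnb n' (tsubst (fun i => TVar (f i)) s2 t) /\ tsb l' (tsubst (fun i => TVar (f i)) s2 t).
Proof.
move=> + + hf hs; elim: t => //=.
- by move=> i /hf.
- by move=> t IHt u IHu [a b] [c d]; have := IHt a c; have := IHu b d; tauto.
- by move=> t IHt u IHu [a b] [c d]; have := IHt a c; have := IHu b d; tauto.
- by move=> X _ /hs.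
Qed.

Lemma fb_ren n n' l l' f s2 p : fnb n p -> fsb l p -> (forall i, i < n -> f i < n') ->
  (forall i, i < l -> s2 i < l') ->
  fnb n' (fsubst (fun i => TVar (f i)) s2 p) /\ fsb l' (fsubst (fun i => TVar (f i)) s2 p).
Proof.
have up1E (g : nat -> nat) : up1 (fun i => TVar (g i)) = fun i => TVar (upr g i).
  by apply: funext => -[].
have upb (g : nat -> nat) a b : (forall i, i < a -> g i < b) -> forall i, i < a.+1 -> upr g i < b.+1.
  by move=> h [|i] //= /h.
have up2b (g : nat -> nat) a b : (forall i, i < a -> g i < b) -> forall i, i < a.+1 -> up2 g i < b.+1.
  by move=> h [|i] //= /h.
elim: p n n' l l' f s2 => //=.
- move=> t u n n' l l' f s2 [a b] [c d] hf hs.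
  by have := tb_ren a c hf hs; have := tb_ren b d hf hs; tauto.
- move=> t u n n' l l' f s2 [a b] [c d] hf hs.
  by have := tb_ren a c hf hs; have := tb_ren b d hf hs; tauto.
- move=> t X n n' l l' f s2 a [c d] hf hs.
  by have := tb_ren a c hf hs; have := hs _ d; tauto.
- by move=> X Y n n' l l' f s2 _ [/[swap] h1 h2] hf hs; rewrite !hs.
- move=> p IHp q IHq n n' l l' f s2 [a b] [c d] hf hs.
  by have := IHp _ _ _ _ _ _ a c hf hs; have := IHq _ _ _ _ _ _ b d hf hs; tauto.
- move=> p IHp q IHq n n' l l' f s2 [a b] [c d] hf hs.
  by have := IHp _ _ _ _ _ _ a c hf hs; have := IHq _ _ _ _ _ _ b d hf hs; tauto.
- move=> p IHp q IHq n n' l l' f s2 [a b] [c d] hf hs.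
  by have := IHp _ _ _ _ _ _ a c hf hs; have := IHq _ _ _ _ _ _ b d hf hs; tauto.
- by move=> p IH n n' l l' f s2 a b hf hs; rewrite up1E; apply: IH a b _ hs; apply: upb.
- by move=> p IH n n' l l' f s2 a b hf hs; rewrite up1E; apply: IH a b _ hs; apply: upb.
- by move=> p IH n n' l l' f s2 a b hf hs; apply: IH a b hf _; apply: up2b.
- by move=> p IH n n' l l' f s2 a b hf hs; apply: IH a b hf _; apply: up2b.
Qed.

Lemma closed_modax d : Defs.closed (MODax d).
Proof.
have h n l : tnb n (numeral d) /\ tsb l (numeral d) by elim: d => //= d; tauto.
by split; rewrite /= ?addn0; do !split => //; apply: (proj1 (h _ 0)) || apply: (proj2 (h 0 _)).
Qed.

Lemma closed_V0m m q : V0m m q -> Defs.closed q.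
Proof.
move=> [[|[p [n [l [_ [_ //]]]]]]|->]; last exact: closed_modax.
rewrite /basic_ax /=.
by move=> [<-|[<-|[<-|[<-|[<-|[<-|[<-|[<-|[<-|[<-|[<-|[<-|[<-|[<-|[<-|//]]]]]]]]]]]]]]]; split; do !split.
Qed.

(** * Functions computed by programs are definable *)

Section Definable.
Variables (m : nat) (hm : 0 < m) (k l : nat) (P : prog) (gP : gprog m P) (P0 : 0 < size P).

Definition taut := FEq1 TZero TZero.
(** The value Y is string variable 0, so the inputs are renamed by [S]; under the quantifiers of the
    program Y has index [size P], and the last computed string has index 0. *)
Definition strform b := ftr k l.+1 (build b id P S taut (FEq2 0 (size P))).
Definition numform b := ftr k.+1 l (build b S P id taut (FEq1 (TVar 0) (TLen 0))).

Lemma msat_strform M (sM : strict M) (mM : models M (V0m m)) e :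
  mlen e = m0 M -> (forall z, ~ mmem e z) -> forall b r1 r2 Y,
  msat r1 (scons Y r2) (strform b) <->
    exists ws, exec (cutn k (m0 M) r1) (cutn l e r2) P ws /\ Y = ext r2 ws 0.
Proof.
move=> e0 eN b r1 r2 Y; have [sq1 sq2] := sM.
rewrite /strform (msat_ftr sM e0 eN); last by move=> X hX; exact: (mlen0_empty sM mM e hX e0).
rewrite msat_build cutn_scons /= sq1; split=> [[_ [ws [h]]]|[ws [h E]]].
  have hs := exec_size h; rewrite sq2 -[size P]addn0 -hs ext_addn /= => E; exists ws; split => //.
  by rewrite -E; apply: ext_head; rewrite hs.
split => //; exists ws; split => //; have hs := exec_size h.
by rewrite sq2 -[size P]addn0 -hs ext_addn /= E; apply: ext_head; rewrite hs.
Qed.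

Lemma msat_numform M (sM : strict M) (mM : models M (V0m m)) e :
  mlen e = m0 M -> (forall z, ~ mmem e z) -> forall b r1 r2 y,
  msat (scons y r1) r2 (numform b) <->
    exists ws, exec (cutn k (m0 M) r1) (cutn l e r2) P ws /\ y = mlen (ext r2 ws 0).
Proof.
move=> e0 eN b r1 r2 Y; have [sq1 sq2] := sM.
rewrite /numform (msat_ftr sM e0 eN); last by move=> X hX; exact: (mlen0_empty sM mM e hX e0).
rewrite msat_build cutn_scons /= sq1; split=> [[_ [ws [h]]]|[ws [h E]]].
  have hs := exec_size h; rewrite sq1 => E; exists ws; split => //.
  by rewrite E; congr mlen; apply: ext_head; rewrite hs.
split => //; exists ws; split => //; have hs := exec_size h.
by rewrite sq1 E; congr mlen; apply: ext_head; rewrite hs.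
Qed.

Lemma cut_num xs : size xs = k -> cutn k 0 (num_env xs) = num_env xs.
Proof.
move=> h; apply: funext => i; rewrite /cutn; case: ltnP => // hi.
by rewrite /num_env nth_default // h.
Qed.
Lemma cut_str Xs : size Xs = l -> cutn l sempty (str_env Xs) = str_env Xs.
Proof.
move=> h; apply: funext => i; rewrite /cutn; case: ltnP => // hi.
by rewrite /str_env nth_default // h.
Qed.

Lemma std_exec_unique r1 r2 ws ws' : @exec stdM r1 r2 P ws -> exec r1 r2 P ws' -> ws = ws'.
Proof. exact: gprog_unique stdM_strict (std_V0m hm) P r1 r2 ws ws' gP. Qed.

Lemma prog_strfun (cls : form -> Prop) b F : cls (strform b) ->
  (forall xs Xs ws, size xs = k -> size Xs = l -> @exec stdM (num_env xs) (str_env Xs) P ws ->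
     F xs Xs = ext (str_env Xs) ws 0) ->
  def_strfun cls (V0m m) k l F.
Proof.
move=> hc hF; have [b1 b2] := ftr_bound k l.+1 (build b id P S taut (FEq2 0 (size P))).
exists (strform b); split => //; split => //; split => //; split.
  move=> xs Xs Y hx hX; rewrite -msat_std.
  rewrite (msat_strform stdM_strict (std_V0m hm) (e := sempty)) //; last by move=> z /=; rewrite smem_sempty.
  rewrite /= cut_num // cut_str //.
  have [ws hws] := gprog_ex stdM_strict (std_V0m hm) (num_env xs) (str_env Xs) gP.
  split=> [->|[vs [/(std_exec_unique hws) <- ->]]]; last by rewrite (hF _ _ ws).
  by exists ws; rewrite (hF _ _ ws).
apply: completeness; first exact: closed_V0m.
  apply: closed_close => /=; first by split => //; split=> //; have [] := @fb_ren k k l.+1 l.+2 id (scons 0 (fun j => j.+2)) _ b1 b2 (fun i h => h) (fun i => if i is j.+1 then fun h => h else fun h => h).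
  split => //; split; last by [].
  by have [] := @fb_ren k k l.+1 l.+2 id (scons 0 (fun j => j.+2)) _ b1 b2 (fun i h => h) (fun i => if i is j.+1 then fun h => h else fun h => h).
move=> M sM mM; apply/msat_close => r1 r2.
have [e [e0 eN]] := mempty_ex sM mM (r2 0).
have hE := msat_strform sM mM e0 eN b.
have [ws hws] := gprog_ex sM mM (cutn k (m0 M) r1) (cutn l e r2) gP.
exists (ext r2 ws 0); split; first by apply/hE; exists ws.
move=> Y; rewrite /= msat_subst.
have -> : (fun n => meval r1 (scons Y (scons (ext r2 ws 0) r2)) (TVar n)) = r1 by [].
have -> : (fun n => scons Y (scons (ext r2 ws 0) r2) (scons 0 (fun j => j.+2) n)) = scons Y r2.
  by apply: funext => -[].
move=> /hE [vs [/(gprog_unique sM mM gP hws) <- ->]].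
by case: sM => _ ->.
Qed.

Lemma prog_numfun (cls : form -> Prop) b f : cls (numform b) ->
  (forall xs Xs ws, size xs = k -> size Xs = l -> @exec stdM (num_env xs) (str_env Xs) P ws ->
     f xs Xs = slen (ext (str_env Xs) ws 0)) ->
  def_numfun cls (V0m m) k l f.
Proof.
move=> hc hF; have [b1 b2] := ftr_bound k.+1 l (build b S P id taut (FEq1 (TVar 0) (TLen 0))).
exists (numform b); split => //; split => //; split => //; split.
  move=> xs Xs Y hx hX; rewrite -msat_std.
  rewrite (msat_numform stdM_strict (std_V0m hm) (e := sempty)) //; last by move=> z /=; rewrite smem_sempty.
  rewrite /= cut_num // cut_str //.
  have [ws hws] := gprog_ex stdM_strict (std_V0m hm) (num_env xs) (str_env Xs) gP.
  split=> [->|[vs [/(std_exec_unique hws) <- ->]]]; last by rewrite (hF _ _ ws).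
  by exists ws; rewrite (hF _ _ ws).
have sE : scons (TVar 0) (fun i => TVar i.+2) = fun i => TVar (if i is j.+1 then j.+2 else 0).
  by apply: funext => -[].
have hr := @fb_ren k.+1 k.+2 l l (fun i => if i is j.+1 then j.+2 else 0) id _ b1 b2 (fun i => if i is j.+1 then fun h => h else fun h => h) (fun i h => h).
apply: completeness; first exact: closed_V0m.
  by apply: closed_close => /=; rewrite sE; case: hr.
move=> M sM mM; apply/msat_close => r1 r2.
have [e [e0 eN]] := mempty_ex sM mM (r2 0).
have hE := msat_numform sM mM e0 eN b.
have [ws hws] := gprog_ex sM mM (cutn k (m0 M) r1) (cutn l e r2) gP.
exists (mlen (ext r2 ws 0)); split; first by apply/hE; exists ws.
move=> Y; rewrite /= msat_subst.
have -> : (fun n => meval (scons Y (scons (mlen (ext r2 ws 0)) r1)) r2 (scons (TVar 0) (fun i => TVar i.+2) n)) = scons Y r1.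
  by apply: funext => -[].
move=> /hE [vs [/(gprog_unique sM mM gP hws) <- ->]].
by case: sM => ->.
Qed.
End Definable.

(** * Compiling counting formulas to programs *)

Definition app (ys : seq nat) (r1 : nat -> nat) : nat -> nat := foldr (@scons nat) r1 ys.

Lemma app_nth ys r1 i : app ys r1 i = if i < size ys then nth 0 ys i else r1 (i - size ys).
Proof.
by elim: ys i => [|y ys IH] [|i] //=; rewrite IH ltnS.
Qed.

Lemma app_addn ys r1 : (fun i => app ys r1 (i + size ys)) = r1.
Proof. by apply: funext => i; rewrite app_nth ltnNge leq_addl /= addnK. Qed.

Lemma teval_mono r r' r2 t : (forall i, r i <= r' i) -> teval r r2 t <= teval r' r2 t.
Proof.
move=> h; elim: t => //= t ht u hu; [exact: leq_add|exact: leq_mul].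
Qed.

Lemma sat_subst r1 r2 s1 s2 p :
  sat r1 r2 (fsubst s1 s2 p) = sat (fun n => teval r1 r2 (s1 n)) (fun n => r2 (s2 n)) p.
Proof.
rewrite -!msat_std msat_subst; congr msat; by apply: funext => n; rewrite -meval_std.
Qed.

Fixpoint code (b : nat) (ys : seq nat) : nat := if ys is y :: ys' then y + b * code b ys' else 0.

Lemma code_lt b ys : all (fun y => y < b) ys -> code b ys < b ^ size ys.
Proof.
elim: ys => //= y ys IH /andP [h1 /IH h2]; rewrite expnS.
apply: (@leq_trans (b * (code b ys).+1)); first by rewrite mulnS; lia.
by rewrite leq_mul2l h2 orbT.
Qed.

Lemma code_inj b ys zs : size ys = size zs -> all (fun y => y < b) ys -> all (fun y => y < b) zs ->
  code b ys = code b zs -> ys = zs.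
Proof.
elim: ys zs => [|y ys IH] [|z zs] //= [hs] /andP [hy hys] /andP [hz hzs] E.
have b0 : 0 < b by lia.
have Ey : y = z.
  by have := f_equal (modn^~ b) E; rewrite /= !(addnC _ (b * _)) !(mulnC b) !modnMDl !modn_small.
subst z; congr cons; apply: IH => //; move: E => /addnI /eqP.
by rewrite eqn_pmul2l // => /eqP.
Qed.

Fixpoint codet (b : term) (i k : nat) : term :=
  if k is k'.+1 then TPlus (TVar i) (TTimes b (codet b i.+1 k')) else TZero.

Lemma codet_eval r1 r2 b i ys : (forall j, j < size ys -> r1 (i + j) = nth 0 ys j) ->
  teval r1 r2 (codet b i (size ys)) = code (teval r1 r2 b) ys.
Proof.
elim: ys i => //= y ys IH i h; rewrite IH; last by move=> j hj; rewrite addSnnS h.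
by have := h 0 isT; rewrite addn0 /= => ->.
Qed.

Fixpoint tpow (t : term) (k : nat) : term := if k is k'.+1 then TTimes t (tpow t k') else TOne.
Lemma tpow_eval r1 r2 t k : teval r1 r2 (tpow t k) = teval r1 r2 t ^ k.
Proof. by elim: k => //= k ->; rewrite expnS. Qed.

(** All k quantifiers share the bound t, which speaks of the outer variables only and is therefore
    moved past those bound before. *)
Fixpoint exs (k : nat) (t : term) (p : form) : form :=
  if k is k'.+1 then
    exs k' t (FEx1 (FAnd (FLe (TVar 0) (shift1t (tsubst (fun i => TVar (i + k')) id t))) p))
  else p.

Lemma sigB0_exs k t p : sigB0 p -> sigB0 (exs k t p).
Proof. by elim: k p => //= k IH p hp; apply: IH; apply: sB0_exle. Qed.

Lemma sat_exs k t p r1 r2 : sat r1 r2 (exs k t p) <->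
  exists us, [/\ size us = k, all (fun u => u <= teval r1 r2 t) us & sat (app us r1) r2 p].
Proof.
elim: k p => [|k IH] p /=.
  by split=> [h|[us [/size0nil -> _]] //]; exists [::].
have E us u : size us = k ->
    teval (scons u (app us r1)) r2 (shift1t (tsubst (fun i => TVar (i + k)) id t)) = teval r1 r2 t.
  by move=> <-; rewrite teval_shift1 teval_subst /= app_addn.
rewrite IH; split.
  move=> [us [hs ha [u [hu h]]]]; exists (u :: us); rewrite /= hs ha andbT; split => //.
  by move: hu; rewrite /= E.
move=> [[|u us] [//= [hs] /andP [hu ha] h]]; exists us; split => //; exists u; split => //.
by rewrite E.
Qed.

(** By uniqueness of the step it is enough that the table [modstr m X] satisfies its condition. *)
Lemma std_modstep m r1 r2 X Y : 0 < m ->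
  @stepsat stdM r1 (scons X r2) (modstep m) Y -> Y = modstr m X.
Proof.
move=> hm [_ h]; apply: (modstep_unique hm stdM_strict (std_V0m hm) X h); split.
  apply/(msat_normf stdM_strict (std_V0m hm) X) => w /=.
  rewrite smem_strof => /andP [_ /asboolP [z [hz [y [_ [hy [-> _]]]]]]].
  exists z, y; split => //; apply/(nm_lt stdM_strict (std_V0m hm) X); exists y => //.
  by elim: y {hy} => //= y <-; rewrite addn1.
by rewrite msat_std; apply: sat_modmx.
Qed.

(** Subtraction of residues written with addition only: V is the residue of C + K minus that of C,
    with at most one wrap-around by m. *)
Lemma mod_sub m C K V : 0 < m ->
  K %% m = V <-> V < m /\ (C %% m + V = (C + K) %% m \/ C %% m + V = (C + K) %% m + m).
Proof.
move=> hm; have c := ltn_pmod C hm; have k := ltn_pmod K hm.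
have -> : (C + K) %% m = (C %% m + K %% m) %% m by rewrite modnDm.
move: (C %% m) (K %% m) c k => c k hc hk.
have -> : (c + k) %% m = if c + k < m then c + k else c + k - m.
  case: ltnP => h; first by rewrite modn_small.
  by rewrite -{1}(subnK h) modnDr modn_small //; lia.
by case: (ltnP (c + k) m) => h; lia.
Qed.

Lemma count_shift (P : pred nat) a T : count P (iota 0 (a + T)) =
  count P (iota 0 a) + count (fun u => P (a + u)) (iota 0 T).
Proof.
rewrite iotaD count_cat add0n; congr (_ + _).
by rewrite -{1}[a]addn0 iotaDl count_map.
Qed.

Lemma smem_compstep r1 r2 t p X : @stepsat stdM r1 r2 (compstep t p) X ->
  forall z, z < teval r1 r2 t -> (smem X z <-> sat (scons z r1) r2 p).
Proof.
move=> [_ /(msat_compstep stdM_strict) h] z hz; rewrite -msat_std -(h z) //.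
by rewrite /mlt /= meval_std; split; lia.
Qed.

(** * Translation of each connective *)

Section Compile.
Variables (m : nat) (hm : 0 < m).

(** The n numbers ys are the variables bound by quantifiers around p. The program must not depend on
    them but only on a common bound B, because its strings are computed once for all their values;
    they enter again through psi. The renaming f2 accounts for strings computed earlier. *)
Definition compiles (p : gform) : Prop := forall n (B : term) (f2 : nat -> nat),
  exists P psi, [/\ gprog m P, sigB0 psi & forall r1 r2 ws, @exec stdM r1 r2 P ws ->
    forall ys, size ys = n -> all (fun y => y <= teval r1 (fun j => r2 (f2 j)) B) ys ->
    (gsat m (app ys r1) (fun j => r2 (f2 j)) p <-> sat (app ys r1) (ext r2 ws) psi)].

(** Terms are monotone, so putting B for the local variables bounds t uniformly without mentioning
    them. *)
Definition tbound (n : nat) (B t : term) : term := tsubst (fun i => if i < n then B else TVar (i - n)) id t.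

Lemma tboundP n B t r1 r2 ys : size ys = n -> all (fun y => y <= teval r1 r2 B) ys ->
  teval (app ys r1) r2 t <= teval r1 r2 (tbound n B t).
Proof.
move=> hs /allP ha; rewrite /tbound teval_subst; apply: teval_mono => i; rewrite app_nth hs.
by case: ltnP => //= h; apply: ha; apply: mem_nth; rewrite hs.
Qed.

Lemma teval_ren r1 r2 f2 t : teval r1 r2 (tsubst TVar f2 t) = teval r1 (fun j => r2 (f2 j)) t.
Proof. by rewrite teval_subst. Qed.

Lemma ext_sz (r2 : nat -> str) ws N (f2 : nat -> nat) : size ws = N ->
  (fun j => ext r2 ws (N + f2 j)) = (fun j => r2 (f2 j)).
Proof. by move=> <-; apply: funext => j; rewrite ext_addn. Qed.

Lemma compiles_imp p q : compiles p -> compiles q -> compiles (GImp p q).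
Proof.
move=> hp hq n B f2; have [P [f [gP sf hP]]] := hp n B f2.
(* Q runs after P, so its inputs are found behind the strings of P; conversely f must be moved past
   the strings of Q. *)
have [Q [g [gQ sg hQ]]] := hq n B (fun j => size P + f2 j) => {hp hq}.
exists (P ++ Q), (FImp (fsubst TVar (addn (size Q)) f) g); split.
- exact: gprog_cat.
- by apply: sB0_imp => //; apply: sigB0_fsubst.
move=> r1 r2 us /exec_catP [ws [vs [-> eP eQ]]] ys hs ha.
have sP := exec_size eP; have sQ := exec_size eQ.
have E := ext_sz r2 f2 sP.
have := hQ _ _ _ eQ ys hs; rewrite E => /(_ ha) hQ'.
rewrite /= ext_cat -hQ' sat_subst -sQ.
rewrite (_ : (fun n0 => ext (ext r2 ws) vs (size vs + n0)) = ext r2 ws); last first.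
  by apply: funext => j; rewrite ext_addn.
by rewrite -(hP _ _ _ eP ys hs ha); split=> /implyP.
Qed.

Lemma compiles_all t p : compiles p -> compiles (GAll t p).
Proof.
(* The quantified variable becomes one more local variable, and the sum bounds it together with the
   old ones. The quantifier itself costs no step, as it stays in psi. *)
move=> hp n B f2; have [P [f [gP sf hP]]] := hp n.+1 (TPlus B (tbound n B t)) f2.
exists P, (FAll1 (FImp (FLe (TVar 0) (shift1t (tsubst TVar (fun j => size P + f2 j) t))) f)); split => //.
  exact: sB0_allle.
move=> r1 r2 ws eP ys hs ha; have sP := exec_size eP.
have hb := tboundP t hs ha; have E := ext_sz r2 f2 sP.
have key x : x <= teval (app ys r1) (fun j => r2 (f2 j)) t ->
    gsat m (scons x (app ys r1)) (fun j => r2 (f2 j)) p <-> sat (scons x (app ys r1)) (ext r2 ws) f.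
  move=> hx; apply: (hP _ _ _ eP (x :: ys)); first by rewrite /= hs.
  rewrite /=; apply/andP; split; first by apply: leq_trans hx (leq_trans hb (leq_addl _ _)).
  by apply: sub_all ha => y hy; apply: leq_trans hy (leq_addr _ _).
rewrite /=; split.
  move=> /ballnP h x; rewrite teval_shift1 teval_ren E => hx.
  by apply/key => //; apply: h.
move=> h; apply/ballnP => x hx; apply/key => //; apply: h.
by rewrite /= teval_shift1 teval_ren E.
Qed.

(** Here c and d are the residues that the table in string 0 records at the two ends of a block; the
    last clause is the subtraction of [mod_sub]. *)
Lemma sat_modsub aT tT vT r s : sat r s
  (FEx1 (FAnd (flt (TVar 0) (numeral m)) (FEx1 (FAnd (flt (TVar 0) (numeral m))
   (FAnd (FIn (tpair (TPlus aT tT) (TVar 0)) 0) (FAnd (FIn (tpair aT (TVar 1)) 0)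
     (FAnd (flt vT (numeral m))
       (FOr (FEq1 (TPlus (TVar 1) vT) (TVar 0)) (FEq1 (TPlus (TVar 1) vT) (TPlus (TVar 0) (numeral m))))))))))) <->
  exists c, c < m /\ exists d, d < m /\
    (smem (s 0) (pairn (teval (scons d (scons c r)) s aT + teval (scons d (scons c r)) s tT) d) /\
     smem (s 0) (pairn (teval (scons d (scons c r)) s aT) c) /\
     teval (scons d (scons c r)) s vT < m /\
     (c + teval (scons d (scons c r)) s vT = d \/ c + teval (scons d (scons c r)) s vT = d + m)).
Proof.
split=> /=.
  move=> [c]; rewrite tnumeral => -[[h n] [d]]; rewrite !tnumeral => -[[h' n'] [h1 [h2 [[h3 n3] h4]]]].
  exists c; split; first by lia.
  by exists d; do !split => //; lia.
move=> [c [hc [d [hd [h1 [h2 [h3 h4]]]]]]]; exists c; rewrite tnumeral; split; first by split; lia.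
by exists d; rewrite !tnumeral; do !split => //; lia.
Qed.

(* Read the values of the local variables, all at most b, as the digits of a number
   in base b + 1, the innermost digit being the least significant one.  The string
   X of all codes of tuples satisfying p then consists of blocks of length b + 1, one
   for each value of ys, and the count in a block is a difference of two prefix counts.
   The extra bit at L makes |X| exceed all the positions that are queried. *)
Lemma compiles_cnt t v p : compiles p -> compiles (GCnt t v p).
Proof.
move=> hp n B f2; pose B' := TPlus B (tbound n B t).
have [P [f [gP sf hP]]] := hp n.+1 B' f2.
pose N := size P.
pose B1 := tsubst TVar (fun j => N + f2 j) B'.
pose bb := TPlus B1 TOne.
pose L := tpow bb n.+1.
pose shn k u := tsubst (fun i => TVar (i + k)) id u.
(* The quantifiers bind the n+1 digits and the position w stands behind them as variable n+1, so the
   outer variables of f are renamed to skip it. *)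
pose phi := exs n.+1 (shift1t B1)
   (FAnd (FEq1 (TVar n.+1) (codet (shn n.+2 bb) 0 n.+1))
         (fsubst (fun i => TVar (if i < n.+1 then i else i.+1)) id f)).
have sphi : sigB0 phi.
  by apply: sigB0_exs; apply: sB0_and; [constructor|apply: sigB0_fsubst].
pose X0 := compstep (TPlus L TOne) (FOr phi (FEq1 (TVar 0) (shift1t L))).
(* Two residues are bound in psi, and two strings, X and its table, have been added; hence the shift
   by two in both sorts. *)
pose up s u := tsubst (fun i => TVar (i + 2)) (fun j => j.+2) (tsubst TVar s u).
pose aT := up id (TTimes (shn n bb) (codet (shn n bb) 0 n)).
pose tT := up (fun j => N + f2 j) t.
pose vT := up (fun j => N + f2 j) v.
pose psi := FEx1 (FAnd (flt (TVar 0) (numeral m)) (FEx1 (FAnd (flt (TVar 0) (numeral m))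
   (FAnd (FIn (tpair (TPlus aT tT) (TVar 0)) 0) (FAnd (FIn (tpair aT (TVar 1)) 0)
     (FAnd (flt vT (numeral m))
       (FOr (FEq1 (TPlus (TVar 1) vT) (TVar 0)) (FEq1 (TPlus (TVar 1) vT) (TPlus (TVar 0) (numeral m)))))))))).
exists (P ++ [:: X0; modstep m]), psi; split.
- apply: gprog_cat => //; split; last by split => //; apply: gstep_mod.
  by apply: gstep_comp => //; apply: sB0_or => //; constructor.
- by do 2!apply: sB0_exnum; do !constructor.
move=> r1 r2 us /exec_catP [ws [vs [-> eP eQ]]] ys hs ha.
case: vs eQ => [|X [|Y [|Z vs]]] eQ; try by move: eQ => /=; tauto.
set s2 := ext r2 ws in eQ; have [eX [eY _]] := eQ.
move: (std_modstep hm eY) => {eQ eY} EY; subst Y.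
have sP := exec_size eP; have E := ext_sz r2 f2 sP.
pose b := teval r1 (fun j => r2 (f2 j)) B'.
have EB : teval r1 s2 B1 = b by rewrite /B1 teval_ren E.
have Ebb : teval r1 s2 bb = b + 1 by rewrite -[LHS]/(teval r1 s2 B1 + 1) EB.
have EL : teval r1 s2 L = (b + 1) ^ n.+1 by rewrite tpow_eval Ebb.
pose T := teval (app ys r1) (fun j => r2 (f2 j)) t.
pose V := teval (app ys r1) (fun j => r2 (f2 j)) v.
have hb : T <= teval r1 (fun j => r2 (f2 j)) (tbound n B t) := tboundP t hs ha.
have Tb : T <= b by apply: leq_trans hb (leq_addl _ _).
have yb : all (fun y => y <= b) ys by apply: sub_all ha => y hy; apply: leq_trans hy (leq_addr _ _).
have key u : u < T ->
    gsat m (scons u (app ys r1)) (fun j => r2 (f2 j)) p <-> sat (scons u (app ys r1)) s2 f.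
  move=> hu; apply: (hP _ _ _ eP (u :: ys)); first by rewrite /= hs.
  by rewrite /= -/B' -/b yb andbT; apply: ltnW; apply: leq_trans hu Tb.
have lt1 zs : all (fun y => y <= b) zs -> all (fun y => y < b + 1) zs.
  by apply: sub_all => y; rewrite addn1 ltnS.
have Eshn k zs (r : nat -> nat) : size zs = k -> teval (app zs r) s2 (shn k bb) = teval r s2 bb.
  by move=> <-; rewrite /shn teval_subst /= app_addn.
have Ecode zs (r : nat -> nat) c : size zs = c -> teval (app zs r) s2 (codet (shn c bb) 0 c) = code (teval r s2 bb) zs.
  move=> hz; rewrite -(Eshn c zs r hz) -hz; apply: codet_eval => j hj.
  by rewrite app_nth add0n hj.
have hphi w : sat (scons w r1) s2 phi <-> exists us, [/\ size us = n.+1, all (fun u => u <= b) us,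
     w = code (b + 1) us & sat (app us r1) s2 f].
  rewrite /phi sat_exs teval_shift1 EB.
  have body zs : size zs = n.+1 ->
     sat (app zs (scons w r1)) s2 (FAnd (FEq1 (TVar n.+1) (codet (shn n.+2 bb) 0 n.+1))
         (fsubst (fun i => TVar (if i < n.+1 then i else i.+1)) id f)) <->
     w = code (b + 1) zs /\ sat (app zs r1) s2 f.
    move=> hz.
    have h1 : app zs (scons w r1) n.+1 = w by rewrite app_nth hz ltnn subnn.
    have h2 : teval (app zs (scons w r1)) s2 (codet (shn n.+2 bb) 0 n.+1) = code (b + 1) zs.
      have <- : teval (app zs (scons w r1)) s2 (shn n.+2 bb) = b + 1.
        (* The position w is treated as one more local variable behind the digits. *)
        rewrite -Ebb -(Eshn n.+2 (rcons zs w) r1); last by rewrite size_rcons hz.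
        by rewrite /app foldr_rcons.
      by rewrite -hz; apply: codet_eval => j hj; rewrite app_nth add0n hj.
    have h3 : sat (app zs (scons w r1)) s2 (fsubst (fun i => TVar (if i < n.+1 then i else i.+1)) id f)
       = sat (app zs r1) s2 f.
      rewrite sat_subst; congr sat; apply: funext => i /=; rewrite !app_nth hz.
      case: (ltnP i n.+1) => hi; first by rewrite hi.
      by rewrite ltnNge (leqW hi) /= subSn.
    by rewrite -h3 -h2 -{2}h1.
  by split=> -[zs]; [move=> [hz hb' /(body zs hz) [? ?]]|move=> [hz hb' h1 h2]]; exists zs; split => //; apply/body.
pose a := (b + 1) * code (b + 1) ys.
have aT_lt : a + T <= (b + 1) ^ n.+1.
  have := code_lt (lt1 _ yb); rewrite hs expnS /a => h.
  apply: (@leq_trans ((b + 1) * (code (b + 1) ys).+1)); first by rewrite mulnS; lia.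
  by rewrite leq_mul2l h orbT.
have XL w : w <= (b + 1) ^ n.+1 -> (smem X w <-> sat (scons w r1) s2 phi \/ w = (b + 1) ^ n.+1).
  move=> hw; rewrite (smem_compstep eX); last by rewrite -[teval _ _ _]/(teval r1 s2 L + 1) EL addn1 ltnS.
  by rewrite -[sat _ _ _]/(sat (scons w r1) s2 phi \/ w = teval (scons w r1) s2 (shift1t L)) teval_shift1 EL.
have lX : (b + 1) ^ n.+1 < slen X by apply: smem_lt; apply/XL => //; right.
have Xu u : u < T -> smem X (a + u) = gsat m (scons u (app ys r1)) (fun j => r2 (f2 j)) p.
  move=> hu; have hw : a + u < (b + 1) ^ n.+1 by lia.
  have uyb : all (fun y => y <= b) (u :: ys) by rewrite /= yb andbT; lia.
  have Eu : a + u = code (b + 1) (u :: ys) by rewrite /= addnC.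
  apply/idP/idP => [/(XL _ (ltnW hw)) [/hphi [zs [hz hzb Ez hzf]]|]|h]; last 1 first.
  - apply/(XL _ (ltnW hw)); left; apply/hphi; exists (u :: ys); rewrite /= hs; split => //.
    by apply/key.
  - apply/key => //; suff E' : zs = u :: ys by move: hzf; rewrite E'.
    by apply: (@code_inj (b + 1)); rewrite ?hz /= ?hs //; [exact: lt1|exact: (lt1 _ uyb)|rewrite -Ez Eu].
  - by move=> E'; rewrite E' ltnn in hw.
pose s3 := scons (modstr m X) (scons X s2).
have Eup (g : nat -> nat) c d u : teval (scons d (scons c (app ys r1))) s3 (up g u) = teval (app ys r1) (fun j => s2 (g j)) u.
  rewrite /up !teval_subst /=; congr (teval _ _ u); apply: funext => i.
  by rewrite addn2.
have EaT c d : teval (scons d (scons c (app ys r1))) s3 aT = a.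
  rewrite Eup -[LHS]/(teval (app ys r1) s2 (shn n bb) * teval (app ys r1) s2 (codet (shn n bb) 0 n)).
  by rewrite Eshn // Ecode // Ebb.
have EtT c d : teval (scons d (scons c (app ys r1))) s3 tT = T by rewrite Eup E.
have EvT c d : teval (scons d (scons c (app ys r1))) s3 vT = V by rewrite Eup E.
have cX z c : z <= (b + 1) ^ n.+1 -> c < m ->
    (smem (modstr m X) (pairn z c) <-> count (smem X) (iota 0 z) %% m = c).
  by move=> hz hc; rewrite smem_modstr //; [split=> /eqP|lia].
pose K := count (fun u => gsat m (scons u (app ys r1)) (fun j => r2 (f2 j)) p) (iota 0 T).
have EK : count (smem X) (iota 0 (a + T)) = count (smem X) (iota 0 a) + K.
  rewrite count_shift; congr (_ + _); apply: eq_in_count => u.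
  by rewrite mem_iota add0n => /andP [_ /Xu].
have -> : gsat m (app ys r1) (fun j => r2 (f2 j)) (GCnt t v p) = (K %% m == V) by [].
rewrite ext_cat -/s2 -[ext s2 _]/s3 -(rwP eqP) (mod_sub (count (smem X) (iota 0 a)) K V hm) -EK.
set C := count (smem X) (iota 0 a); set D := count (smem X) (iota 0 (a + T)).
have ha' : a <= (b + 1) ^ n.+1 by lia.
rewrite /psi (sat_modsub aT tT vT); split.
  move=> [Vm h]; exists (C %% m); split; first exact: ltn_pmod.
  exists (D %% m); split; first exact: ltn_pmod.
  rewrite EtT EaT EvT; split; first by apply/cX => //; apply: ltn_pmod.
  by split; [apply/cX => //; apply: ltn_pmod|split].
move=> [c [hc [d [hd]]]]; rewrite EtT EaT EvT => -[h1 [h2 [hv h3]]].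
have {}h1 : D %% m = d by apply/cX.
have {}h2 : C %% m = c by apply/cX.
by rewrite h1 h2.
Qed.

Lemma compile_gform p : compiles p.
Proof.
elim: p => [|t u|t X|p hp q hq|t p hp|t v p hp].
- by move=> n B f2; exists [::], FBot; split => //; constructor.
- move=> n B f2; exists [::], (FLe (tsubst TVar f2 t) (tsubst TVar f2 u)); split => //.
    by constructor.
  by move=> r1 r2 [|//] _ ys _ _ /=; rewrite !teval_ren.
- move=> n B f2; exists [::], (FIn (tsubst TVar f2 t) (f2 X)); split => //.
    by constructor.
  by move=> r1 r2 [|//] _ ys _ _ /=; rewrite !teval_ren.
- exact: compiles_imp.
- exact: compiles_all.
- exact: compiles_cnt.
Qed.

Lemma compile_str F : sdef m F -> exists P, [/\ gprog m P, 0 < size P &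
  forall r1 r2 ws, @exec stdM r1 r2 P ws -> F r1 r2 = ext r2 ws 0].
Proof.
move=> [[bt hbt] [q hq]].
(* The bit position is the single local variable, bounded by the term that bounds the length of F;
   one further comprehension step collects the bits. *)
have [P [f [gP sf hP]]] := compile_gform q 1 bt id.
pose bt' := tsubst TVar (addn (size P)) bt.
exists (P ++ [:: compstep bt' f]); split.
- by apply: gprog_cat => //; split => //; apply: gstep_comp.
- by rewrite size_cat addn1.
move=> r1 r2 us /exec_catP [ws [vs [-> eP eQ]]]; rewrite ext_cat.
case: vs eQ => [|X [|]] //=; try tauto; move=> [eX _].
have sP := exec_size eP; have E := ext_sz r2 id sP.
have Eb : teval r1 (ext r2 ws) bt' = teval r1 r2 bt by rewrite /bt' teval_ren E.
have key z : z < teval r1 r2 bt -> (smem X z <-> smem (F r1 r2) z).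
  move=> hz; rewrite (smem_compstep eX) ?Eb // (hq (scons z r1) r2).
  by have := hP _ _ _ eP [:: z] erefl; rewrite /= (ltnW hz) => /(_ isT) ->.
apply: str_ext => z; apply/idP/idP => hz.
  by apply/key => //; apply: leq_trans (smem_lt hz) (hbt _ _).
apply/key => //; rewrite -Eb -meval_std; apply: leq_trans (smem_lt hz) _.
by case: eX.
Qed.

Lemma FAC0_str_def k l F : FAC0_str m k l F ->
  def_strfun sigB1 (V0m m) k l F /\ def_strfun sig11 (V0m m) k l F.
Proof.
move=> /FAC0_strP [F' [hF' hF]]; have [P [gP P0 hP]] := compile_str hF'.
have t0 : sigB0 taut by constructor.
have o0 : sigB0 (FEq2 0 (size P)) by constructor.
split; apply: (prog_strfun hm gP P0) => [|xs Xs ws hx hX /hP <-]; try exact: hF.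
  by apply: (sigB1_ftr _ _ (sigB1_build id S gP t0 o0)).
by apply: (sig11_ftr _ _ (sig11_build id S gP t0 o0)).
Qed.

Lemma slen_strofT n : slen (strof n xpredT) = n.
Proof.
apply/eqP; rewrite eqn_leq slen_strof /=; case: n => // n.
by apply: smem_lt; rewrite smem_strof ltnSn.
Qed.

(** A number is computed as the length of the string of that many ones, which reduces this to
    programs for string functions. *)
Lemma FAC0_num_def k l f : FAC0_num m k l f ->
  def_numfun sigB1 (V0m m) k l f /\ def_numfun sig11 (V0m m) k l f.
Proof.
move=> /FAC0_numP [f' [hf' hf]].
have hT : gdef m (fun _ _ => True) by exists (GImp GBot GBot).
have hF : sdef m (fun r1 r2 => strof (f' r1 r2) xpredT).
  apply: sdef_ext (sdef_strof hf' hT) => r1 r2; congr strof.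
  by apply: funext => z; apply/esym/asboolP.
have [P [gP P0 hP]] := compile_str hF.
have t0 : sigB0 taut by constructor.
have o0 : sigB0 (FEq1 (TVar 0) (TLen 0)) by constructor.
split; apply: (prog_numfun hm gP P0) => [|xs Xs ws hx hX /hP <-]; try by rewrite slen_strofT; apply: hf.
  by apply: (sigB1_ftr _ _ (sigB1_build S id gP t0 o0)).
by apply: (sig11_ftr _ _ (sig11_build S id gP t0 o0)).
Qed.
End Compile.

(** * Transfer to VACC and conclusion *)

Lemma def_str_VACC cls m k l F : 2 <= m -> def_strfun cls (V0m m) k l F -> def_strfun cls VACC k l F.
Proof.
move=> m2 [p [h1 [h2 [h3 [h4 h5]]]]]; exists p; do 4!split => //.
by apply: prov_mono h5 => q [|->]; [left|right; exists m].
Qed.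

Lemma def_num_VACC cls m k l f : 2 <= m -> def_numfun cls (V0m m) k l f -> def_numfun cls VACC k l f.
Proof.
move=> m2 [p [h1 [h2 [h3 [h4 h5]]]]]; exists p; do 4!split => //.
by apply: prov_mono h5 => q [|->]; [left|right; exists m].
Qed.

Theorem mainTheorem11 :
  (forall m : nat, 2 <= m -> forall k l : nat,
     (forall f, def_numfun sig11 (V0m m) k l f <-> FAC0_num m k l f) /\
     (forall f, def_numfun sigB1 (V0m m) k l f <-> FAC0_num m k l f) /\
     (forall F, def_strfun sig11 (V0m m) k l F <-> FAC0_str m k l F) /\
     (forall F, def_strfun sigB1 (V0m m) k l F <-> FAC0_str m k l F)) /\
  (forall k l : nat,
     (forall f, def_numfun sig11 VACC k l f <-> FACC_num k l f) /\
     (forall f, def_numfun sigB1 VACC k l f <-> FACC_num k l f) /\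
     (forall F, def_strfun sig11 VACC k l F <-> FACC_str k l F) /\
     (forall F, def_strfun sigB1 VACC k l F <-> FACC_str k l F)).
Proof.
split=> [m m2 k l|k l].
- have m0 : 0 < m by lia.
  split; [|split; [|split]] => F; split.
  + by move=> [p [/sig11_X hp [_ [_ [hs pr]]]]]; apply: (witness_V0m_num m2 hp hs pr).
  + by move/(FAC0_num_def m0) => [].
  + by move=> [p [/sigB1_X hp [_ [_ [hs pr]]]]]; apply: (witness_V0m_num m2 hp hs pr).
  + by move/(FAC0_num_def m0) => [].
  + by move=> [p [/sig11_X hp [_ [_ [hs pr]]]]]; apply: (witness_V0m_str m2 hp hs pr).
  + by move/(FAC0_str_def m0) => [].
  + by move=> [p [/sigB1_X hp [_ [_ [hs pr]]]]]; apply: (witness_V0m_str m2 hp hs pr).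
  + by move/(FAC0_str_def m0) => [].
- split; [|split; [|split]] => F; split.
  + by move=> [p [/sig11_X hp [_ [_ [hs pr]]]]]; apply: (witness_VACC_num hp hs pr).
  + by move=> [m [m2 h]]; apply: (def_num_VACC m2); case: (FAC0_num_def (ltnW m2) h).
  + by move=> [p [/sigB1_X hp [_ [_ [hs pr]]]]]; apply: (witness_VACC_num hp hs pr).
  + by move=> [m [m2 h]]; apply: (def_num_VACC m2); case: (FAC0_num_def (ltnW m2) h).
  + by move=> [p [/sig11_X hp [_ [_ [hs pr]]]]]; apply: (witness_VACC_str hp hs pr).
  + by move=> [m [m2 h]]; apply: (def_str_VACC m2); case: (FAC0_str_def (ltnW m2) h).
  + by move=> [p [/sigB1_X hp [_ [_ [hs pr]]]]]; apply: (witness_VACC_str hp hs pr).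
  + by move=> [m [m2 h]]; apply: (def_str_VACC m2); case: (FAC0_str_def (ltnW m2) h).
Qed.
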